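(* Let $\Lambda\subset\mathbb{R}^{2d}$ be a lattice and let $g\in H^1_\Lambda(\mathbb{R}^d)$. Let $A_{\Lambda,g}:=S_{\Lambda,g}|_{H^1_\Lambda(\mathbb{R}^d)}$ be the restriction of the frame operator $S_{\Lambda,g}$ to $H^1_\Lambda(\mathbb{R}^d)$, regarded as a bounded operator on the Banach space $H^1_\Lambda(\mathbb{R}^d)$. Then $$\sigma(A_{\Lambda,g})=\sigma(S_{\Lambda,g}),$$ where $\sigma(S_{\Lambda,g})$ is the spectrum of $S_{\Lambda,g}$ as an operator on $L^2(\mathbb{R}^d)$.
   Context: A lattice in $\mathbb{R}^{2d}$ is a set $\Lambda=A\mathbb{Z}^{2d}$ with $A\in\mathbb{R}^{2d\times2d}$ invertible. $T_af(x)=f(x-a)$, $M_bf(x)=e^{2\pi ib\cdot x}f(x)$, $\pi(a,b)=T_aM_b$ for $a,b\in\mathbb{R}^d$. For $g\in L^2(\mathbb{R}^d)$, the analysis operator is $C_{\Lambda,g}f=(\langle f,\pi(\lambda)g\rangle)_{\lambda\in\Lambda}$, and $\mathcal{B}_\Lambda$ is the set of all $g\in L^2(\mathbb{R}^d)$ (Bessel vectors) for which $C_{\Lambda,g}$ is a bounded operator $L^2(\mathbb{R}^d)\to\ell^2(\Lambda)$. For $g\in\mathcal{B}_\Lambda$ the frame operator is $S_{\Lambda,g}=C_{\Lambda,g}^*C_{\Lambda,g}$, i.e. $S_{\Lambda,g}f=\sum_{\lambda\in\Lambda}\langle f,\pi(\lambda)g\rangle\pi(\lambda)g$. $H^1(\mathbb{R}^d)=W^{1,2}(\mathbb{R}^d)$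 is the $L^2$-Sobolev space of order one, and $H^1_\Lambda(\mathbb{R}^d):=H^1(\mathbb{R}^d)\cap\mathcal{B}_\Lambda$ with norm $\|f\|_{H^1_\Lambda}=\|\nabla f\|_{L^2}+\|C_{\Lambda,f}\|_{L^2\to\ell^2}$, where $\|\nabla f\|_{L^2}:=\sum_{j=1}^d\|\partial_jf\|_{L^2}$. This is a Banach space, and for $g\in H^1_\Lambda(\mathbb{R}^d)$ the operator $S_{\Lambda,g}$ maps it boundedly into itself. For a bounded operator $T$ on a complex Banach space $X$, $\sigma(T)$ is the set of $z\in\mathbb{C}$ for which $T-zI:X\to X$ is not bijective. *)

(* Defs.v *)
From HB Require Import structures.
From mathcomp Require Import all_boot all_order all_algebra.
From mathcomp Require Import ring_quotient.
From mathcomp Require Import complex.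
From mathcomp Require Import all_classical all_reals all_analysis.

Set Implicit Arguments.
Unset Strict Implicit.
Unset Printing Implicit Defensive.

Import Order.TTheory GRing.Theory Num.Theory.
Import numFieldNormedType.Exports.
Import ComplexField.Normc.

Local Open Scope classical_set_scope.
Local Open Scope ring_scope.
Local Open Scope complex_scope.
Local Open Scope quotient_scope.

(* R^n is 'cV[R]_n, with the product (= Borel) sigma-algebra. *)
Section measurable_cV.
Context {R : realType} (n : nat).

Let coord (i : 'I_n) (x : 'cV[R]_n) : R := x i 0.

Let cV_set0 : g_sigma_preimage coord set0.
Proof. exact: sigma_algebra0. Qed.

Let cV_setC A : g_sigma_preimage coord A -> g_sigma_preimage coord (~` A).
Proof. exact: sigma_algebraC. Qed.

Let cV_bigcup (F : (set 'cV[R]_n)^nat) :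
  (forall i, g_sigma_preimage coord (F i)) ->
  g_sigma_preimage coord (\bigcup_i (F i)).
Proof. exact: sigma_algebra_bigcup. Qed.

HB.instance Definition _ := @isMeasurable.Build
  (measure_tuple_display default_measure_display)
  'cV[R]_n (g_sigma_preimage coord) cV_set0 cV_setC cV_bigcup.

End measurable_cV.

Section measurable_cV_theory.
Context {R : realType}.

Lemma measurable_cV_coord n (i : 'I_n) :
  measurable_fun [set: 'cV[R]_n] (fun x : 'cV[R]_n => x i 0).
Proof.
move=> _ Y mY; rewrite setTI; apply: sub_sigma_algebra => /=.
rewrite -bigcup_seq/=; exists i => /=; first by rewrite mem_index_enum.
by exists Y => //; rewrite setTI.
Qed.

Lemma measurable_fun_cV d (T : measurableType d) n (f : T -> 'cV[R]_n) :
  (forall i, measurable_fun setT (fun t => f t i 0)) ->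
  measurable_fun setT f.
Proof.
move=> mf _ Y mY; rewrite setTI.
pose coord (i : 'I_n) (x : 'cV[R]_n) : R := x i 0.
have : preimage_set_system setT f (g_sigma_preimage coord) (f @^-1` Y).
  by exists Y => //; rewrite setTI.
rewrite -g_sigma_preimage_comp; apply: smallest_sub.
  exact: sigma_algebra_measurable.
case: n => [|n] in f mf {Y mY} coord *; first by rewrite big_ord0.
rewrite -bigcup_mkord_ord; apply: bigcup_sub => i Ii.
by move=> A [B mB <-]; exact: mf.
Qed.

Definition cV_cons n (p : measurableTypeR R * 'cV[R]_n) : 'cV[R]_n.+1 :=
  \col_i oapp (fun j => p.2 j 0) p.1 (unlift ord0 i).

Definition cV_uncons n (x : 'cV[R]_n.+1) : measurableTypeR R * 'cV[R]_n :=
  (x ord0 0, \col_j x (lift ord0 j) 0).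

Lemma cV_consK n : cancel (@cV_cons n) (@cV_uncons n).
Proof.
move=> [a x]; rewrite /cV_uncons /cV_cons mxE unlift_none/=; congr pair.
by apply/colP => j; rewrite !mxE liftK.
Qed.

Lemma measurable_cV_cons n : measurable_fun setT (@cV_cons n).
Proof.
apply: measurable_fun_cV => i; rewrite /cV_cons; under eq_fun do rewrite mxE.
case: unliftP => [j _|_] /=; last exact: measurable_fst.
exact: (measurableT_comp (measurable_cV_coord j)).
Qed.

Lemma measurable_cV_uncons n : measurable_fun setT (@cV_uncons n).
Proof.
apply: measurable_fun_pair => /=; first exact: measurable_cV_coord.
apply: measurable_fun_cV => i; under eq_fun do rewrite mxE.
exact: measurable_cV_coord.
Qed.

Section step.
Variables (n : nat) (m : {sigma_finite_measure set 'cV[R]_n -> \bar R}).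

Definition lebesgue_cV_step : set 'cV[R]_n.+1 -> \bar R :=
  pushforward (@lebesgue_measure R \x m)%E (@cV_cons n).

(* The library's sigma-finite instance for \x is shadowed by its
   subprobability instance, so that it cannot be inferred. *)
Let product_sigma_finite : sigma_finite setT (@lebesgue_measure R \x m)%E.
Proof.
have /sigma_finiteP[F [TF ndF Foo]] := sigma_finiteT (@lebesgue_measure R).
have /sigma_finiteP[G [TG ndG Goo]] := sigma_finiteT m.
exists (fun k => F k `*` G k).
  rewrite -setXTT TF TG predeqE => -[x y]; split.
    move=> [/= [k _ Fkx] [l _ Gly]]; exists (maxn k l) => //; split.
    - by move: x Fkx; exact/subsetPset/ndF/leq_maxl.
    - by move: y Gly; exact/subsetPset/ndG/leq_maxr.
  by move=> [k _ []/= ? ?]; split; exists k.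
move=> k; have [? ?] := Foo k; have [? ?] := Goo k.
split; first exact: measurableX.
by rewrite product_measure1E// lte_mul_pinfty// ge0_fin_numE.
Qed.

Let step0 : lebesgue_cV_step set0 = 0%E.
Proof. by rewrite /lebesgue_cV_step /pushforward preimage_set0 measure0. Qed.

Let step_ge0 A : (0 <= lebesgue_cV_step A)%E.
Proof. exact: (@measure_ge0 _ _ _ (@lebesgue_measure R \x m)%E). Qed.

Let step_sigma_additive : semi_sigma_additive lebesgue_cV_step.
Proof.
by apply: measure_semi_sigma_additive; exact: measurable_cV_cons.
Qed.

HB.instance Definition _ := isMeasure.Build _ _ _ lebesgue_cV_step
  step0 step_ge0 step_sigma_additive.

Let step_sigma_finite : sigma_finite setT lebesgue_cV_step.
Proof.
have [F UF mF] := product_sigma_finite.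
exists (fun k => @cV_uncons n @^-1` F k).
  by rewrite -preimage_bigcup -UF preimage_setT.
move=> k; have [mFk Fkoo] := mF k; split.
  by rewrite -[X in measurable X]setTI; exact: measurable_cV_uncons.
rewrite /lebesgue_cV_step /pushforward -comp_preimage.
by rewrite (_ : _ \o _ = id) ?preimage_id//; apply/funext/cV_consK.
Qed.

HB.instance Definition _ := Measure_isSigmaFinite.Build _ _ _
  lebesgue_cV_step step_sigma_finite.

End step.

(* Lebesgue measure on R^n, as an iterated product. *)
Fixpoint lebesgue_cV n : {sigma_finite_measure set 'cV[R]_n -> \bar R} :=
  match n return {sigma_finite_measure set 'cV[R]_n -> \bar R} with
  | 0%N => dirac (0 : 'cV[R]_0)
  | n'.+1 => lebesgue_cV_step (lebesgue_cV n')
  end.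

End measurable_cV_theory.

(* L^2(mu) for complex-valued functions: a submodule of T -> R[i], modulo
   equality almost everywhere. *)
Section L2.
Context d (T : measurableType d) (R : realType).
Variable mu : {measure set T -> \bar R}.

Definition square_integrable : {pred T -> R[i]} :=
  [pred f | ((fun x => complex.Re (f x)) \in Lfun mu 2%:E) &&
            ((fun x => complex.Im (f x)) \in Lfun mu 2%:E)].

Let p2 : (1 <= 2%:E :> \bar R)%E.
Proof. by rewrite lee_fin ler1n. Qed.

Let square_integrable_submod_closed : submod_closed square_integrable.
Proof.
have L0 := (Lfun_submod_closed mu p2).1.
have LD := (Lfun_submod_closed mu p2).2.
split; first by rewrite inE; apply/andP; split; exact: L0.
move=> [a b] f g /andP[fr fi] /andP[gr gi]; apply/andP; split.
- have -> : (fun x => complex.Re (((a +i* b) *: f + g) x)) =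
      a *: (fun x => complex.Re (f x)) +
      ((- b) *: (fun x => complex.Im (f x)) + (fun x => complex.Re (g x))).
    apply/funext => x; rewrite !fctE.
    by case: (f x) (g x) => [? ?] [? ?] /=; rewrite -addrA -mulNr.
  by apply: (LD) => //; exact: LD.
- have -> : (fun x => complex.Im (((a +i* b) *: f + g) x)) =
      a *: (fun x => complex.Im (f x)) +
      (b *: (fun x => complex.Re (f x)) + (fun x => complex.Im (g x))).
    apply/funext => x; rewrite !fctE.
    by case: (f x) (g x) => [? ?] [? ?] /=; rewrite -addrA.
  by apply: (LD) => //; exact: LD.
Qed.

HB.instance Definition _ := GRing.isSubmodClosed.Build R[i] (T -> R[i])
  square_integrable square_integrable_submod_closed.

Record L2fun := MkL2fun {
  L2fun_val :> T -> R[i]; _ : L2fun_val \in square_integrable }.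

HB.instance Definition _ := [isSub of L2fun for L2fun_val].
HB.instance Definition _ := [Choice of L2fun by <:].
HB.instance Definition _ := [SubChoice_isSubLmodule of L2fun by <:].

Definition ae_null : {pred L2fun} :=
  [pred f : L2fun | `[< {ae mu, forall x, f x = 0} >]].

Let ae_null_zmod_closed : zmod_closed ae_null.
Proof.
split; first by apply/asboolP; exact: aeW.
move=> f g /asboolP f0 /asboolP g0; apply/asboolP.
apply: filterS2 f0 g0 => x /= fx gx.
by transitivity (f x - g x); [|rewrite fx gx subr0].
Qed.

HB.instance Definition _ := GRing.isZmodClosed.Build L2fun ae_null
  ae_null_zmod_closed.

Lemma ae_nullZ (a : R[i]) (f : L2fun) : f \in ae_null -> a *: f \in ae_null.
Proof.
move=> /asboolP f0; apply/asboolP.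
apply: filterS f0 => x /= fx.
by transitivity (a *: f x); [|rewrite fx scaler0].
Qed.

Definition L2 := Quotient.quot ae_null.

HB.instance Definition _ := GRing.Zmodule.on L2.
HB.instance Definition _ := EqQuotient.on L2.

Definition L2_scale (a : R[i]) (f : L2) : L2 := \pi_L2 (a *: repr f).

Lemma L2_scale_pi (a : R[i]) (f : L2fun) :
  L2_scale a (\pi_L2 f) = \pi_L2 (a *: f).
Proof.
rewrite /L2_scale; apply/eqP; rewrite -Quotient.idealrBE -scalerBr.
by apply: ae_nullZ; rewrite Quotient.idealrBE reprK.
Qed.

Let L2_scaleA a b f : L2_scale a (L2_scale b f) = L2_scale (a * b) f.
Proof.
rewrite -[f]reprK (L2_scale_pi b (repr f)) (L2_scale_pi a) L2_scale_pi.
by rewrite scalerA.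
Qed.

Let L2_scale1 : left_id 1 L2_scale.
Proof. by move=> f; rewrite -[f]reprK L2_scale_pi scale1r. Qed.

Let L2_scaleDr : right_distributive L2_scale +%R.
Proof.
move=> a f g; rewrite -[f]reprK -[g]reprK -[LHS]/(L2_scale a _).
by rewrite -(raddfD \pi_L2) !L2_scale_pi scalerDr raddfD.
Qed.

Let L2_scaleDl f : {morph L2_scale^~ f : a b / a + b}.
Proof.
by move=> a b; rewrite -[f]reprK !L2_scale_pi scalerDl raddfD.
Qed.

HB.instance Definition _ := GRing.Zmodule_isLmodule.Build R[i] L2
  L2_scaleA L2_scale1 L2_scaleDr L2_scaleDl.

(* Classes are used as functions through a chosen representative; the integrals
   and inner products below do not depend on the choice. *)
Definition L2_repr (f : L2) : T -> R[i] := L2fun_val (repr f).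
Coercion L2_repr : L2 >-> Funclass.

End L2.

Definition cintegral d (T : measurableType d) (R : realType)
    (mu : {measure set T -> \bar R}) (f : T -> R[i]) : R[i] :=
  (\int[mu]_x complex.Re (f x)) +i* (\int[mu]_x complex.Im (f x)).

Definition inner d (T : measurableType d) (R : realType)
    (mu : {measure set T -> \bar R}) (f g : T -> R[i]) : R[i] :=
  cintegral mu (fun x => f x * (g x)^*).

(* Absolutely convergent sums over an index set D. *)
Definition rsum (I : choiceType) (R : realType) (D : set I) (u : I -> R) : R :=
  fine (\esum_(i in D) (u^\+ i)%:E) - fine (\esum_(i in D) (u^\- i)%:E).

Definition csum (I : choiceType) (R : realType) (D : set I) (u : I -> R[i]) :
    R[i] :=
  rsum D (fun i => complex.Re (u i)) +i* rsum D (fun i => complex.Im (u i)).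

Definition l2norm (I : choiceType) (R : realType) (D : set I) (u : I -> R[i]) :
    \bar R :=
  ((\esum_(i in D) (normc (u i) ^+ 2)%:E) `^ 2^-1)%E.

Definition l2inner (I : choiceType) (R : realType) (D : set I)
    (u v : I -> R[i]) : R[i] :=
  csum D (fun i => u i * (v i)^*).

Notation L2Rd R d := (L2 (@lebesgue_cV R d)).

Section gabor.
Context {R : realType} {d : nat}.
Local Notation Rd := 'cV[R]_d.
Local Notation R2d := 'cV[R]_(d + d).
Local Notation mu := (@lebesgue_cV R d).
Local Notation L2Rd := (L2Rd R d).

Definition is_lattice (Lambda : set R2d) : Prop :=
  exists2 A : 'M[R]_(d + d), A \in unitmx &
    Lambda = range (fun z : 'cV[int]_(d + d) => A *m map_mx intr z).

Definition expi (t : R) : R[i] := cos t +i* sin t.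

Definition translation (a : Rd) (f : Rd -> R[i]) : Rd -> R[i] :=
  fun x => f (x - a).

Definition modulation (b : Rd) (f : Rd -> R[i]) : Rd -> R[i] :=
  fun x => expi (2 * pi * (\sum_i b i 0 * x i 0)) * f x.

(* a point of R^(2d) is the column of its components a and b, in this order *)
Definition tfshift (l : R2d) (f : Rd -> R[i]) : Rd -> R[i] :=
  translation (usubmx l) (modulation (dsubmx l) f).

Definition analysis (g f : L2Rd) (l : R2d) : R[i] :=
  inner mu f (tfshift l g).

Definition L2norm (f : L2Rd) : \bar R :=
  'N[mu]_2%:E[EFin \o (@normc R \o f)]%E.

Definition bessel (Lambda : set R2d) : set L2Rd :=
  [set g : L2Rd | exists M : R, forall f : L2Rd,
    (l2norm Lambda (analysis g f) <= M%:E * L2norm f)%E].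

(* The adjoint of the analysis operator; the element h below exists and is
   unique when g is a Bessel vector and c is in l^2(Lambda). *)
Definition synthesis (Lambda : set R2d) (g : L2Rd) (c : R2d -> R[i]) : L2Rd :=
  xget 0 [set h : L2Rd | forall f : L2Rd,
    inner mu f h = l2inner Lambda (analysis g f) c].

Definition frame_op (Lambda : set R2d) (g : L2Rd) : L2Rd -> L2Rd :=
  fun f => synthesis Lambda g (analysis g f).

Definition partial (j : 'I_d) (phi : Rd -> R) : Rd -> R :=
  'D_(delta_mx j 0) phi.

Fixpoint Ck (k : nat) (phi : Rd -> R) : Prop :=
  continuous phi /\
  if k is k'.+1 then
    forall j, (forall x, derivable phi x (delta_mx j 0)) /\ Ck k' (partial j phi)
  else True.

Definition test_function (phi : Rd -> R) : Prop :=
  (forall k, Ck k phi) /\ compact (closure [set x | phi x != 0]).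

Definition weak_partial (j : 'I_d) (f h : L2Rd) : Prop :=
  forall phi, test_function phi ->
    cintegral mu (fun x => f x * (partial j phi x)%:C) =
    - cintegral mu (fun x => h x * (phi x)%:C).

Definition H1 : set L2Rd :=
  [set f : L2Rd | forall j, exists h : L2Rd, weak_partial j f h].

Definition H1Lambda (Lambda : set R2d) : set L2Rd := H1 `&` bessel Lambda.

End gabor.

(* No norm enters: for a bounded operator of a Banach space, bijectivity of
   T - z is all that is asked. *)
Definition spectrum (K : fieldType) (V : lmodType K) (T : V -> V) : set K :=
  [set z | ~ bijective (fun f => T f - z *: f)].

(* The spectrum of the restriction of T to an invariant subspace X: set_bij
   also requires T - z to map X into X. *)
Definition spectrum_on (K : fieldType) (V : lmodType K) (X : set V)
    (T : V -> V) : set K :=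
  [set z | ~ set_bij X X (fun f => T f - z *: f)].

(* Main.v *)
Require Import Defs.
From mathcomp Require Import all_boot all_order all_algebra.
From mathcomp Require Import complex ring lra.
From mathcomp Require Import all_classical all_reals all_analysis.
From mathcomp Require Import measurable_realfun.

Set Implicit Arguments.
Unset Strict Implicit.
Unset Printing Implicit Defensive.

Import Order.TTheory GRing.Theory Num.Theory.
Import numFieldNormedType.Exports.
Import ComplexField.Normc.

Local Open Scope ring_scope.
Local Open Scope complex_scope.
Local Open Scope quotient_scope.

(* Write S_(g,h) f for the sum over Lambda of <f, pi(l) g> pi(l) h.  A function
   lies in H^1 iff its translates satisfy |T_t f - f| <= K |t|: one direction
   integrates along the translation group, the other is Riesz representation of
   the weak derivative; both use that test functions are dense in L^2.  Hence
   H^1_Lambda is the space of Lipschitz Bessel vectors, and the statement is about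
   a Hilbert space with a projective unitary representation.

   If S - z is bijective on L^2 with inverse R, then R commutes with pi(Lambda)
   and so preserves Bessel vectors.  For h = R f,
   T h - h = R ((T f - f) - (S_(Tg,Tg) - S_(g,g)) T h), and the second term is
   O(|T g - g|) because |S_(u,h) k| <= b_h b_k |u| with the Bessel bounds b.  That
   estimate comes from Lax's lemma: the adjoint of Q : h |-> S_(g,h) f is
   k |-> S_(f,k) g, so the iterates of Q^* Q grow at most like (b_f b_g)^(2 n) on
   Bessel vectors, which bounds the symmetric operator Q^* Q in the Hilbert norm.

   Conversely, let S - z be bijective on H^1_Lambda.  As S is self-adjoint only
   real z matter.  The inverse is bounded for the seminorms defining H^1_Lambda
   (uniform boundedness) and symmetric, so Lax's lemma bounds it in the L^2 norm.
   Since H^1_Lambda is dense, S - z is bijective on L^2.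

   Density requires test functions phi to be Bessel vectors.  By Schur's test it
   suffices that <pi(l) phi, phi> is summable over Lambda.  It vanishes for large
   time shifts, and it decays rapidly in the frequency b because a translation by
   1 / (2 b) anticommutes with the modulation. *)

(** * Hilbert spaces *)

(** Neither completeness of H^1_Lambda nor an open mapping theorem is used. The norm of H^1_Lambda
    is replaced by a family of seminorms, each continuous on L^2; their supremum is finite exactly
    on H^1_Lambda, and closedness of its balls in L^2 takes the place of completeness. The inverse
    of S - z is bounded in two stages: first from these seminorms to L^2, where symmetry makes each
    functional x |-> <(S - z)^-1 x, k> continuous, then from the seminorms to themselves. The
    obstacle in the other direction is that T g - g is known to be small in L^2 only; no smallness
    of its Bessel bound is available. Hence an estimate of S_(g,h) f must put the L^2 norm on the
    one small argument and Bessel bounds on the other two. For f this is immediate and for g it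
    follows by replacing l with -l; for h it is not visible from the series. The phases of the
    projective representation are never computed in the abstract part, since each meets its
    conjugate. *)

Section complex_facts.
Variable R : realType.
Implicit Types z w : R[i].

Lemma normcE2 z : normc z ^+ 2 = complex.Re z ^+ 2 + complex.Im z ^+ 2.
Proof. by case: z => a b /=; rewrite sqr_sqrtr// addr_ge0// sqr_ge0. Qed.

Lemma normc_ge0 z : 0 <= normc z.
Proof. by case: z => a b /=; rewrite sqrtr_ge0. Qed.

Lemma normcJ z : normc (conjc z) = normc z.
Proof. by case: z => a b /=; rewrite sqrrN. Qed.

Lemma mulcJ z : z * (conjc z) = (normc z ^+ 2)%:C.
Proof.
rewrite normcE2; case: z => a b; apply/eqP; rewrite eq_complex/=.
by apply/andP; split; apply/eqP; ring.
Qed.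

Lemma Re_le_normc z : `|complex.Re z| <= normc z.
Proof.
rewrite -(@ler_pXn2r _ 2)// ?nnegrE ?normc_ge0// real_normK ?num_real//.
by rewrite normcE2 lerDl sqr_ge0.
Qed.

Lemma Im_le_normc z : `|complex.Im z| <= normc z.
Proof.
rewrite -(@ler_pXn2r _ 2)// ?nnegrE ?normc_ge0// real_normK ?num_real//.
by rewrite normcE2 lerDr sqr_ge0.
Qed.

Lemma normc_real (a : R) : normc a%:C = `|a|.
Proof. by rewrite /= expr0n/= addr0 sqrtr_sqr. Qed.

Lemma normc_eq0P z : normc z = 0 -> z = 0.
Proof. exact: eq0_normc. Qed.

Lemma ReD z w : complex.Re (z + w) = complex.Re z + complex.Re w.
Proof. by case: z; case: w. Qed.
Lemma ImD z w : complex.Im (z + w) = complex.Im z + complex.Im w.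
Proof. by case: z; case: w. Qed.
Lemma ReN z : complex.Re (- z) = - complex.Re z.
Proof. by case: z. Qed.
Lemma ImN z : complex.Im (- z) = - complex.Im z.
Proof. by case: z. Qed.
Lemma ReB z w : complex.Re (z - w) = complex.Re z - complex.Re w.
Proof. by rewrite ReD ReN. Qed.
Lemma ReJ z : complex.Re (conjc z) = complex.Re z. Proof. by case: z. Qed.
Lemma ImJ z : complex.Im (conjc z) = - complex.Im z. Proof. by case: z. Qed.
Lemma ReZ (a : R) z : complex.Re (a%:C * z) = a * complex.Re z.
Proof. by case: z => b c /=; rewrite mul0r subr0. Qed.
Lemma ImZ (a : R) z : complex.Im (a%:C * z) = a * complex.Im z.
Proof. by case: z => b c /=; rewrite mul0r addr0. Qed.
Lemma complexP z w : complex.Re z = complex.Re w ->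
  complex.Im z = complex.Im w -> z = w.
Proof. by case: z => ? ?; case: w => ? ? /= -> ->. Qed.
Lemma conjcR (a : R) : (conjc (a%:C : R[i])) = a%:C.
Proof. by rewrite /= oppr0. Qed.
Lemma conjcM z w : (conjc (z * w)) = (conjc z) * (conjc w).
Proof. exact: rmorphM. Qed.
Lemma conjcD z w : (conjc (z + w)) = (conjc z) + (conjc w).
Proof. exact: rmorphD. Qed.

(** Multiplying a vector by this phase reduces the estimate of a modulus to that of a real part. *)
Lemma normc_phase z : exists2 c : R[i], normc c = 1 & c * z = (normc z)%:C.
Proof.
have [->|z0] := eqVneq z 0.
  by exists 1; rewrite ?normc1// mulr0 normc0.
have nz0 : normc z != 0 by apply: contra_neq z0; exact: eq0_normc.
exists ((normc z)^-1%:C * (conjc z)).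
  by rewrite normcM normc_real normcJ normfV ger0_norm ?normc_ge0// mulVf.
rewrite -mulrA (mulrC (conjc z)) mulcJ -rmorphM/= expr2 mulrA mulVf// mul1r//.
Qed.

End complex_facts.

Section hilbert.
Variables (R : realType) (V : lmodType R[i]).

(** Completeness is asked only of sequences with increments at most [2^-1 ^+ n]. Every Cauchy
    sequence has such a subsequence, and Riesz-Fischer delivers exactly this form. *)
Record is_hilbert (ip : V -> V -> R[i]) : Prop := IsHilbert {
  ipDl : forall x y z, ip (x + y) z = ip x z + ip y z;
  ipZl : forall a x z, ip (a *: x) z = a * ip x z;
  ipC : forall x y, ip y x = (conjc (ip x y));
  ip_ge0 : forall x, 0 <= complex.Re (ip x x);
  ip_eq0 : forall x, ip x x = 0 -> x = 0;
  ip_complete : forall u : nat -> V,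
    (forall n, Num.sqrt (complex.Re (ip (u n.+1 - u n) (u n.+1 - u n)))
                 <= 2^-1 ^+ n) ->
    exists x, forall e, 0 < e -> exists N, forall n, (N <= n)%N ->
      Num.sqrt (complex.Re (ip (x - u n) (x - u n))) <= e }.

Variable ip : V -> V -> R[i].
Hypothesis hip : is_hilbert ip.

Definition nrm x := Num.sqrt (complex.Re (ip x x)).

Definition cvgV (u : nat -> V) (x : V) := forall e, 0 < e ->
  exists N, forall n, (N <= n)%N -> nrm (x - u n) <= e.

Lemma ip0l x : ip 0 x = 0.
Proof. by rewrite -(scale0r 0) (ipZl hip) mul0r. Qed.
Lemma ip0r x : ip x 0 = 0.
Proof. by rewrite (ipC hip) ip0l conjc0. Qed.
Lemma ipNl x y : ip (- x) y = - ip x y.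
Proof. by rewrite -scaleN1r (ipZl hip) mulN1r. Qed.
Lemma ipBl x y z : ip (x - y) z = ip x z - ip y z.
Proof. by rewrite (ipDl hip) ipNl. Qed.
Lemma ipDr x y z : ip x (y + z) = ip x y + ip x z.
Proof. by rewrite (ipC hip) (ipDl hip) rmorphD/= -!(ipC hip). Qed.
Lemma ipZr a x z : ip x (a *: z) = (conjc a) * ip x z.
Proof. by rewrite (ipC hip) (ipZl hip) rmorphM/= -(ipC hip). Qed.
Lemma ipNr x y : ip x (- y) = - ip x y.
Proof. by rewrite (ipC hip) ipNl rmorphN/= -(ipC hip). Qed.
Lemma ipBr x y z : ip x (y - z) = ip x y - ip x z.
Proof. by rewrite ipDr ipNr. Qed.
Lemma ip_suml I (s : seq I) (F : I -> V) x :
  ip (\sum_(i <- s) F i) x = \sum_(i <- s) ip (F i) x.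
Proof. by apply: (big_morph (ip^~ x)) => [a b|]; rewrite ?(ipDl hip) ?ip0l. Qed.
Lemma ip_sumr I (s : seq I) (F : I -> V) x :
  ip x (\sum_(i <- s) F i) = \sum_(i <- s) ip x (F i).
Proof. by apply: (big_morph (ip x)) => [a b|]; rewrite ?ipDr ?ip0r. Qed.
Lemma ReipC x y : complex.Re (ip y x) = complex.Re (ip x y).
Proof. by rewrite (ipC hip) ReJ. Qed.

Lemma nrm_ge0 x : 0 <= nrm x. Proof. exact: sqrtr_ge0. Qed.
#[local] Hint Resolve nrm_ge0 : core.
Lemma sqr_nrm x : nrm x ^+ 2 = complex.Re (ip x x).
Proof. by rewrite sqr_sqrtr// (ip_ge0 hip). Qed.
Lemma ipxx x : ip x x = (nrm x ^+ 2)%:C.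
Proof.
apply: complexP => /=; first by rewrite sqr_nrm.
have := congr1 (@complex.Im R) (ipC hip x x); rewrite ImJ => h.
lra.
Qed.
Lemma nrm0 : nrm 0 = 0. Proof. by rewrite /nrm ip0l sqrtr0. Qed.
Lemma nrm_eq0 x : nrm x = 0 -> x = 0.
Proof. by move=> h; apply: (ip_eq0 hip); rewrite ipxx h expr0n. Qed.
Lemma nrmZ a x : nrm (a *: x) = normc a * nrm x.
Proof.
apply/eqP; rewrite -(@eqrXn2 _ 2)// ?mulr_ge0 ?normc_ge0//; apply/eqP.
rewrite exprMn !sqr_nrm (ipZl hip) ipZr mulrA mulcJ ReZ//.
Qed.
Lemma nrmN x : nrm (- x) = nrm x.
Proof. by rewrite -scaleN1r nrmZ normcN normc1 mul1r. Qed.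
Lemma nrmBC x y : nrm (x - y) = nrm (y - x).
Proof. by rewrite -nrmN opprB. Qed.

Lemma sqr_nrmD x y :
  nrm (x + y) ^+ 2 = nrm x ^+ 2 + nrm y ^+ 2 + 2 * complex.Re (ip x y).
Proof.
rewrite !sqr_nrm (ipDl hip) !ipDr !ReD [complex.Re (ip y x)]ReipC.
ring.
Qed.

Lemma sqr_nrmB x y :
  nrm (x - y) ^+ 2 = nrm x ^+ 2 + nrm y ^+ 2 - 2 * complex.Re (ip x y).
Proof. by rewrite sqr_nrmD nrmN ipNr ReN mulrN. Qed.

Lemma ReCS x y : complex.Re (ip x y) <= nrm x * nrm y.
Proof.
have [x0|x0] := eqVneq (nrm x) 0; first by rewrite (nrm_eq0 x0) ip0l nrm0 mul0r.
have [y0|y0] := eqVneq (nrm y) 0; first by rewrite (nrm_eq0 y0) ip0r nrm0 mulr0.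
have xp : 0 < nrm x by rewrite lt_def x0 nrm_ge0.
have yp : 0 < nrm y by rewrite lt_def y0 nrm_ge0.
have := sqr_ge0 (nrm ((nrm y)%:C *: x - (nrm x)%:C *: y)).
rewrite sqr_nrmB !nrmZ !normc_real !(ger0_norm (nrm_ge0 _)) (ipZl hip) ipZr.
rewrite conjcR ReZ ReZ => h.
have : 0 <= 2 * (nrm x * nrm y) * (nrm x * nrm y - complex.Re (ip x y)).
  by apply: le_trans h _; rewrite le_eqVlt; apply/orP; left; apply/eqP; ring.
by rewrite pmulr_rge0 ?subr_ge0// !mulr_gt0.
Qed.

Lemma CS x y : normc (ip x y) <= nrm x * nrm y.
Proof.
have [c c1 h] := normc_phase (ip x y).
have -> : normc (ip x y) = complex.Re (ip (c *: x) y) by rewrite (ipZl hip) h.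
by apply: le_trans (ReCS _ _) _; rewrite nrmZ c1 mul1r.
Qed.

Lemma nrmD x y : nrm (x + y) <= nrm x + nrm y.
Proof.
rewrite -(@ler_pXn2r _ 2)// ?nnegrE ?addr_ge0// sqr_nrmD sqrrD.
by have := ReCS x y; rewrite mulr2n; lra.
Qed.
Lemma nrmB x y : nrm (x - y) <= nrm x + nrm y.
Proof. by rewrite -(nrmN y) nrmD. Qed.
Lemma nrm_tri y x z : nrm (x - z) <= nrm (x - y) + nrm (y - z).
Proof. by apply: le_trans (nrmD _ _); rewrite addrA subrK. Qed.
Lemma nrm_sum I (s : seq I) (F : I -> V) :
  nrm (\sum_(i <- s) F i) <= \sum_(i <- s) nrm (F i).
Proof.
elim: s => [|a s IH]; first by rewrite !big_nil nrm0.
by rewrite !big_cons; apply: le_trans (nrmD _ _) _; rewrite lerD2l.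
Qed.

Lemma nrm_le_ip x M : 0 <= M ->
  (forall y, normc (ip x y) <= M * nrm y) -> nrm x <= M.
Proof.
move=> M0 h; have := h x; rewrite ipxx normc_real ger0_norm ?sqr_ge0// expr2.
have [->//|x0] := eqVneq (nrm x) 0.
by rewrite ler_pM2r// lt_def x0 nrm_ge0.
Qed.

Lemma ip_inj x y : (forall k, ip k x = ip k y) -> x = y.
Proof.
move=> h; apply/eqP; rewrite -subr_eq0; apply/eqP/(ip_eq0 hip).
by rewrite ipBr h subrr.
Qed.

Lemma cvgV_uniq u x y : cvgV u x -> cvgV u y -> x = y.
Proof.
move=> ux uy; apply/eqP; rewrite -subr_eq0; apply/eqP/nrm_eq0/eqP.
rewrite eq_le nrm_ge0 andbT; apply/ler_addgt0Pr => e e0; rewrite add0r.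
have [N hN] := ux _ (divr_gt0 e0 (ltr0n _ 2)).
have [N' hN'] := uy _ (divr_gt0 e0 (ltr0n _ 2)).
have := nrm_tri (u (maxn N N')) x y; rewrite (nrmBC (u _) y).
have := hN _ (leq_maxl N N'); have := hN' _ (leq_maxr N N'); lra.
Qed.

Lemma cvgV_closed (q : V -> R) (c M : R) u x : 0 <= c ->
  (forall a b, q a <= q b + c * nrm (a - b)) ->
  cvgV u x -> (exists N, forall n, (N <= n)%N -> q (u n) <= M) -> q x <= M.
Proof.
move=> c0 hq ux [N hN]; apply/ler_addgt0Pr => e e0.
have e'0 : 0 < e / (c + 1) by rewrite divr_gt0// ltr_wpDl.
have [N' hN'] := ux _ e'0.
have h := hN' _ (leq_maxr N N'); have {}hN := hN _ (leq_maxl N N').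
apply: le_trans (hq _ (u (maxn N N'))) _; apply: lerD => //.
apply: le_trans (ler_wpM2l c0 h) _.
rewrite mulrCA ger_pMr// ler_pdivrMr ?ltr_wpDl// mul1r; lra.
Qed.

Lemma half_ltn (e : R) : 0 < e -> exists N, forall n, (N <= n)%N -> 2^-1 ^+ n <= e.
Proof.
move=> e0; have [N hN] : exists N : nat, e^-1 <= N%:R.
  by exists (Num.bound e^-1); rewrite ltW// archi_boundP// invr_ge0 ltW.
exists N => n Nn; rewrite exprVn -[leRHS]invrK lef_pV2 ?posrE ?exprn_gt0 ?invr_gt0//.
apply: le_trans hN _; rewrite -natrX ler_nat; apply: leq_trans Nn _.
exact/ltnW/ltn_expl.
Qed.

Lemma cvgV_geometric (a : R) (u : nat -> V) :
  (forall n, nrm (u n.+1 - u n) <= a * 2^-1 ^+ n) -> exists x, cvgV u x.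
Proof.
move=> hu; have a0 : 0 <= a by have := hu 0%N; rewrite expr0 mulr1; exact: le_trans.
have a1 : 0 < a + 1 by rewrite ltr_wpDl.
(* The scaling is by [a + 1] rather than [a], which may be 0. *)
have [|x hx] := ip_complete hip (u := fun n => (a + 1)^-1%:C *: u n).
  move=> n; rewrite -/(nrm _) -scalerBr nrmZ normc_real ger0_norm; last by rewrite invr_ge0 ltW.
  rewrite ler_pdivrMl//; apply: le_trans (hu n) _.
  by rewrite ler_wpM2r ?exprn_ge0 ?invr_ge0// lerDl.
exists ((a + 1)%:C *: x) => e e0.
have [|N hN] := hx (e / (a + 1)); first by rewrite divr_gt0.
exists N => n /hN; rewrite -/(nrm _) ler_pdivlMr//; apply: le_trans.
have -> : (a + 1)%:C *: x - u n = (a + 1)%:C *: (x - (a + 1)^-1%:C *: u n).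
  by rewrite scalerBr scalerA -rmorphM/= mulfV ?gt_eqF// scale1r.
by rewrite nrmZ normc_real gtr0_norm// mulrC.
Qed.

Section submodule.
Variable M : set V.
Hypothesis M0 : M 0.
Hypothesis MD : forall x y, M x -> M y -> M (x + y).
Hypothesis MZ : forall a x, M x -> M (a *: x).

(* Minimise [|y|^2 - 2 Re (L y)] over M: by the parallelogram identity a
   minimising sequence is Cauchy, and its limit represents L. *)
Lemma riesz_sub (L : V -> R[i]) (K : R) :
  (forall x y, M x -> M y -> L (x + y) = L x + L y) ->
  (forall a x, M x -> L (a *: x) = a * L x) ->
  (forall x, M x -> normc (L x) <= K * nrm x) ->
  exists h, (forall y, M y -> L y = ip y h) /\
    (forall e, 0 < e -> exists2 m, M m & nrm (h - m) <= e).
Proof.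
move=> LD LZ LK.
pose J y := nrm y ^+ 2 - 2 * complex.Re (L y).
pose E := [set J y | y in M]%classic.
have lbE : lbound E (- K ^+ 2).
  move=> _ [y My <-]; rewrite /J; have := LK _ My.
  have := Re_le_normc (L y); have := ler_norm (complex.Re (L y)).
  have := sqr_ge0 (nrm y - K); rewrite sqrrB mulr2n; lra.
have hE : has_inf E by split; [exists (J 0); exists 0|exists (- K ^+ 2)].
(* With this excess the parallelogram identity gives [nrm (u n.+1 - u n) ^+ 2 <= 5/8 * (2^-1 ^+ n)
   ^+ 2]. *)
have /choice[u hu] : forall n, exists v,
    M v /\ J v <= inf E + (2^-1 ^+ n) ^+ 2 / 4.
  move=> n; have [|_ [v Mv <-] hv] := inf_adherent (eps := (2^-1 ^+ n) ^+ 2 / 4) _ hE.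
    by rewrite divr_gt0// !exprn_gt0// invr_gt0.
  by exists v; split=> //; exact: ltW.
have Jinf y : M y -> inf E <= J y.
  by move=> My; apply: ge_inf; [exists (- K ^+ 2)|exists y].
have [n|h uh] := @cvgV_geometric 1 u.
  rewrite mul1r -(@ler_pXn2r _ 2)// ?nnegrE ?exprn_ge0// ?invr_ge0//.
  have [Mu Ju] := hu n; have [Mu' Ju'] := hu n.+1.
  have := Jinf _ (MZ (2^-1)%:C (MD Mu Mu')).
  rewrite /J nrmZ normc_real exprMn real_normK ?num_real// sqr_nrmD.
  rewrite LZ ?LD//; last exact: MD.
  rewrite ReZ ReD; move: Ju Ju'; rewrite /J sqr_nrmB [complex.Re (ip (u n.+1) _)]ReipC.
  rewrite (exprS _ n) exprMn; have := sqr_ge0 ((2 : R)^-1 ^+ n); lra.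
exists h; split; last first.
  by move=> e /uh[N hN]; exists (u N); [case: (hu N)|exact: hN].
have key y : M y -> complex.Re (L y) = complex.Re (ip y h).
  move=> My; set D := complex.Re (ip y h) - complex.Re (L y).
  (* First variation of J at the minimiser in the direction [t * y]. As h need not lie in M, the
     inequality is obtained along [u n] and passed to the limit. *)
  have hD t : - (2 * t * D) <= t ^+ 2 * nrm y ^+ 2.
    apply/ler_addgt0Pr => e e0.
    rewrite /D mulrBr opprB lerBlDr -lerBlDl.
    rewrite -lerN2.
    apply: (@cvgV_closed (fun x => - (2 * t * complex.Re (ip y x))) (`|2 * t| * nrm y) _ u h) => //.
    - by rewrite mulr_ge0.
    - move=> a b; rewrite -lerBlDl opprK addrC -mulrBr -ReB -ipBr.
      apply: le_trans (ler_norm _) _; rewrite normrM -mulrA ler_wpM2l//.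
      rewrite -(nrmBC b).
      exact: le_trans (Re_le_normc _) (CS _ _).
    - have [N hN] := half_ltn e0; exists N => n /hN h1.
      have [Mu Ju] := hu n; have := Jinf _ (MD Mu (MZ t%:C My)).
      have q1 : (2^-1 : R) ^+ n <= 1.
        by rewrite exprn_ile1// ?invr_ge0// invf_le1// ler1n.
      have q0 : 0 <= (2^-1 : R) ^+ n by rewrite exprn_ge0// invr_ge0.
      have q2 : ((2^-1 : R) ^+ n) ^+ 2 <= 2^-1 ^+ n by rewrite expr2 ler_piMl.
      rewrite /J sqr_nrmD nrmZ normc_real exprMn real_normK ?num_real//.
      rewrite LD ?LZ//; last exact: MZ.
      rewrite ipZr conjcR !ReD !ReZ (ReipC y); move: Ju; rewrite /J; lra.
  have N0 : 0 <= nrm y ^+ 2 by rewrite exprn_ge0.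
  have s0 : 0 < (nrm y ^+ 2 + 1)^-1 by rewrite invr_gt0 ltr_wpDl.
  have sN : (nrm y ^+ 2 + 1)^-1 * nrm y ^+ 2 <= 1.
    by rewrite ler_pdivrMl ?ltr_wpDl// mulr1 lerDl.
  (* At [t = - D * s] the variation reads [2 * D^2 * s <= D^2 * s^2 * N], and [s * N <= 1] then
     forces [D = 0]. *)
  have := hD (- (D * (nrm y ^+ 2 + 1)^-1)); rewrite sqrrN exprMn.
  set s := (nrm y ^+ 2 + 1)^-1 in s0 sN *; set N := nrm y ^+ 2 in sN *.
  have : D ^+ 2 * s * (s * N) <= D ^+ 2 * s * 1.
    by rewrite ler_wpM2l// mulr_ge0 ?sqr_ge0// ltW.
  have := sqr_ge0 D => D0 h1 h2.
  have {h1 h2} : D ^+ 2 * s <= 0.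
    have e1 : - (2 * - (D * s) * D) = 2 * (D ^+ 2 * s) by ring.
    have e2 : D ^+ 2 * s ^+ 2 * N = D ^+ 2 * s * (s * N) by ring.
    by rewrite e1 e2 in h2; lra.
  rewrite pmulr_lle0// => D1.
  by apply/esym/eqP; rewrite -subr_eq0 -/D -sqrf_eq0 eq_le D1 D0.
move=> y My; apply: complexP; first exact: key.
(* The imaginary part of L at y is minus its real part at ['i *: y]. *)
have := key _ (MZ 'i%C My); rewrite LZ// (ipZl hip).
by rewrite !(mulrC 'i%C) !ReiNIm => /oppr_inj.
Qed.
End submodule.

Definition lin (T : V -> V) :=
  (forall x y, T (x + y) = T x + T y) /\ (forall a x, T (a *: x) = a *: T x).

Lemma linB T x y : lin T -> T (x - y) = T x - T y.
Proof. by move=> [TD TZ]; rewrite TD -scaleN1r TZ scaleN1r. Qed.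

Lemma lin0 T : lin T -> T 0 = 0.
Proof. by move=> hT; rewrite -[in LHS](subrr 0) (linB _ _ hT) subrr. Qed.

Lemma riesz (L : V -> R[i]) (K : R) :
  (forall x y, L (x + y) = L x + L y) -> (forall a x, L (a *: x) = a * L x) ->
  (forall x, normc (L x) <= K * nrm x) -> exists h, forall y, L y = ip y h.
Proof.
move=> LD LZ LK.
have [x y _ _|a x _|x _|h [h1 _]] :=
  @riesz_sub setT I (fun _ _ _ _ => I) (fun _ _ _ => I) L K.
- exact: LD.
- exact: LZ.
- exact: LK.
- by exists h => y; exact: h1.
Qed.

(** On M the functional [ip x k] is represented by a point h of the closure of M. Then [k - h] is
    orthogonal to M, so k itself lies in that closure. *)
Lemma dense_of_orthogonal (M : set V) : M 0 ->
  (forall x y, M x -> M y -> M (x + y)) -> (forall a x, M x -> M (a *: x)) ->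
  (forall k, (forall m, M m -> ip m k = 0) -> k = 0) ->
  forall k e, 0 < e -> exists2 m, M m & nrm (k - m) <= e.
Proof.
move=> M0 MD MZ Mperp k.
have [x y _ _|a x _|x _|h [h1 h2]] :=
    @riesz_sub M M0 MD MZ (fun x => ip x k) (nrm k).
- exact: (ipDl hip).
- exact: (ipZl hip).
- by rewrite mulrC; exact: CS.
suff -> : k = h by [].
apply/eqP; rewrite -subr_eq0; apply/eqP/Mperp => m Mm.
by rewrite ipBr h1// subrr.
Qed.

Lemma adjoint (T : V -> V) (c : R) : lin T -> (forall x, nrm (T x) <= c * nrm x) ->
  exists T', forall x y, ip (T x) y = ip x (T' y).
Proof.
move=> [TD TZ] Tc.
suff /choice[T' hT'] : forall y, exists y', forall x, ip (T x) y = ip x y'.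
  by exists T' => x y; exact: hT'.
move=> y; apply: (@riesz _ (c * nrm y)) => [a b|a b|x].
- by rewrite TD (ipDl hip).
- by rewrite TZ (ipZl hip).
- by apply: le_trans (CS _ _) _; rewrite mulrAC ler_wpM2r.
Qed.

(** The one-sided Lipschitz condition admits functionals that are differences of norms. *)
Lemma dense_le (D : set V) (p : V -> R) (c K : R) :
  (forall k e, 0 < e -> exists2 m, D m & nrm (k - m) <= e) ->
  0 <= c -> (forall a b, p a <= p b + c * nrm (a - b)) ->
  (forall x, D x -> p x <= K) -> forall x, p x <= K.
Proof.
move=> Dd c0 pc Dp x.
have /choice[u hu] : forall n : nat, exists v, D v /\ nrm (x - v) <= 2^-1 ^+ n.
  by move=> n; have [|v Dv xv] := Dd x (2^-1 ^+ n);
    [rewrite exprn_gt0// invr_gt0|exists v].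
apply: (cvgV_closed (u := u) c0 pc).
- move=> e /half_ltn[N hN]; exists N => n /hN; apply: le_trans.
  by case: (hu n).
- by exists 0%N => n _; apply: Dp; case: (hu n).
Qed.

(** The lower bound extends from E by continuity and makes T injective with closed range, and the
    range contains the dense set D. E and D are kept apart: for nonreal z the bound holds everywhere
    while D is the range itself. *)
Lemma bdd_below_bijective (T : V -> V) (c r : R) (E D : set V) : lin T ->
  0 <= c -> (forall x, nrm (T x) <= c * nrm x) ->
  (forall k e, 0 < e -> exists2 m, E m & nrm (k - m) <= e) ->
  (forall k e, 0 < e -> exists2 m, D m & nrm (k - m) <= e) ->
  0 <= r -> (forall x, E x -> nrm x <= r * nrm (T x)) ->
  (forall y, D y -> exists x, T x = y) -> bijective T.
Proof.
move=> linT c0 Tc Ed Dd r0 Er Dsurj.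
have bb x : nrm x <= r * nrm (T x).
  rewrite -subr_le0.
  apply: (@dense_le E (fun x => nrm x - r * nrm (T x)) (1 + r * c)) => //.
  - by rewrite addr_ge0// mulr_ge0.
  - move=> a b; have := nrmD (a - b) b; rewrite subrK.
    have : r * nrm (T b) <= r * (nrm (T a) + c * nrm (a - b)).
      apply: ler_wpM2l => //; rewrite -[T b](subrK (T a)) addrC.
      apply: le_trans (nrmD _ _) _; rewrite lerD2l -linB// (nrmBC a); exact: Tc.
    lra.
  - by move=> y /Er; rewrite subr_le0.
have injT : injective T.
  move=> x y Txy; apply/eqP; rewrite -subr_eq0; apply/eqP/nrm_eq0/eqP.
  rewrite eq_le nrm_ge0 andbT; apply: le_trans (bb _) _.
  by rewrite linB// Txy subrr nrm0 mulr0.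
suff /choice[T' hT'] : forall y, exists x, T x = y.
  by exists T' => x //; apply: injT; rewrite hT'.
move=> y.
have /choice[u hu] : forall n : nat, exists v, nrm (y - T v) <= 2^-1 ^+ n.
  move=> n; have [|v Dv xv] := Dd y (2^-1 ^+ n); first by rewrite exprn_gt0// invr_gt0.
  by have [x hx] := Dsurj _ Dv; exists x; rewrite hx.
have [n|x ux] := @cvgV_geometric (r * 2) u.
  apply: le_trans (bb _) _; rewrite -mulrA ler_wpM2l// linB//.
  apply: le_trans (nrm_tri y _ _) _; have := hu n; have := hu n.+1.
  rewrite exprS (nrmBC _ y) => h1 h2.
  have : 0 <= (2^-1 : R) ^+ n by rewrite exprn_ge0// invr_ge0.
  lra.
exists x; apply: (@cvgV_uniq (fun n => T (u n))).
- move=> e e0; have e1 : 0 < e / (c + 1) by rewrite divr_gt0// ltr_wpDl.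
  have [N hN] := ux _ e1; exists N => n /hN h.
  rewrite -linB//; apply: le_trans (Tc _) _.
  apply: le_trans (ler_wpM2l c0 h) _.
  rewrite mulrCA ger_pMr// ler_pdivrMr ?ltr_wpDl// mul1r; lra.
- by move=> e /half_ltn[N hN]; exists N => n /hN; exact: le_trans.
Qed.

(* Log-convexity of n |-> |B^n x| for a symmetric B. *)
Lemma lax (P : set V) (B : V -> V) (rho K : R) x :
  (forall y, P y -> P (B y)) ->
  (forall y z, P y -> P z -> ip (B y) z = ip y (B z)) ->
  P x -> 0 < rho -> (forall n, nrm (iter n B x) <= K * rho ^+ n) ->
  nrm (B x) <= rho * nrm x.
Proof.
move=> PB symB Px rho0 hK; rewrite leNgt; apply/negP => hlt.
pose a n := nrm (iter n B x).
(* B is not assumed linear; that [B 0] vanishes is drawn from symmetry. *)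
have a0 : 0 < a 0%N.
  rewrite lt_def nrm_ge0 andbT; apply/eqP => /nrm_eq0 /= x0; move: hlt Px.
  rewrite x0 nrm0 mulr0 => hlt P0; have := sqr_nrm (B 0).
  rewrite symB//; last exact: PB.
  by rewrite ip0l => /eqP; rewrite sqrf_eq0 gt_eqF.
have Pn n : P (iter n B x) by elim: n => //= n /PB.
have logc n : a n.+1 ^+ 2 <= a n * a n.+2.
  by rewrite sqr_nrm /= symB//; [exact: ReCS|exact: (Pn n.+1)].
set q := a 1%N / a 0%N.
have rq : 1 < q / rho by rewrite ltr_pdivlMr// mul1r ltr_pdivlMr.
have q0 : 0 < q by rewrite divr_gt0// (lt_trans _ hlt)// mulr_gt0.
have aq n : 0 < a n /\ q * a n <= a n.+1.
  elim: n => [|n [an0 IH]]; first by split; rewrite // /q mulfVK ?gt_eqF.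
  have an1 : 0 < a n.+1 by apply: lt_le_trans IH; rewrite mulr_gt0.
  split=> //; rewrite -(ler_pM2l an0); apply: le_trans (logc n).
  by rewrite mulrA (mulrC (a n)) expr2 ler_wpM2r// ltW.
have aqn n : q ^+ n * a 0%N <= a n.
  elim: n => [|n IH]; first by rewrite expr0 mul1r.
  by have [_] := aq n; apply: le_trans; rewrite exprS -mulrA ler_wpM2l// ltW.
(* The powers of [q / rho > 1] would stay bounded, against Bernoulli's inequality. *)
have hb n : (q / rho) ^+ n <= K / a 0%N.
  rewrite exprMn exprVn ler_pdivrMr ?exprn_gt0// mulrAC ler_pdivlMr//.
  exact: le_trans (hK n).
have Kb : 0 <= K / a 0%N by apply: le_trans (hb 0%N); rewrite expr0.
have dlt : 0 < q / rho - 1 by rewrite subr_gt0.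
pose n := Num.bound (K / a 0%N / (q / rho - 1)).
have : K / a 0%N < n%:R * (q / rho - 1).
  by rewrite -ltr_pdivrMr// archi_boundP// divr_ge0// ltW.
have bern m : 1 + m%:R * (q / rho - 1) <= (q / rho) ^+ m.
  elim: m => [|m IH]; first by rewrite mul0r addr0 expr0.
  have h := ler_wpM2l (ltW (lt_trans ltr01 rq)) IH; rewrite exprS; apply: le_trans h.
  have : 0 <= m%:R * (q / rho - 1) ^+ 2 by rewrite mulr_ge0// sqr_ge0.
  rewrite -natr1; nra.
have := le_trans (bern n) (hb n); lra.
Qed.

(** * Uniform boundedness for a supremum of seminorms *)

Section uniform_boundedness.
Variable Q : set (V -> R).
Hypothesis QD : forall q, Q q -> forall x y, q (x + y) <= q x + q y.
Hypothesis QZ : forall q, Q q -> forall a x, q (a *: x) = normc a * q x.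
Hypothesis Qcont : forall q, Q q -> exists2 c, 0 <= c & forall x, q x <= c * nrm x.
Hypothesis Qnrm : Q nrm.

(** [gball x M] says that the supremum at x of the seminorms in Q, possibly infinite, is at most M;
    the supremum itself is never formed. *)
Definition gball (x : V) (M : R) := forall q, Q q -> q x <= M.
Definition gauged : set V := [set x | exists M, gball x M]%classic.

Lemma gballD x y M N : gball x M -> gball y N -> gball (x + y) (M + N).
Proof. by move=> hx hy q Qq; apply: le_trans (QD Qq _ _) _; rewrite lerD ?hx ?hy. Qed.

Lemma gballZ a x M : gball x M -> gball (a *: x) (normc a * M).
Proof. by move=> hx q Qq; rewrite QZ// ler_wpM2l ?normc_ge0// hx. Qed.

Lemma gball_ge0 x M : gball x M -> 0 <= M.
Proof. by move=> hx; apply: le_trans (hx _ Qnrm). Qed.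

Lemma gball0 : gball 0 0.
Proof. by move=> q Qq; rewrite -(scale0r (0 : V)) QZ// normc0 mul0r. Qed.

Lemma gballW x M N : M <= N -> gball x M -> gball x N.
Proof. by move=> MN hx q Qq; apply: le_trans MN; exact: hx. Qed.

Lemma gauged0 : gauged 0. Proof. by exists 0; exact: gball0. Qed.
Lemma gaugedD x y : gauged x -> gauged y -> gauged (x + y).
Proof. by move=> [M hx] [N hy]; exists (M + N); exact: gballD. Qed.
Lemma gaugedZ a x : gauged x -> gauged (a *: x).
Proof. by move=> [M hx]; exists (normc a * M); exact: gballZ. Qed.
Lemma gaugedB x y : gauged x -> gauged y -> gauged (x - y).
Proof. by move=> gx gy; rewrite -scaleN1r; apply: gaugedD => //; exact: gaugedZ. Qed.

(** Lower semicontinuity of the supremum. Together with completeness of V it stands in for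
    completeness of [gauged]. *)
Lemma gball_closed u x M : cvgV u x ->
  (exists N, forall n, (N <= n)%N -> gball (u n) M) -> gball x M.
Proof.
move=> ux [N hN] q Qq; have [c c0 qc] := Qcont Qq.
apply: (cvgV_closed (q := q) (u := u) c0) => //.
- move=> a b; rewrite addrC -{1}(subrK b a); apply: le_trans (QD Qq _ _) _.
  by rewrite lerD2r.
- by exists N => n /hN; exact.
Qed.

(** Additivity and homogeneity are asked on [gauged] vectors only, since P will consist of
    functionals composed with an inverse that is controlled only there. *)
Variable P : set (V -> R).
Hypothesis PD : forall p, P p -> forall x y, gauged x -> gauged y ->
  p (x + y) <= p x + p y.
Hypothesis PZ : forall p, P p -> forall a x, gauged x -> p (a *: x) = normc a * p x.
Hypothesis Pcont : forall p, P p -> exists c, forall x M, gball x M -> p x <= c * M.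
Hypothesis Pbdd : forall x, gauged x -> exists B, forall p, P p -> p x <= B.

(** A gliding hump in place of Baire's theorem: z is a sum of terms [4^-n * x n] with signs, and
    [p n z] is unbounded in n. A sign that keeps [p n (y n.+1)] above [4^-n * p n (x n)] exists
    because [p (y + w) + p (y - w) >= 2 * p w]. *)
Lemma uniform_boundedness :
  exists2 C, 0 <= C & forall p, P p -> forall x M, gball x M -> p x <= C * M.
Proof.
apply: contrapT => hno.
(* The triple consists of a functional, a point of the unit gauge ball where it reaches half its
   norm, and that norm, which exceeds [n * 4 ^+ n]. *)
have step n : exists pxc : (V -> R) * V * R, [/\ P pxc.1.1, gball pxc.1.2 1,
    pxc.2 <= 2 * pxc.1.1 pxc.1.2, n%:R * 4 ^+ n < pxc.2 &
    forall x M, gball x M -> pxc.1.1 x <= pxc.2 * M].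
  have [p [Pp [x [M [bx xM]]]]] : exists p, P p /\ exists x M, gball x M /\
      n%:R * 4 ^+ n * M < p x.
    apply: contrapT => h; apply: hno; exists (n%:R * 4 ^+ n).
      by rewrite mulr_ge0// exprn_ge0.
    move=> p Pp x M bx; rewrite leNgt; apply/negP => hlt; apply: h.
    by exists p; split=> //; exists x, M.
  have M0 : 0 < M.
    rewrite lt_def (gball_ge0 bx) andbT; apply/eqP => M0; move: bx xM.
    rewrite M0 mulr0 => bx; have /nrm_eq0 -> : nrm x = 0.
      by apply/eqP; rewrite eq_le nrm_ge0 andbT; exact: (bx _ Qnrm).
    by rewrite -(scale0r (0 : V)) (PZ Pp)// ?normc0 ?mul0r ?ltxx//; exact: gauged0.
  have [c hc] := Pcont Pp.
  pose E := [set p y | y in [set y | gball y 1]]%classic.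
  have hE : has_sup E.
    split; first by exists (p 0); exists 0 => //; exact: gballW ler01 gball0.
    by exists c => _ [y /= by1 <-]; rewrite -[c]mulr1; exact: hc.
  have bsup y N : gball y N -> p y <= sup E * N.
    move=> byN; have [N0|N0] := eqVneq N 0.
      rewrite N0 mulr0; move: byN; rewrite N0 => byN.
      have /nrm_eq0 -> : nrm y = 0.
        by apply/eqP; rewrite eq_le nrm_ge0 andbT; exact: (byN _ Qnrm).
      by rewrite -(scale0r (0 : V)) (PZ Pp)// ?normc0 ?mul0r ?ltxx//; exact: gauged0.
    have {}N0 : 0 < N by rewrite lt_def N0 (gball_ge0 byN).
    rewrite -ler_pdivrMr//; apply: ub_le_sup; first by case: hE.
    exists (N^-1%:C *: y) => /=.
      have := gballZ (N^-1%:C) byN; rewrite normc_real gtr0_norm ?invr_gt0//.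
      by rewrite mulVf ?gt_eqF.
    rewrite (PZ Pp); last by exists N.
    by rewrite normc_real gtr0_norm ?invr_gt0// mulrC.
  have Ebig : n%:R * 4 ^+ n < sup E.
    by rewrite -(ltr_pM2r M0); apply: lt_le_trans xM _; exact: bsup.
  have E0 : 0 < sup E.
    by apply: le_lt_trans Ebig; rewrite mulr_ge0// exprn_ge0.
  have [|_ [y by1 <-] hy] := sup_adherent (eps := sup E / 2) _ hE.
    by rewrite divr_gt0.
  by exists (p, y, sup E); split => //=; lra.
have {step}/choice[f hf] := step.
pose r n : R := 4^-1 ^+ n.
have r0 n : 0 <= r n by rewrite exprn_ge0// invr_ge0.
pose p n := (f n).1.1; pose x n := (f n).1.2; pose c n := (f n).2.
pose next n y := if r n * p n (x n) <= p n (y + (r n)%:C *: x n)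
  then y + (r n)%:C *: x n else y - (r n)%:C *: x n.
pose y := fix y n := if n is n'.+1 then next n' (y n') else 0.
have yS n : y n.+1 = next n (y n) by [].
have bx n : gball ((r n)%:C *: x n) (r n).
  have [_ b1 _ _ _] := hf n; have := gballZ (r n)%:C b1.
  by rewrite normc_real ger0_norm// mulr1.
have bstep n : gball (y n.+1 - y n) (r n).
  rewrite yS /next; case: ifP => _; first by rewrite addrAC subrr add0r.
  rewrite addrAC subrr add0r -scaleN1r; have := gballZ (-1) (bx n).
  by rewrite normcN normc1 mul1r.
have gy n : gauged (y n).
  elim: n => [|n IH]; first exact: gauged0.
  by rewrite -[y n.+1](subrK (y n)); apply: gaugedD => //; exists (r n).
have pbig n : r n * p n (x n) <= p n (y n.+1).
  rewrite yS /next; case: ifP => // /negbT; rewrite -ltNge => hlt.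
  have [Pp b1 _ _ _] := hf n.
  have gx : gauged ((r n)%:C *: x n) by exists (r n).
  have := PD Pp (gaugedD (gy n) gx) (gaugedZ (-1) (gaugedB (gy n) gx)).
  rewrite (PZ Pp); last exact: gaugedB.
  rewrite normcN normc1 mul1r scaleN1r opprB [_ + (_ - _)]addrC addrA subrK -mulr2n.
  rewrite -scaler_nat (PZ Pp)// (PZ Pp); last by exists 1.
  rewrite (_ : normc 2%:R = 2 :> R); last by rewrite -[2%:R](rmorph_nat (real_complex R)) normc_real ger0_norm.
  rewrite normc_real ger0_norm// -/(p n) -/(x n); move: hlt; lra.
(* The geometric series of ratio 1/4 is kept with its exact partial sums, so that the induction
   closes. *)
have tail n m : gball (y (n + m)%N - y n) (4 / 3 * (r n - r (n + m)%N)).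
  elim: m => [|m IH]; first by rewrite addn0 !subrr mulr0; exact: gball0.
  have := gballD (bstep (n + m)%N) IH; rewrite addrA subrK -addnS.
  by apply: gballW; rewrite /r addnS exprS; lra.
have [n|z yz] := @cvgV_geometric 1 y.
  rewrite mul1r; apply: le_trans (bstep n _ Qnrm) _.
  by rewrite lerXn2r ?nnegrE ?invr_ge0// lef_pV2 ?posrE// ler_nat.
have ztail n : gball (z - y n) (4 / 3 * r n).
  apply: (@gball_closed (fun m => y m - y n)).
  - move=> e /yz[N hN]; exists N => m /hN.
    by rewrite opprB addrA subrK; exact.
  - exists n => m nm; rewrite -(subnKC nm); apply: gballW (tail n _).
    by have := r0 (n + (m - n))%N; lra.
have gz : gauged z.
  by exists (4 / 3 * r 0%N); have := ztail 0%N; rewrite /= subr0.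
have [B hB] := Pbdd gz.
(* At index [n.+1] the hump contributes at least [r c / 2] and the tail removes at most [r c / 3];
   the remaining sixth of [r c] exceeds B. *)
pose n := (Num.bound (6 * `|B|)).+1.
have [Pp b1 c1 c2 c3] := hf n.+1.
have := PD Pp (gz) (gaugedZ (-1) (gaugedB gz (gy n.+2))).
rewrite (PZ Pp); last exact: gaugedB.
rewrite normcN normc1 mul1r scaleN1r opprB addrCA subrr addr0 -/(p _).
have := c3 _ _ (ztail n.+2); rewrite -/(p _) -/(c _).
have := hB _ Pp; rewrite -/(p _).
have := pbig n.+1.
have h1 : r n.+1 * c n.+1 <= 2 * (r n.+1 * p n.+1 (x n.+1)).
  by rewrite mulrCA ler_wpM2l.
have h2 : n.+1%:R < r n.+1 * c n.+1.
  move: c2; rewrite -/(c _) mulrC -ltr_pdivlMl ?exprn_gt0// /r exprVn//.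
have h3 : 6 * `|B| < n.+1%:R.
  apply: lt_le_trans (archi_boundP _) _; first by rewrite mulr_ge0.
  by rewrite ler_nat /n; apply: leq_trans (leqnSn _) (leqnSn _).
have := ler_norm B.
have -> : r n.+2 = 4^-1 * r n.+1 by rewrite /r exprS.
have -> : c n.+1 * (4 / 3 * (4^-1 * r n.+1)) = 3^-1 * (r n.+1 * c n.+1) by field.
lra.
Qed.

End uniform_boundedness.
End hilbert.

(** * Unordered sums *)

Section netsum.
Variables (R : realType) (I : choiceType).
Implicit Types (D : set I) (u v : I -> R[i]) (s : seq I).

Definition seq_in D s := uniq s /\ forall i, i \in s -> D i.

(** Convergence along the finite subsets of D, given as duplicate-free sequences. Identities between
    values of [csum], which is built from positive and negative parts, are proved by showing both
    sides to be limits of one net and applying [netsum_uniq]. *)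
Definition netsum D u (l : R[i]) := forall e : R, 0 < e ->
  exists2 s0, seq_in D s0 & forall s, seq_in D s -> {subset s0 <= s} ->
    normc (\sum_(i <- s) u i - l) <= e.

Lemma seq_in_cat D s t : seq_in D s -> seq_in D t ->
  exists2 w, seq_in D w & {subset s <= w} /\ {subset t <= w}.
Proof.
move=> [us hs] [ut ht]; exists (undup (s ++ t)).
  split; first exact: undup_uniq.
  by move=> i; rewrite mem_undup mem_cat => /orP[/hs|/ht].
by split=> i hi; rewrite mem_undup mem_cat hi ?orbT.
Qed.

Lemma netsum_uniq D u l m : netsum D u l -> netsum D u m -> l = m.
Proof.
move=> hl hm; apply/eqP; rewrite -subr_eq0; apply/eqP/normc_eq0P/eqP.
rewrite eq_le normc_ge0 andbT; apply/ler_addgt0Pr => e e0; rewrite add0r.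
have e2 : 0 < e / 2 by rewrite divr_gt0.
have [s ss hs] := hl _ e2; have [t tt ht] := hm _ e2.
have [w ww [sw tw]] := seq_in_cat ss tt.
have := hs _ ww sw; have := ht _ ww tw.
have := le_normcD (\sum_(i <- w) u i - m) (- (\sum_(i <- w) u i - l)).
rewrite normcN opprB addrC addrA subrK; lra.
Qed.

Lemma netsumD D u v l m : netsum D u l -> netsum D v m ->
  netsum D (fun i => u i + v i) (l + m).
Proof.
move=> hl hm e e0; have e2 : 0 < e / 2 by rewrite divr_gt0.
have [s ss hs] := hl _ e2; have [t tt ht] := hm _ e2.
have [w ww [sw tw]] := seq_in_cat ss tt; exists w => // x xx wx.
rewrite big_split/= opprD addrACA; apply: le_trans (le_normcD _ _) _.
have := hs _ xx (fun i si => wx _ (sw _ si)).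
have := ht _ xx (fun i si => wx _ (tw _ si)); lra.
Qed.

Lemma netsumZ D u l (a : R[i]) : netsum D u l -> netsum D (fun i => a * u i) (a * l).
Proof.
move=> hl e e0; have a1 : 0 < normc a + 1 by rewrite ltr_wpDl ?normc_ge0.
have [s ss hs] := hl _ (divr_gt0 e0 a1); exists s => // t tt st.
rewrite -mulr_sumr -mulrBr normcM; apply: le_trans (ler_wpM2l (normc_ge0 a) (hs _ tt st)) _.
rewrite mulrCA ger_pMr// ler_pdivrMr// mul1r; lra.
Qed.

Lemma netsumJ D u l : netsum D u l -> netsum D (fun i => conjc (u i)) (conjc l).
Proof.
move=> hl e e0; have [s ss hs] := hl _ e0; exists s => // t tt st.
by rewrite -raddf_sum -raddfB normcJ hs.
Qed.

Lemma eq_netsum D u v l : (forall i, D i -> u i = v i) -> netsum D u l -> netsum D v l.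
Proof.
move=> uv hl e e0; have [s ss hs] := hl _ e0; exists s => // t tt st.
rewrite (eq_big_seq u); first exact: hs.
by move=> i /(tt.2) /uv.
Qed.

Lemma netsum_le D u l (B : R) :
  (forall s, seq_in D s -> normc (\sum_(i <- s) u i) <= B) ->
  netsum D u l -> normc l <= B.
Proof.
move=> hB hl; apply/ler_addgt0Pr => e e0; have [s ss hs] := hl _ e0.
have := le_normcD (\sum_(i <- s) u i) (- (\sum_(i <- s) u i - l)).
rewrite normcN opprB addrC subrK; have := hB _ ss; have := hs _ ss (fun _ => id); lra.
Qed.

Lemma netsum_reindex D u l (f f' : I -> I) :
  (forall i, D i -> D (f i)) -> (forall i, D i -> D (f' i)) ->
  cancel f f' -> cancel f' f ->
  netsum D u l -> netsum D (u \o f) l.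
Proof.
move=> Df Df' fK f'K hl e e0; have [s ss hs] := hl _ e0; exists (map f' s).
  split; first by rewrite map_inj_uniq ?ss.1//; exact: can_inj f'K.
  by move=> i /mapP[j /(ss.2) Dj ->]; exact: Df'.
move=> t tt st; rewrite -(big_map f predT u); apply: hs.
  split; first by rewrite map_inj_uniq ?tt.1//; exact: can_inj fK.
  by move=> i /mapP[j /(tt.2) Dj ->]; exact: Df.
move=> i si; apply/mapP; exists (f' i); last by rewrite f'K.
exact/st/map_f.
Qed.

Lemma esum_seq_le D (a : I -> R) (B : R) : (forall s, seq_in D s -> \sum_(i <- s) a i <= B) ->
  (\esum_(i in D) (a i)%:E <= B%:E)%E.
Proof.
move=> h; apply: ub_ereal_sup => _ [F [finF FD] <-].
rewrite fsbig_finite//= sumEFin lee_fin; apply: h; split; first exact: finmap.fset_uniq.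
by move=> i; rewrite in_fset_set// inE => /FD.
Qed.

Lemma seq_le_esum D (a : I -> R) s : seq_in D s ->
  ((\sum_(i <- s) a i)%:E <= \esum_(i in D) (a i)%:E)%E.
Proof.
move=> [us Ds]; apply: ereal_sup_ubound; exists [set` s]%classic; first by split.
by rewrite -fsbig_seq// sumEFin.
Qed.

Lemma netsum_nneg D (a : I -> R) (B : R) : (forall i, 0 <= a i) ->
  (forall s, seq_in D s -> \sum_(i <- s) a i <= B) ->
  netsum D (fun i => (a i)%:C) (fine (\esum_(i in D) (a i)%:E))%:C.
Proof.
move=> a0 hB e e0.
have fin : \esum_(i in D) (a i)%:E \is a fin_num.
  rewrite fin_real//; apply/andP; split.
    by apply: (lt_le_trans (ltNyr 0)); apply: esum_ge0 => i _; rewrite lee_fin.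
  exact: le_lt_trans (esum_seq_le hB) (ltry _).
set L := fine _.
have LE : (L%:E = \esum_(i in D) (a i)%:E)%E by rewrite fineK.
have hL s : seq_in D s -> \sum_(i <- s) a i <= L.
  by move=> ss; rewrite -lee_fin LE; exact: seq_le_esum.
have [s0 ss0 hs0] : exists2 s0, seq_in D s0 & L - e <= \sum_(i <- s0) a i.
  apply: contrapT => h; suff : (L%:E <= (L - e)%:E)%E by rewrite lee_fin; lra.
  rewrite {1}LE; apply: esum_seq_le => s ss; rewrite leNgt; apply/negP => hlt.
  by apply: h; exists s => //; exact: ltW.
exists s0 => // s ss sub.
rewrite -raddf_sum -raddfB/= -[Num.sqrt _]/(normc (_ - _)%:C) normc_real.
rewrite ler_norml; have h1 := hL _ ss.
have : \sum_(i <- s0) a i <= \sum_(i <- s) a i.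
  rewrite [leRHS](perm_big (s0 ++ [seq i <- s | i \notin s0])).
    by rewrite big_cat lerDl sumr_ge0.
  apply: uniq_perm; first exact: ss.1.
    rewrite cat_uniq ss0.1 filter_uniq ?ss.1// andbT; apply/hasPn => i.
    by rewrite mem_filter => /andP[].
  by move=> i; rewrite mem_cat mem_filter; case: (boolP (i \in s0)) => //= /sub ->.
lra.
Qed.

Lemma netsum_csum D u (B : R) : (forall s, seq_in D s -> \sum_(i <- s) normc (u i) <= B) ->
  netsum D u (csum D u).
Proof.
move=> hB.
have key (a : I -> R) : (forall i, `|a i| <= normc (u i)) ->
    netsum D (fun i => (a i)%:C) (rsum D a)%:C.
  move=> hn; rewrite /rsum rmorphB/= -mulN1r.
  apply: (@eq_netsum _ (fun i => (funrpos a i)%:C + (-1) * (funrneg a i)%:C)).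
    move=> i _; rewrite -[in RHS](funrposBneg a)/= rmorphB mulN1r//.
  have bd (b : I -> R) : (forall i, b i <= `|a i|) -> forall s, seq_in D s ->
      \sum_(i <- s) b i <= B.
    move=> hb s ss; apply: le_trans (hB _ ss); apply: ler_sum => i _.
    exact: le_trans (hn i).
  apply: netsumD; last apply: netsumZ.
  - apply: netsum_nneg => [i|]; first exact: funrpos_ge0.
    by apply: bd => i; rewrite /funrpos ge_max ler_norm normr_ge0.
  - apply: netsum_nneg => [i|]; first exact: funrneg_ge0.
    by apply: bd => i; rewrite /funrneg ge_max -normrN ler_norm normr_ge0.
have -> : csum D u = (rsum D (fun i => complex.Re (u i)))%:C +
    'i%C * (rsum D (fun i => complex.Im (u i)))%:C.
  by apply: complexP; rewrite /= ?mul0r ?mulr0 ?mul1r ?subr0 ?addr0 ?add0r ?oppr0 ?addr0.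
apply: (@eq_netsum _ (fun i => (complex.Re (u i))%:C + 'i%C * (complex.Im (u i))%:C)).
  by move=> i _; rewrite -complexE.
apply: netsumD; first by apply: key => i; exact: Re_le_normc.
by apply: netsumZ; apply: key => i; exact: Im_le_normc.
Qed.

End netsum.

(** * Square-summable families *)

Section square_summable.
Variables (R : realType) (I : choiceType) (D : set I).
Implicit Types (u v : I -> R[i]) (s : seq I).

Definition l2bound u (M : R) := forall s, seq_in D s ->
  \sum_(i <- s) normc (u i) ^+ 2 <= M ^+ 2.

(** The sum of [(B * a i - A * b i) ^+ 2] is nonnegative. Since [A * B] is cancelled at the end, a
    vanishing bound is treated first. *)
Lemma sum_cauchy_schwarz (s : seq I) (a b : I -> R) (A B : R) : 0 <= A -> 0 <= B ->
  \sum_(i <- s) a i ^+ 2 <= A ^+ 2 -> \sum_(i <- s) b i ^+ 2 <= B ^+ 2 ->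
  \sum_(i <- s) a i * b i <= A * B.
Proof.
move=> A0 B0 hA hB.
have hab x y : 0 <= x -> 0 <= y -> x * y * (2 * \sum_(i <- s) a i * b i) <=
    y ^+ 2 * A ^+ 2 + x ^+ 2 * B ^+ 2.
  move=> x0 y0; apply: (@le_trans _ _ (y ^+ 2 * \sum_(i <- s) a i ^+ 2 +
      x ^+ 2 * \sum_(i <- s) b i ^+ 2)); last by rewrite lerD// ler_wpM2l// sqr_ge0.
  rewrite !mulr_sumr -big_split/=; apply: ler_sum => i _.
  rewrite -subr_ge0; have := sqr_ge0 (y * a i - x * b i); congr (0 <= _); ring.
have [/eqP|A1] := eqVneq A 0.
  rewrite -sqrf_eq0 => /eqP A2; rewrite A2 in hA.
  have a0 i : i \in s -> a i = 0.
    move=> si; apply/eqP; rewrite -sqrf_eq0 eq_le sqr_ge0 andbT.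
    apply: le_trans hA; rewrite (big_rem i)//= lerDl sumr_ge0// => j _; exact: sqr_ge0.
  rewrite big_seq big1 ?mulr_ge0// => i /a0 ->; exact: mul0r.
have [/eqP|B1] := eqVneq B 0.
  rewrite -sqrf_eq0 => /eqP B2; rewrite B2 in hB.
  have b0 i : i \in s -> b i = 0.
    move=> si; apply/eqP; rewrite -sqrf_eq0 eq_le sqr_ge0 andbT.
    apply: le_trans hB; rewrite (big_rem i)//= lerDl sumr_ge0// => j _; exact: sqr_ge0.
  rewrite big_seq big1 ?mulr_ge0// => i /b0 ->; exact: mulr0.
have := hab _ _ A0 B0.
have AB : 0 < A * B by rewrite mulr_gt0// lt_def ?A1 ?B1.
set S := \sum_(i <- s) _.
have -> : A * B * (2 * S) = 2 * (A * B * S) by ring.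
have -> : B ^+ 2 * A ^+ 2 + A ^+ 2 * B ^+ 2 = 2 * (A * B * (A * B)) by ring.
by rewrite !ler_pM2l.
Qed.

Lemma l2_mul_bound u v A B : 0 <= A -> 0 <= B -> l2bound u A -> l2bound v B ->
  forall s, seq_in D s -> \sum_(i <- s) normc (u i * conjc (v i)) <= A * B.
Proof.
move=> A0 B0 hu hv s ss; under eq_bigr do rewrite normcM normcJ.
by apply: sum_cauchy_schwarz => //; [exact: hu|exact: hv].
Qed.

Lemma l2inner_netsum u v A B : 0 <= A -> 0 <= B -> l2bound u A -> l2bound v B ->
  netsum D (fun i => u i * conjc (v i)) (l2inner D u v).
Proof. by move=> A0 B0 hu hv; apply: netsum_csum; exact: l2_mul_bound hu hv. Qed.

Lemma sum_normc_le s (u : I -> R[i]) : normc (\sum_(i <- s) u i) <= \sum_(i <- s) normc (u i).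
Proof.
elim: s => [|i s IH]; first by rewrite !big_nil normc0.
by rewrite !big_cons; apply: le_trans (le_normcD _ _) _; rewrite lerD2l.
Qed.

Lemma l2inner_le u v A B : 0 <= A -> 0 <= B -> l2bound u A -> l2bound v B ->
  normc (l2inner D u v) <= A * B.
Proof.
move=> A0 B0 hu hv; apply: netsum_le (l2inner_netsum A0 B0 hu hv) => s ss.
apply: le_trans (sum_normc_le _ _) _; exact: l2_mul_bound hu hv _ ss.
Qed.

End square_summable.

(** * Bessel vectors and frame operators of a projective unitary system *)

Section spectral.
Variables (R : realType) (V : lmodType R[i]) (ip : V -> V -> R[i]).
Hypothesis hip : is_hilbert ip.
Local Notation nrm := (nrm ip).
Local Notation CS := (CS hip).

Variables (T : V -> V) (c : R).
Hypothesis linT : lin T.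
Hypothesis c0 : 0 <= c.
Hypothesis Tc : forall x, nrm (T x) <= c * nrm x.

(** The imaginary part of [ip (S x - z *: x) x] is minus that of z times [nrm x ^+ 2];
    Cauchy-Schwarz does the rest. *)
Lemma eigen_bound (z : R[i]) (S : V -> V) : (forall x, complex.Im (ip (S x) x) = 0) ->
  forall x, `|complex.Im z| * nrm x <= nrm (S x - z *: x).
Proof.
move=> symS x; have [->|x0] := eqVneq (nrm x) 0; first by rewrite mulr0 nrm_ge0.
have xp : 0 < nrm x by rewrite lt_def x0 nrm_ge0.
rewrite -(ler_pM2r xp) -mulrA -expr2; apply: le_trans (CS _ _).
apply: le_trans (Im_le_normc _).
rewrite (ipBl hip) (ipZl hip) (ipxx hip) ImD ImN symS add0r normrN [z * _]mulrC ImZ normrM.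
by rewrite ger0_norm ?sqr_ge0// mulrC.
Qed.

(* Hellinger-Toeplitz: an everywhere defined symmetric inverse is bounded. *)
Lemma symmetric_bijective_bounded_below : (forall x y, ip (T x) y = ip x (T y)) ->
  bijective T -> exists2 r, 0 <= r & forall x, nrm x <= r * nrm (T x).
Proof.
move=> symT [T' TK T'K].
have linT' : lin T'.
  split=> [x y|a x]; apply: (can_inj TK).
    by rewrite linT.1 !T'K.
  by rewrite linT.2 !T'K.
have symT' x y : ip (T' x) y = ip x (T' y) by rewrite -{1}(T'K y) -symT T'K.
(* Each functional is bounded on its own because symmetry moves T' onto k. *)
pose P : set (V -> R) := [set p | exists2 k, nrm k <= 1 &
  p = fun x => normc (ip (T' x) k)]%classic.
have [||||||||C C0 hC] := @uniform_boundedness R V ip hip [set nrm]%classic _ _ _ _ P.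
- by move=> _ -> x y; exact: nrmD.
- by move=> _ -> a x; exact: nrmZ.
- by move=> _ ->; exists 1 => // x; rewrite mul1r.
- by [].
- move=> _ [k _ ->] x y _ _; rewrite linT'.1 (ipDl hip); exact: le_normcD.
- by move=> _ [k _ ->] a x _; rewrite linT'.2 (ipZl hip) normcM.
- move=> _ [k _ ->]; exists (nrm (T' k)) => x M bx; rewrite symT'.
  apply: le_trans (CS _ _) _; rewrite mulrC ler_wpM2l ?nrm_ge0//.
  exact: (bx nrm erefl).
- move=> x _; exists (nrm (T' x)) => _ [k k1 ->].
  by apply: le_trans (CS _ _) _; rewrite ler_piMr ?nrm_ge0.
exists C => // x.
have [->|x0] := eqVneq (nrm x) 0; first by rewrite mulr_ge0 ?nrm_ge0.
have xp : 0 < nrm x by rewrite lt_def x0 nrm_ge0.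
have k1 : nrm ((nrm x)^-1%:C *: x) <= 1.
  by rewrite (nrmZ hip) normc_real gtr0_norm ?invr_gt0// mulVf.
have := hC (fun y => normc (ip (T' y) ((nrm x)^-1%:C *: x))) _ (T x) (nrm (T x)).
rewrite TK (ipZr hip) conjcR (ipxx hip) -rmorphM normc_real.
rewrite expr2 mulrA mulVf// mul1r gtr0_norm//; apply; first by exists ((nrm x)^-1%:C *: x).
by move=> _ ->.
Qed.

(** [R'] is the adjoint of the inverse. It expresses the coefficients of x by those of [T x], which
    is how a Bessel bound passes from [T x] to x. *)
Lemma bijective_adjoint_inverse (r : R) : bijective T -> 0 <= r ->
  (forall x, nrm x <= r * nrm (T x)) ->
  exists R', forall x k, ip (T x) (R' k) = ip x k /\ nrm (R' k) <= r * nrm k.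
Proof.
move=> [T' TK T'K] r0 hr.
have linT' : lin T'.
  split=> [x y|a x]; apply: (can_inj TK).
    by rewrite linT.1 !T'K.
  by rewrite linT.2 !T'K.
have T'r x : nrm (T' x) <= r * nrm x by apply: le_trans (hr _) _; rewrite T'K.
have [R' hR'] := adjoint hip linT' T'r.
exists R' => x k; split; first by rewrite -hR' TK.
apply: (nrm_le_ip hip); first by rewrite mulr_ge0 ?nrm_ge0.
move=> y; rewrite (ipC hip) normcJ -hR'; apply: le_trans (CS _ _) _.
by rewrite mulrAC ler_wpM2r ?nrm_ge0.
Qed.

End spectral.

Section shift_system.
Variables (R : realType) (V : lmodType R[i]) (ip : V -> V -> R[i]).
Hypothesis hip : is_hilbert ip.
Local Notation nrm := (nrm ip).
Local Notation CS := (CS hip).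
#[local] Hint Extern 0 (is_true (0 <= nrm _)) => exact: nrm_ge0 : core.

Variables (W : zmodType) (U : W -> V -> V).
Hypothesis Ulin : forall a, lin (U a).
Hypothesis Uiso : forall a x y, ip (U a x) (U a y) = ip x y.
Hypothesis U0 : forall x, U 0 x = x.
(** The phase is left unspecified: in each identity below it cancels against its conjugate. *)
Hypothesis UM : forall a b, exists2 c, normc c = 1 &
  forall x, U a (U b x) = c *: U (a + b) x.

Variable L : set W.
Hypothesis L0 : L 0.
Hypothesis LD : forall a b, L a -> L b -> L (a + b).
Hypothesis LN : forall a, L a -> L (- a).

Lemma nrmU a x : nrm (U a x) = nrm x.
Proof. by rewrite /nrm Uiso. Qed.

Lemma phaseV (c : R[i]) : normc c = 1 -> c * conjc c = 1.
Proof. by move=> c1; rewrite mulcJ c1 expr1n. Qed.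

Lemma Usurj a y : exists x, U a x = y.
Proof.
have [c c1 hc] := UM a (- a); exists (conjc c *: U (- a) y).
by rewrite (Ulin a).2 hc scalerA mulrC phaseV// scale1r subrr U0.
Qed.

Lemma Ucomm a b : exists2 c, normc c = 1 & forall x, U a (U b x) = c *: U b (U a x).
Proof.
have [c c1 hc] := UM a b; have [e e1 he] := UM b a; exists (c * conjc e).
  by rewrite normcM normcJ c1 e1 mulr1.
by move=> x; rewrite hc he scalerA addrC -mulrA [_ * e]mulrC phaseV// mulr1.
Qed.

Lemma Uadj a : exists2 c, normc c = 1 & forall x y, ip (U a x) y = c * ip x (U (- a) y).
Proof.
have [c c1 hc] := UM (- a) a; exists c => // x y.
by rewrite -(Uiso (- a)) hc (ipZl hip) addNr U0.
Qed.

Local Notation coef f g := (fun i => ip f (U i g)).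

(** The bound M is an explicit parameter because its growth under iteration is what Lax's lemma
    consumes. *)
Definition bes (g : V) (M : R) := 0 <= M /\ forall f, l2bound L (coef f g) (M * nrm f).

(** The single term at 0 of the Bessel inequality already gives [normc (ip f g) <= M * nrm f]. *)
Lemma bes_nrm g M : bes g M -> nrm g <= M.
Proof.
move=> [M0 hg]; apply: (nrm_le_ip hip) => // f.
have ss : seq_in L [:: 0] by split=> // i; rewrite inE => /eqP ->.
have := hg f _ ss; rewrite big_seq1 U0 ler_pXn2r ?nnegrE ?normc_ge0 ?mulr_ge0//.
by rewrite (ipC hip) normcJ.
Qed.

(** Analysis and synthesis are adjoint and so have the same norm. The synthesis form exhibits the
    Bessel bound as a supremum of seminorms of g, from which [besD] and [gauges] are built. *)
Lemma bes_synth g M : 0 <= M ->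
  (bes g M <-> forall s (c : W -> R[i]), seq_in L s ->
     \sum_(i <- s) normc (c i) ^+ 2 <= 1 -> nrm (\sum_(i <- s) c i *: U i g) <= M).
Proof.
move=> M0; split=> [[_ hg] s c ss c1|h].
  apply: (nrm_le_ip hip) => // f; rewrite (ipC hip) normcJ (ip_sumr hip).
  apply: le_trans (sum_normc_le _ _) _; rewrite -[leRHS]mul1r.
  under eq_bigr do rewrite (ipZr hip) normcM normcJ.
  apply: sum_cauchy_schwarz; rewrite ?mulr_ge0 ?expr1n//; exact: hg.
split=> // f s ss; set A := \sum_(i <- s) _.
have A0 : 0 <= A by apply: sumr_ge0 => i _; exact: sqr_ge0.
have [->|An0] := eqVneq A 0; first exact: sqr_ge0.
have Ap : 0 < A by rewrite lt_def An0.
pose r := Num.sqrt A; have r0 : 0 < r by rewrite sqrtr_gt0.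
have rA : r ^+ 2 = A by rewrite sqr_sqrtr.
(* The extremal coefficients are those of f itself, normalised to square sum 1. *)
have := h s (fun i => r^-1%:C * ip f (U i g)) ss.
have -> : \sum_(i <- s) normc (r^-1%:C * ip f (U i g)) ^+ 2 = 1.
  under eq_bigr do rewrite normcM exprMn normc_real.
  by rewrite -mulr_sumr -/A real_normK ?num_real// -rA exprVn mulVf// rA.
move=> /(_ (lexx 1)) hM.
have : A = r * complex.Re (ip f (\sum_(i <- s) (r^-1%:C * ip f (U i g)) *: U i g)).
  rewrite (ip_sumr hip) -ReZ mulr_sumr (raddf_sum (@complex.Re R)) /=.
  apply: eq_bigr => i _; rewrite (ipZr hip) conjcM conjcR !mulrA -!rmorphM/=.
  by rewrite mulfV ?gt_eqF// mul1r mulrC mulcJ.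
have hr := ReCS hip f (\sum_(i <- s) (r^-1%:C * ip f (U i g)) *: U i g).
move=> hA; have : r * r <= r * (M * nrm f).
  rewrite -expr2 rA [leLHS]hA; apply: ler_wpM2l; first exact: ltW.
  apply: le_trans hr _.
  by rewrite mulrC ler_wpM2r.
rewrite ler_pM2l// => hrM; rewrite -rA ler_pXn2r ?nnegrE ?mulr_ge0//; exact: ltW.
Qed.

Lemma besD x y M N : bes x M -> bes y N -> bes (x + y) (M + N).
Proof.
move=> hx hy; have [M0 _] := hx; have [N0 _] := hy.
apply/bes_synth; first exact: addr_ge0.
move=> s c ss c1; under eq_bigr do rewrite (Ulin _).1 scalerDr.
rewrite big_split/=; apply: le_trans (nrmD hip _ _) _; apply: lerD.
  by move/bes_synth : hx; exact.
by move/bes_synth : hy; exact.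
Qed.

Lemma besZ a x M : bes x M -> bes (a *: x) (normc a * M).
Proof.
move=> [M0 hx]; split; first by rewrite mulr_ge0 ?normc_ge0.
move=> f s ss; under eq_bigr do rewrite (Ulin _).2 (ipZr hip) normcM normcJ exprMn.
rewrite -mulr_sumr -[normc a * M * _]mulrA [leRHS]exprMn.
by apply: ler_wpM2l; [exact: sqr_ge0|exact: hx].
Qed.

Lemma besB x y M N : bes x M -> bes y N -> bes (x - y) (M + N).
Proof.
by move=> hx /(besZ (-1)); rewrite normcN normc1 mul1r scaleN1r; exact: besD.
Qed.

(** Here w need not lie in L: moving [U w] past the lattice shifts costs only phases. *)
Lemma besU w g M : bes g M -> bes (U w g) M.
Proof.
move=> [M0 hg]; split=> // f s ss; have [f' <-] := Usurj w f.
rewrite nrmU; apply: le_trans (hg f' s ss); apply: ler_sum => i _.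
have [c c1 hc] := Ucomm i w; rewrite hc (ipZr hip) Uiso normcM normcJ c1 mul1r//.
Qed.

(** The coefficient of u against [U (- i) f] has the same modulus as that of f against [U i u], and
    L is symmetric. *)
Lemma bes_swap f u M : bes f M -> l2bound L (coef f u) (M * nrm u).
Proof.
move=> [M0 hf] s ss; have ss' : seq_in L (map -%R s).
  split; first by rewrite map_inj_uniq ?ss.1//; exact: oppr_inj.
  by move=> i /mapP[j /(ss.2)/LN Lj ->].
apply: le_trans (hf u _ ss'); rewrite big_map; apply: ler_sum => i _.
have [c c1 hc] := Uadj i; rewrite (ipC hip) normcJ hc normcM c1 mul1r//.
Qed.

Definition synth (g : V) (c : W -> R[i]) : V :=
  xget 0 [set h : V | forall f, ip f h = l2inner L (coef f g) c]%classic.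

Definition opS g h f := synth h (coef f g).

(** Only square summability of the coefficients is assumed. This covers a Bessel window g with
    arbitrary f and, through [bes_swap], a Bessel f with an arbitrary window. *)
Lemma opS_spec g h f A N : 0 <= A -> l2bound L (coef f g) A -> bes h N ->
  (forall k, netsum L (fun i => ip k (U i h) * conjc (ip f (U i g))) (ip k (opS g h f)))
  /\ nrm (opS g h f) <= N * A.
Proof.
move=> A0 hA [N0 hh].
have hnet k := l2inner_netsum (mulr_ge0 N0 (nrm_ge0 ip k)) A0 (hh k) hA.
have hle k := l2inner_le (mulr_ge0 N0 (nrm_ge0 ip k)) A0 (hh k) hA.
have [x hx] : exists x, forall k, l2inner L (coef k h) (coef f g) = ip k x.
  apply: (@riesz _ _ _ hip _ (N * A)) => [x y|a x|x].
  - apply: (netsum_uniq (hnet _)).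
    apply: eq_netsum (netsumD (hnet x) (hnet y)) => i _.
    by rewrite (ipDl hip) mulrDl.
  - apply: (netsum_uniq (hnet _)).
    apply: eq_netsum (netsumZ a (hnet x)) => i _.
    by rewrite (ipZl hip) mulrA.
  - by apply: le_trans (hle _) _; rewrite mulrAC.
have hS k : ip k (opS g h f) = l2inner L (coef k h) (coef f g).
  rewrite /opS /synth; case: xgetP => [y _ /= ->//|/(_ x) []] k' /=.
  by rewrite -hx.
split=> [k|]; first by rewrite hS.
apply: (nrm_le_ip hip) => [|k]; first exact: mulr_ge0.
by rewrite (ipC hip) normcJ hS mulrAC.
Qed.

Lemma opS_net g h f M N : bes g M -> bes h N -> forall k,
  netsum L (fun i => ip k (U i h) * conjc (ip f (U i g))) (ip k (opS g h f)).
Proof.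
by move=> [M0 hg] hh k; apply: (opS_spec (mulr_ge0 M0 (nrm_ge0 ip f)) (hg f) hh).1.
Qed.

Lemma opS_net' g h f A N : bes f A -> bes h N -> forall k,
  netsum L (fun i => ip k (U i h) * conjc (ip f (U i g))) (ip k (opS g h f)).
Proof.
move=> hf hh k; have [A0 _] := hf.
by apply: (opS_spec (mulr_ge0 A0 (nrm_ge0 ip g)) (bes_swap g hf) hh).1.
Qed.

Lemma opS_le g h f M N : bes g M -> bes h N -> nrm (opS g h f) <= N * (M * nrm f).
Proof.
by move=> [M0 hg] hh; exact: (opS_spec (mulr_ge0 M0 (nrm_ge0 ip f)) (hg f) hh).2.
Qed.

(** The Hilbert norm now falls on the window g, at the price of a Bessel bound for f. *)
Lemma opS_le' g h f A N : bes f A -> bes h N -> nrm (opS g h f) <= N * (A * nrm g).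
Proof.
move=> hf hh; have [A0 _] := hf.
exact: (opS_spec (mulr_ge0 A0 (nrm_ge0 ip g)) (bes_swap g hf) hh).2.
Qed.

Lemma opS_lin g h M N : bes g M -> bes h N -> lin (opS g h).
Proof.
move=> hg hh; split=> [x y|a x]; apply: (ip_inj hip) => k;
    apply: (netsum_uniq (opS_net _ hg hh k)).
  rewrite (ipDr hip).
  apply: eq_netsum (netsumD (opS_net x hg hh k) (opS_net y hg hh k)) => i _.
  by rewrite (ipDl hip) conjcD mulrDr.
rewrite (ipZr hip).
apply: eq_netsum (netsumZ (conjc a) (opS_net x hg hh k)) => i _.
by rewrite (ipZl hip) conjcM mulrCA.
Qed.

Lemma opSBg g g' h f A N : bes f A -> bes h N ->
  opS g h f - opS g' h f = opS (g - g') h f.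
Proof.
move=> hf hh; apply: (ip_inj hip) => k; rewrite (ipBr hip).
apply: (fun h => netsum_uniq h (opS_net' _ hf hh k)).
rewrite -mulN1r.
apply: eq_netsum (netsumD (opS_net' g hf hh k)
  (netsumZ (-1) (opS_net' g' hf hh k))) => i _.
by rewrite linB// (ipBr hip) rmorphB mulrBr mulN1r.
Qed.

Lemma opSBh g h h' f A N N' : bes f A -> bes h N -> bes h' N' ->
  opS g h f - opS g h' f = opS g (h - h') f.
Proof.
move=> hf hh hh'; apply: (ip_inj hip) => k; rewrite (ipBr hip).
apply: (fun H => netsum_uniq H (opS_net' _ hf (besB hh hh') k)).
rewrite -mulN1r.
apply: eq_netsum (netsumD (opS_net' g hf hh k)
  (netsumZ (-1) (opS_net' g hf hh' k))) => i _.
by rewrite linB// (ipBr hip) mulrBl mulN1r.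
Qed.

Lemma opS_adj g h f k M N : bes g M -> bes h N ->
  ip k (opS g h f) = ip (opS h g k) f.
Proof.
move=> hg hh; rewrite [RHS](ipC hip).
apply: (netsum_uniq (opS_net f hg hh k)).
apply: eq_netsum (netsumJ (opS_net k hh hg f)) => i _.
by rewrite conjcM conjcK mulrC.
Qed.

(** After replacing i by [- i], [Uadj] transfers both coefficients; one acquires the phase c, the
    other its conjugate. *)
Lemma opS_swap g h f k M N A B : bes g M -> bes h N -> bes f A -> bes k B ->
  ip k (opS g h f) = ip (opS f k g) h.
Proof.
move=> hg hh hf hk; rewrite [RHS](ipC hip).
apply: (netsum_uniq (opS_net f hg hh k)).
have := netsum_reindex LN LN (@opprK W) (@opprK W) (netsumJ (opS_net g hf hk h)).
apply: eq_netsum => i _ /=; have [c c1 hc] := Uadj i.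
rewrite [ip k _](ipC hip) hc [ip f _](ipC hip) hc conjcK !conjcM conjcK.
by rewrite mulrACA [conjc c * c]mulrC phaseV// mul1r.
Qed.

Lemma opS_comm g h f i M N : bes g M -> bes h N -> L i ->
  opS g h (U i f) = U i (opS g h f).
Proof.
move=> hg hh Li; apply: (ip_inj hip) => k; have [k' <-] := Usurj i k; rewrite Uiso.
apply: (netsum_uniq (opS_net _ hg hh _)).
have := netsum_reindex (f := fun j => j - i) (f' := fun j => j + i) _ _ _ _
  (opS_net f hg hh k').
move=> /(_ (fun j Lj => LD Lj (LN Li)) (fun j Lj => LD Lj Li) (addrNK _) (addrK _)).
apply: eq_netsum => j _ /=.
have [c c1 hc] := UM i (j - i).
rewrite -[in LHS](Uiso i) -[X in _ * conjc X](Uiso i) !hc addrC subrK !(ipZr hip).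
by rewrite conjcM conjcK mulrACA [conjc c * c]mulrC phaseV// mul1r.
Qed.

(** All three arguments move, so nothing is reindexed and w need not lie in L. This is what lets
    translations outside the lattice act on the frame operator. *)
Lemma opS_cov g h f w M N : bes g M -> bes h N ->
  opS (U w g) (U w h) (U w f) = U w (opS g h f).
Proof.
move=> hg hh; apply: (ip_inj hip) => k; have [k' <-] := Usurj w k; rewrite Uiso.
apply: (netsum_uniq (opS_net _ (besU w hg) (besU w hh) _)).
apply: eq_netsum (opS_net f hg hh k') => j _ /=.
have [c c1 hc] := Ucomm j w.
rewrite !hc !(ipZr hip) !Uiso.
by rewrite conjcM conjcK mulrACA [conjc c * c]mulrC phaseV// mul1r.
Qed.

(** By commutation and adjunction, the coefficient of k against [U i (opS g h f)] is that of
    [opS h g k] against [U i f]. *)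
Lemma bes_opS g h f M N A : bes g M -> bes h N -> bes f A ->
  bes (opS g h f) (A * (M * N)).
Proof.
move=> hg hh [A0 hf]; have [M0 _] := hg; have [N0 _] := hh.
split; first by rewrite !mulr_ge0.
move=> k s ss; rewrite big_seq.
under eq_bigr => i si do rewrite -(opS_comm _ hg hh (ss.2 _ si)) (opS_adj _ _ hg hh).
rewrite -big_seq; apply: le_trans (hf _ _ ss) _.
rewrite ler_pXn2r// ?nnegrE ?mulr_ge0// -!mulrA ler_wpM2l//; exact: opS_le.
Qed.

(* The adjoint of [Q h = opS g h f] is [k |-> opS f k g], so that Q preserves
   Bessel vectors and [lax] applies to Q^* Q. *)
Lemma opS_le_synth g u f M A B : bes g M -> bes f A -> bes u B ->
  nrm (opS g u f) <= A * M * nrm u.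
Proof.
move=> hg hf hu; have [M0 _] := hg; have [A0 _] := hf.
(* [lax] needs a positive rate, so a vanishing bound is settled by the two direct estimates. *)
have [AM0|AM0] := eqVneq (A * M) 0.
  rewrite AM0 mul0r; move/eqP: AM0; rewrite mulf_eq0 => /orP[]/eqP e0.
    by have := opS_le' g hf hu; rewrite e0 mul0r mulr0.
  by have := opS_le f hg hu; rewrite e0 mul0r mulr0.
have AMp : 0 < A * M by rewrite lt_def AM0 mulr_ge0.
pose Q h := opS g h f; pose Qa k := opS f k g.
pose P : set V := [set h | exists B, bes h B]%classic.
have bQ h N : bes h N -> bes (Q h) (A * M * N).
  by move=> hh; rewrite -mulrA; exact: bes_opS.
have bQa h N : bes h N -> bes (Qa h) (A * M * N).
  by move=> hh; rewrite (mulrC A) -mulrA; exact: bes_opS.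
have adjQ h k : P h -> P k -> ip (Qa (Q h)) k = ip (Q h) (Q k).
  move=> [N hN] [N' hN']; rewrite (ipC hip) [RHS](ipC hip); congr conjc.
  exact: (opS_swap hf (bQ _ _ hN) hg hN').
have PQ h : P h -> P (Qa (Q h)).
  by move=> [N /bQ/bQa hN]; exists (A * M * (A * M * N)).
have Pu : P u by exists B.
have iterb n : bes (iter n (Qa \o Q) u) (((A * M) ^+ 2) ^+ n * B).
  elim: n => [|n IH]; first by rewrite expr0 mul1r.
  rewrite iterS /=; have := bQa _ _ (bQ _ _ IH).
  have -> // : A * M * (A * M * (((A * M) ^+ 2) ^+ n * B)) = ((A * M) ^+ 2) ^+ n.+1 * B.
  by rewrite [_ ^+ n.+1]exprS expr2 !mulrA.
have hlax : nrm ((Qa \o Q) u) <= (A * M) ^+ 2 * nrm u.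
  apply: (@lax _ _ _ hip P (Qa \o Q) ((A * M) ^+ 2) B) => //.
  - move=> y x Py Px /=; rewrite adjQ// [RHS](ipC hip) adjQ// -(ipC hip)//.
  - by rewrite exprn_gt0.
  - by move=> n; rewrite mulrC; exact: (bes_nrm (iterb n)).
have h : nrm (Q u) ^+ 2 <= (A * M * nrm u) ^+ 2.
  rewrite (sqr_nrm hip) -adjQ//; apply: le_trans (ReCS hip _ _) _.
  by rewrite exprMn [_ ^+ 2 * nrm u ^+ 2]mulrA ler_wpM2r.
by move: h; rewrite ler_pXn2r ?nnegrE ?mulr_ge0.
Qed.

(** One window is changed at a time. The change of the analysis window is estimated by [opS_le'],
    that of the synthesis window by [opS_le_synth]; each contributes [A * M]. *)
Lemma frame_variation g k w M A : bes g M -> bes k A ->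
  nrm (opS (U w g) (U w g) k - opS g g k) <= 2 * (A * M) * nrm (U w g - g).
Proof.
move=> hg hk; have hwg := besU w hg; have [A0 _] := hk; have [M0 _] := hg.
rewrite -(subrK (opS g (U w g) k) (opS (U w g) _ _)) -addrA.
rewrite (opSBg _ _ hk hwg) (opSBh g hk hwg hg).
apply: le_trans (nrmD hip _ _) _.
have h1 := opS_le' (U w g - g) hk hwg.
have h2 := opS_le_synth hg hk (besB hwg hg).
rewrite mulrA (mulrC M) in h1; lra.
Qed.

(* In the application E consists of the pairs (translation by t, |t|), so that
   [lip] expresses membership in H^1. *)
Variable E : set (W * R).
Hypothesis E0 : forall e, E e -> 0 < e.2.

Definition lip (x : V) (K : R) := forall e, E e -> nrm (U e.1 x - x) <= K * e.2.

Definition smooth : set V :=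
  [set x | (exists K, lip x K) /\ (exists M, bes x M)]%classic.

Hypothesis smooth_dense : forall k e, 0 < e -> exists2 m, smooth m & nrm (k - m) <= e.

(** The supremum of these seminorms plays the role of the norm of H^1_Lambda. Finite synthesis sums
    and single difference quotients are used because each of them is continuous for [nrm]. *)
Definition gauges : set (V -> R) := [set q | [\/ q = nrm,
  exists s c, [/\ seq_in L s, \sum_(i <- s) normc (c i) ^+ 2 <= 1 &
    q = fun x => nrm (\sum_(i <- s) c i *: U i x)] |
  exists2 e, E e & q = fun x => e.2^-1 * nrm (U e.1 x - x)]]%classic.

Lemma gaugesD q : gauges q -> forall x y, q (x + y) <= q x + q y.
Proof.
move=> [->|[s [c [_ _ ->]]]|[e Ee ->]] x y; first exact: nrmD.
  under eq_bigr do rewrite (Ulin _).1 scalerDr.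
  by rewrite big_split; exact: nrmD.
rewrite -mulrDr ler_wpM2l ?invr_ge0 ?(ltW (E0 Ee))// (Ulin _).1 opprD addrACA.
exact: nrmD.
Qed.

Lemma gaugesZ q : gauges q -> forall a x, q (a *: x) = normc a * q x.
Proof.
move=> [->|[s [c [_ _ ->]]]|[e Ee ->]] a x; first exact: nrmZ.
  rewrite -(nrmZ hip) scaler_sumr; congr nrm; apply: eq_bigr => i _.
  by rewrite (Ulin _).2 !scalerA mulrC.
by rewrite mulrCA -(nrmZ hip) (Ulin _).2 scalerBr.
Qed.

Lemma gauges_cont q : gauges q -> exists2 c, 0 <= c & forall x, q x <= c * nrm x.
Proof.
move=> [->|[s [c [_ _ ->]]]|[e Ee ->]].
- by exists 1 => // x; rewrite mul1r.
- exists (\sum_(i <- s) normc (c i)); first by apply: sumr_ge0 => i _; exact: normc_ge0.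
  move=> x; apply: le_trans (nrm_sum hip _ _) _; rewrite mulr_suml.
  by apply: ler_sum => i _; rewrite (nrmZ hip) nrmU.
- have e0 := E0 Ee; exists (e.2^-1 * 2); first by rewrite mulr_ge0// invr_ge0 ltW.
  move=> x; rewrite -mulrA ler_wpM2l ?invr_ge0 ?(ltW e0)//.
  by apply: le_trans (nrmB hip _ _) _; rewrite nrmU; lra.
Qed.

Lemma gauges_nrm : gauges nrm. Proof. by constructor 1. Qed.

Lemma gauged_smooth : gauged gauges = smooth.
Proof.
apply/seteqP; split=> [x [M hM]|x [[K hK] [M hM]]].
  have M0 : 0 <= M by apply: le_trans (hM _ gauges_nrm).
  split; exists M.
    move=> e Ee; rewrite mulrC -ler_pdivrMl ?E0//.
    by apply: (hM (fun x => e.2^-1 * nrm (U e.1 x - x))); constructor 3; exists e.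
  apply/bes_synth => // s c ss c1.
  by apply: (hM (fun x => nrm (\sum_(i <- s) c i *: U i x))); constructor 2; exists s, c.
exists (Num.max (nrm x) (Num.max K M)) => q; rewrite !le_max.
move=> [->|[s [c [ss c1 ->]]]|[e Ee ->]]; first by rewrite lexx.
  by have [M0 _] := hM; rewrite (proj1 (bes_synth _ M0) hM)// !orbT.
by apply/or3P; constructor 2; rewrite ler_pdivrMl ?E0// mulrC hK.
Qed.

Variable g : V.
Hypothesis g_smooth : smooth g.
Variable z : R[i].
Let S := opS g g.
Let T f := S f - z *: f.

Let frame_lin : lin S.
Proof. by have [_ [M hg]] := g_smooth; exact: (opS_lin hg hg). Qed.

Lemma shifted_lin : lin T.
Proof.
split=> [x y|a x]; rewrite /T.
  by rewrite frame_lin.1 scalerDr opprD addrACA.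
by rewrite frame_lin.2 scalerBr !scalerA (mulrC a).
Qed.

Lemma shifted_bounded : exists2 c, 0 <= c & forall x, nrm (T x) <= c * nrm x.
Proof.
have [_ [M hg]] := g_smooth; have [M0 _] := hg.
exists (M * M + normc z); first by rewrite addr_ge0 ?mulr_ge0 ?normc_ge0.
move=> x; apply: le_trans (nrmB hip _ _) _; rewrite (nrmZ hip) mulrDl lerD2r -mulrA.
exact: opS_le.
Qed.

Lemma frame_sym x y : ip (S x) y = ip x (S y).
Proof. by have [_ [M hg]] := g_smooth; rewrite -(opS_adj _ _ hg hg). Qed.

Lemma frame_Im x : complex.Im (ip (S x) x) = 0.
Proof.
have := congr1 (@complex.Im R) (ipC hip x (S x)); rewrite ImJ -frame_sym => h.
lra.
Qed.

Lemma shifted_sym x y : complex.Im z = 0 -> ip (T x) y = ip x (T y).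
Proof.
move=> z0; rewrite (ipBl hip) (ipBr hip) frame_sym (ipZl hip) (ipZr hip).
by congr (_ - _ * _); apply: complexP; rewrite ?ReJ ?ImJ ?z0 ?oppr0.
Qed.

(** [eigen_bound] at z yields injectivity and closed range. A vector y orthogonal to the range
    satisfies [S y = conjc z *: y] and vanishes by [eigen_bound] at the conjugate. *)
Lemma shifted_nonreal : complex.Im z != 0 ->
  bijective T /\ (forall x, nrm x <= `|complex.Im z|^-1 * nrm (T x)).
Proof.
move=> z0; have n0 : 0 < `|complex.Im z| by rewrite normr_gt0.
have bb x : nrm x <= `|complex.Im z|^-1 * nrm (T x).
  rewrite ler_pdivlMl//; exact: (eigen_bound hip _ frame_Im).
split=> //; have [c c0 Tc] := shifted_bounded.
have [TD TZ] := shifted_lin.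
have Tdense k e : 0 < e -> exists2 m, range T m & nrm (k - m) <= e.
  apply: (dense_of_orthogonal hip).
  - by exists 0 => //; exact: lin0 shifted_lin.
  - by move=> _ _ [x _ <-] [y _ <-]; exists (x + y) => //; rewrite TD.
  - by move=> a _ [x _ <-]; exists (a *: x) => //; rewrite TZ.
  move=> y hy; apply/(nrm_eq0 hip)/eqP; rewrite eq_le nrm_ge0 andbT.
  have h : S y - conjc z *: y = 0.
    apply: (ip_inj hip) => x; rewrite (ipBr hip) (ipZr hip) conjcK -frame_sym ip0r//.
    by rewrite -(ipZl hip) -(ipBl hip) hy//; exists x.
  have := eigen_bound hip (conjc z) frame_Im y; rewrite h (nrm0 hip) ImJ normrN.
  by rewrite pmulr_rle0.
apply: (bdd_below_bijective hip shifted_lin c0 Tc (E := setT) (D := range T)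
  (r := `|complex.Im z|^-1)).
- by move=> k e e0; exists k => //; rewrite subrr (nrm0 hip) ltW.
- exact: Tdense.
- by rewrite invr_ge0.
- by move=> x _; exact: bb.
- by move=> _ [x _ <-]; exists x.
Qed.

Lemma shifted_bounded_below : bijective T ->
  exists2 r, 0 <= r & forall x, nrm x <= r * nrm (T x).
Proof.
move=> bij; have [z0|z0] := eqVneq (complex.Im z) 0.
  apply: (symmetric_bijective_bounded_below hip shifted_lin) => // x y.
  exact: shifted_sym.
exists `|complex.Im z|^-1; first by rewrite invr_ge0.
exact: (shifted_nonreal z0).2.
Qed.

Lemma shifted_smooth x : smooth x -> smooth (T x).
Proof.
move=> [[K hK] [A hA]]; have [[Kg hKg] [M hg]] := g_smooth.
have [A0 _] := hA; have [M0 _] := hg.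
have hT : smooth (S x).
  split; last by exists (A * (M * M)); exact: bes_opS.
  exists (M * M * K + 2 * (A * M) * Kg) => e Ee.
  (* Covariance turns the translate of [S x] into the frame operator of the translated window at the
     translate of x. *)
  have -> : U e.1 (S x) - S x = (opS (U e.1 g) (U e.1 g) (U e.1 x) - S (U e.1 x)) +
      S (U e.1 x - x).
    by rewrite (linB _ _ frame_lin) -(opS_cov x e.1 hg hg) addrA subrK.
  apply: le_trans (nrmD hip _ _) _.
  have h1 := opS_le (U e.1 x - x) hg hg.
  have h2 := frame_variation e.1 hg (besU e.1 hA).
  have h3 := hK e Ee; have h4 := hKg e Ee.
  have : M * (M * nrm (U e.1 x - x)) <= M * (M * (K * e.2)).
    by rewrite !ler_wpM2l.
  have : 2 * (A * M) * nrm (U e.1 g - g) <= 2 * (A * M) * (Kg * e.2).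
    by rewrite ler_wpM2l// !mulr_ge0.
  move: h1 h2; rewrite /S; lra.
have hx : smooth x by split; [exists K|exists A].
move: hT hx; rewrite -gauged_smooth => hT hx.
apply: (gaugedB gaugesD gaugesZ hT).
exact: (gaugedZ gaugesZ).
Qed.

Lemma shifted_inverse_smooth x : bijective T -> smooth (T x) -> smooth x.
Proof.
move=> bij [[K hK] [A hA]]; have [[Kg hKg] [M hg]] := g_smooth.
have [A0 hA'] := hA; have [M0 _] := hg.
have [r r0 hr] := shifted_bounded_below bij.
have [R' hR'] := bijective_adjoint_inverse hip shifted_lin bij r0 hr.
(* The Bessel bound of x comes first, since [frame_variation] needs it for the Lipschitz bound. *)
have bx : bes x (A * r).
  split=> [|f s ss]; first exact: mulr_ge0.
  rewrite big_seq; under eq_bigr => i si.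
    rewrite (ipC hip) normcJ -(hR' (U i x) f).1 (ipC hip) normcJ.
    rewrite {1}/T {1}/S (opS_comm _ hg hg (ss.2 _ si)) -(Ulin i).2 -(linB _ _ (Ulin i)).
    over.
  rewrite -big_seq; apply: le_trans (hA' _ _ ss) _.
  rewrite ler_pXn2r// ?nnegrE ?mulr_ge0// -mulrA ler_wpM2l//.
  exact: (hR' x f).2.
split; last by exists (A * r).
exists (r * (K + 2 * (A * r * M) * Kg)) => e Ee.
rewrite -[r * _ * _]mulrA; apply: le_trans (hr _) _; rewrite ler_wpM2l//.
have -> : T (U e.1 x - x) = (U e.1 (T x) - T x) -
    (opS (U e.1 g) (U e.1 g) (U e.1 x) - opS g g (U e.1 x)).
  rewrite (linB _ _ shifted_lin) /T (linB _ _ (Ulin _)) (Ulin _).2 -(opS_cov x e.1 hg hg) /S.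
  have zmod (a b d f : V) : b - d - f = a - d - f - (a - b).
    by rewrite opprB [RHS]addrC -[a - d - f]addrA subrKA addrA.
  exact: zmod.
apply: le_trans (nrmB hip _ _) _; have h := frame_variation e.1 hg (besU e.1 bx).
have h3 := hK e Ee; have h4 := hKg e Ee.
have : 2 * (A * r * M) * nrm (U e.1 g - g) <= 2 * (A * r * M) * (Kg * e.2).
  by rewrite ler_wpM2l// !mulr_ge0.
lra.
Qed.

Lemma smooth_bijective : bijective T -> set_bij smooth smooth T.
Proof.
move=> bij; have [T' TK T'K] := bij; split.
- by move=> x; exact: shifted_smooth.
- by move=> x y _ _; exact: (can_inj TK).
- move=> y hy; exists (T' y); last exact: T'K.
  by apply: shifted_inverse_smooth => //; rewrite T'K.
Qed.

Lemma bijective_of_smooth : set_bij smooth smooth T -> bijective T.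
Proof.
move=> [funT injT surjT].
have [z0|z0] := eqVneq (complex.Im z) 0; last exact: (shifted_nonreal z0).1.
have [TD TZ] := shifted_lin.
have gs : gauged gauges = smooth := gauged_smooth.
(* I is the inverse on [smooth] and arbitrary elsewhere. *)
have /choice[I hI] : forall y, exists x, smooth y -> smooth x /\ T x = y.
  move=> y; have [sy|nsy] := pselect (smooth y); last by exists 0.
  by have [x sx Tx] := surjT _ sy; exists x.
have sI y : smooth y -> smooth (I y) by move=> /hI[].
have TI y : smooth y -> T (I y) = y by move=> /hI[].
have sD x y : smooth x -> smooth y -> smooth (x + y).
  by rewrite -gs; exact: (gaugedD gaugesD).
have sZ a x : smooth x -> smooth (a *: x).
  by rewrite -gs; exact: (gaugedZ gaugesZ).
have inj x y : smooth x -> smooth y -> T x = T y -> x = y.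
  by move=> sx sy; apply: injT; rewrite inE.
have ID x y : smooth x -> smooth y -> I (x + y) = I x + I y.
  move=> sx sy; apply: inj; [exact/sI/sD|apply: sD; exact: sI|].
  by rewrite TD !TI//; exact: sD.
have IZ a x : smooth x -> I (a *: x) = a *: I x.
  move=> sx; apply: inj; [exact/sI/sZ|apply: sZ; exact: sI|].
  by rewrite TZ !TI//; exact: sZ.
have Isym x y : smooth x -> smooth y -> ip (I x) y = ip x (I y).
  by move=> sx sy; rewrite -{1}(TI _ sy) -shifted_sym// TI.
have ub := @uniform_boundedness R V ip hip gauges gaugesD gaugesZ gauges_cont gauges_nrm.
(* First stage, from the gauges to [nrm]: the functionals [ip (I x) k] with k smooth are continuous
   since I is symmetric, and k proportional to [I x] recovers the norm. *)
have [C C0 hC] : exists2 C, 0 <= C & forall x M, gball gauges x M -> nrm (I x) <= C * M.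
  pose P : set (V -> R) := [set p | exists k, [/\ smooth k, nrm k <= 1 &
    p = fun x => normc (ip (I x) k)]]%classic.
  have [||||C C0 hC] := ub P.
  - move=> _ [k [_ _ ->]] x y; rewrite gs => sx sy; rewrite ID// (ipDl hip).
    exact: le_normcD.
  - by move=> _ [k [_ _ ->]] a x; rewrite gs => sx; rewrite IZ// (ipZl hip) normcM.
  - move=> _ [k [sk _ ->]]; exists (nrm (I k)) => x M bx.
    have sx : smooth x by rewrite -gs; exists M.
    rewrite Isym//; apply: le_trans (CS _ _) _; rewrite mulrC ler_wpM2l//.
    exact: (bx nrm gauges_nrm).
  - move=> x _; exists (nrm (I x)) => _ [k [_ k1 ->]].
    by apply: le_trans (CS _ _) _; rewrite ler_piMr.
  exists C => // x M bx; have sx : smooth x by rewrite -gs; exists M.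
  have [->|x0] := eqVneq (nrm (I x)) 0.
    by rewrite mulr_ge0//; exact: (gball_ge0 gauges_nrm bx).
  have xp : 0 < nrm (I x) by rewrite lt_def x0 nrm_ge0.
  have k1 : nrm ((nrm (I x))^-1%:C *: I x) <= 1.
    by rewrite (nrmZ hip) normc_real gtr0_norm ?invr_gt0// mulVf.
  have := hC (fun y => normc (ip (I y) ((nrm (I x))^-1%:C *: I x))) _ x M bx.
  rewrite (ipZr hip) conjcR (ipxx hip) -rmorphM normc_real.
  rewrite expr2 mulrA mulVf// mul1r gtr0_norm//; apply.
  by exists ((nrm (I x))^-1%:C *: I x); split=> //; exact/sZ/sI.
(* Second stage, from the gauges to themselves: each [q \o I] is bounded by the first stage, and at
   a given x they are jointly bounded because [I x] is smooth. *)
have [B B0 hB] : exists2 B, 0 <= B & forall x M, gball gauges x M -> gball gauges (I x) (B * M).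
  pose P : set (V -> R) := [set p | exists2 q, gauges q & p = q \o I]%classic.
  have [||||B B0 hB] := ub P.
  - move=> _ [q Qq ->] x y; rewrite gs => sx sy /=; rewrite ID//; exact: gaugesD.
  - by move=> _ [q Qq ->] a x; rewrite gs => sx /=; rewrite IZ// gaugesZ.
  - move=> _ [q Qq ->]; have [c c0 qc] := gauges_cont Qq; exists (c * C) => x M bx /=.
    by apply: le_trans (qc _) _; rewrite -mulrA ler_wpM2l//; exact: hC.
  - move=> x; rewrite gs => /sI; rewrite -gs => -[M hM]; exists M => _ [q Qq ->].
    exact: hM.
  by exists B => // x M bx q Qq; apply: (hB (q \o I)) => //; exists q.
have [c c0 Tc] := shifted_bounded.
apply: (bdd_below_bijective hip shifted_lin c0 Tc smooth_dense smooth_dense (r := B + 1)).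
- by rewrite addr_ge0.
- move=> x sx; have sTx : smooth (T x) by exact: shifted_smooth.
  have {1}-> : x = I (T x) by apply: inj => //; [exact: sI|rewrite TI].
  have [M bM] : gauged gauges (T x) by rewrite gs.
  have M0 : 0 <= M := gball_ge0 gauges_nrm bM.
  (* The rate is [B + 1] because it must be positive and B may be 0. *)
  apply: (@lax _ _ _ hip smooth I (B + 1) M) => //.
  + by rewrite ltr_wpDl.
  + move=> n; have bn : gball gauges (iter n I (T x)) (B ^+ n * M).
      elim: n => [|n IH]; first by rewrite expr0 mul1r.
      by rewrite iterS exprS -mulrA; exact: hB.
    apply: le_trans (bn _ gauges_nrm) _; rewrite mulrC ler_wpM2l//.
    by rewrite lerXn2r ?nnegrE ?addr_ge0// lerDl.
- by move=> y sy; exists (I y); exact: TI.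
Qed.

Theorem smooth_spectrum : set_bij smooth smooth T <-> bijective T.
Proof. by split; [exact: bijective_of_smooth|exact: smooth_bijective]. Qed.

End shift_system.

(** * Completeness of L2 and time-frequency shifts *)

Section sqr_summable_increments.
Variable R : realType.

(** A weighted Cauchy-Schwarz inequality with weights [2^-i], whose sum from n on is [2 * 2^-n]. The
    induction closes through [(y + d)^2 <= 2 y^2 + 2 d^2]. *)
Lemma telescope_sqr (a : nat -> R) (H : R) n k :
  (\sum_(i < k) 2 ^+ (n + i) * (a (n + i).+1 - a (n + i)%N) ^+ 2) <= H ->
  (a (n + k)%N - a n) ^+ 2 <= 2 * 2^-1 ^+ n * H.
Proof.
elim: k n H => [|k IH] n H.
  rewrite big_ord0 addn0 subrr expr0n/= => H0.
  by rewrite !mulr_ge0// exprn_ge0// invr_ge0.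
rewrite big_ord_recl/= addn0 => hH.
have := IH n.+1 (H - 2 ^+ n * (a n.+1 - a n) ^+ 2).
have -> : (n.+1 + k = n + k.+1)%N by rewrite addnS.
have e : \sum_(i < k) 2 ^+ (n.+1 + i) * (a (n.+1 + i).+1 - a (n.+1 + i)%N) ^+ 2 =
    \sum_(i < k) 2 ^+ (n + i.+1) * (a (n + i.+1).+1 - a (n + i.+1)%N) ^+ 2.
  by apply: eq_bigr => i _; rewrite addSnnS.
rewrite e => /(_ _); rewrite lerBrDl => /(_ hH).
set d := a n.+1 - a n; set y := a (n + k.+1)%N - a n.+1 => hy.
have -> : a (n + k.+1)%N - a n = y + d by rewrite /y /d addrA subrK.
have h1 := sqr_ge0 (y - d).
have h2 : (2 : R)^-1 ^+ n * 2 ^+ n = 1 by rewrite -exprMn mulVf// expr1n.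
have : 2 * 2^-1 ^+ n.+1 * (H - 2 ^+ n * d ^+ 2) = 2^-1 ^+ n * H - (2^-1 ^+ n * 2 ^+ n) * d ^+ 2.
  by rewrite exprS; field.
rewrite h2 mul1r => h3; rewrite h3 in hy.
have -> : (y + d) ^+ 2 = 2 * y ^+ 2 + 2 * d ^+ 2 - (y - d) ^+ 2 by ring.
lra.
Qed.

Lemma cvg_of_sqr_summable (a : nat -> R) (H : R) :
  (forall N, \sum_(i < N) 2 ^+ i * (a i.+1 - a i) ^+ 2 <= H) ->
  cvgn a /\ forall n, (limn a - a n) ^+ 2 <= 2 * 2^-1 ^+ n * H.
Proof.
move=> hH; have H0 : 0 <= H by have := hH 0%N; rewrite big_ord0.
have hb n k : (a (n + k)%N - a n) ^+ 2 <= 2 * 2^-1 ^+ n * H.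
  apply: telescope_sqr; apply: le_trans (hH (n + k)%N).
  rewrite big_split_ord/= lerDr sumr_ge0// => i _.
  by rewrite mulr_ge0 ?sqr_ge0// exprn_ge0.
have half0 n : 0 <= (2^-1 : R) ^+ n by rewrite exprn_ge0// invr_ge0.
have ca : cvgn a.
  apply: cauchy_cvg; apply: cauchy_exP => e e0.
  have e1 : 0 < e ^+ 2 / (2 * (H + 1)) / 2 by rewrite !divr_gt0 ?exprn_gt0// mulr_gt0// ltr_wpDl.
  have [N hN] := half_ltn e1; exists (a N); exists N => // m /= Nm.
  rewrite -(subnKC Nm) /ball/= distrC.
  rewrite -(@ltr_pXn2r _ 2)// ?nnegrE ?(ltW e0)// real_normK ?num_real//.
  apply: le_lt_trans (hb N (m - N)%N) _.
  have := hN N (leqnn _); rewrite ler_pdivlMr// ler_pdivlMr; last by rewrite mulr_gt0// ltr_wpDl.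
  have := half0 N; set q := 2^-1 ^+ N => q0 hq.
  have e2 : 0 < e ^+ 2 by rewrite exprn_gt0.
  have [->|qn0] := eqVneq q 0; first by rewrite mulr0 mul0r.
  have qp : 0 < q by rewrite lt_def qn0.
  have : 0 < q * (2 * (H + 1)) by rewrite !mulr_gt0// ltr_wpDl.
  have := mulr_ge0 q0 H0; move: hq; lra.
split=> // n; have cn : ((fun m => (a m - a n) ^+ 2) @ \oo --> (limn a - a n) ^+ 2)%classic.
  by rewrite expr2; under eq_fun do rewrite expr2; apply: cvgM; apply: cvgB => //; exact: cvg_cst.
by apply: (cvgr_to_le cn); exists n => // m /= nm; rewrite -(subnKC nm); exact: hb.
Qed.

Lemma half_sum_le N : \sum_(0 <= i < N) (2^-1 : R) ^+ i <= 2.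
Proof.
have -> : \sum_(0 <= i < N) (2^-1 : R) ^+ i = 2 - 2 * 2^-1 ^+ N.
  elim: N => [|N IH]; first by rewrite big_geq// expr0 mulr1 subrr.
  by rewrite big_nat_recr//= IH exprS; field.
by rewrite lerBlDr lerDl mulr_ge0// exprn_ge0// invr_ge0.
Qed.

End sqr_summable_increments.

(** * The Riesz-Fischer theorem *)

Section real_square_integrable.
Context d (T : measurableType d) (R : realType) (mu : {measure set T -> \bar R}).
Implicit Types f g : T -> R.

Definition rint f := mu.-integrable setT (EFin \o f).
Local Notation I f := (\int[mu]_x f x).

Lemma rint_measurable f : rint f -> measurable_fun setT f.
Proof. by move=> /integrableP[/measurable_EFinP]. Qed.

Lemma rintD f g : rint f -> rint g -> rint (fun x => f x + g x).
Proof. by move=> hf hg; have := integrableD measurableT hf hg. Qed.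

Lemma rintZ a f : rint f -> rint (fun x => a * f x).
Proof. by move=> hf; have := integrableZl measurableT a hf. Qed.

Lemma rintB f g : rint f -> rint g -> rint (fun x => f x - g x).
Proof. by move=> hf hg; have := integrableB measurableT hf hg. Qed.

Lemma rint_le f g : measurable_fun setT f -> (forall x, `|f x| <= g x) ->
  rint g -> rint f.
Proof.
move=> mf fg; apply: le_integrable => //; first exact/measurable_EFinP.
by move=> x _ /=; rewrite lee_fin; apply: le_trans (fg x) (ler_norm _).
Qed.

Lemma rint_abs f : rint f -> rint (fun x => `|f x|).
Proof.
move=> hf; apply: (@rint_le _ (fun x => `|f x|)) => [|x|].
- exact: measurableT_comp (rint_measurable hf).
- by rewrite normr_id.
- by have := integrable_abse hf.
Qed.

Lemma Lfun2P f : f \in Lfun mu 2%:E <->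
  measurable_fun setT f /\ rint (fun x => f x ^+ 2).
Proof.
split=> [hf|[mf if2]].
  split; last exact: Lfun2_integrable_sqr.
  by move: hf; rewrite inE => /andP[/[!inE]].
rewrite inE; apply/andP; split; rewrite inE//=.
rewrite /finite_norm unlock; apply: poweR_lty.
move/integrableP : if2 => [_]; apply: le_lt_trans.
rewrite le_eqVlt; apply/orP; left; apply/eqP/eq_integral => x _ /=.
by rewrite powR_mulrn// normrX.
Qed.

(** The weights [2 ^+ n] in H leave it an integral of at most 2 and make the squared pointwise error
    at most [2 * 2^-n * H]. Integrating gives the constant 4 without the triangle inequality in
    L^2. *)
Lemma riesz_fischer_real (f : nat -> T -> R) :
  (forall n, measurable_fun setT (f n)) ->
  (forall n, rint (fun x => (f n.+1 x - f n x) ^+ 2)) ->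
  (forall n, I (fun x => (f n.+1 x - f n x) ^+ 2) <= 4^-1 ^+ n) ->
  exists l : T -> R, [/\ measurable_fun setT l,
    forall n, rint (fun x => (l x - f n x) ^+ 2) &
    forall n, I (fun x => (l x - f n x) ^+ 2) <= 4 * 2^-1 ^+ n].
Proof.
move=> mf intf If.
pose D n x := 2 ^+ n * (f n.+1 x - f n x) ^+ 2.
have D0 n x : 0 <= D n x by rewrite mulr_ge0 ?sqr_ge0// exprn_ge0.
have mD n : measurable_fun setT (D n) by apply/rint_measurable/rintZ.
pose H x := (\sum_(0 <= n <oo) (D n x)%:E)%E.
have H0 x : (0 <= H x)%E by apply: nneseries_ge0 => n _ _; rewrite lee_fin.
have mH : measurable_fun setT H.
  apply: (@ge0_emeasurable_sum _ _ _ setT (fun n x => (D n x)%:E) xpredT).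
  - by move=> n x _ _; rewrite lee_fin.
  - by move=> n _; apply/measurable_EFinP.
have IH : (\int[mu]_x H x <= 2%:E)%E.
  rewrite integral_nneseries//; last 2 first.
  - by move=> n; apply/measurable_EFinP.
  - by move=> n x _; rewrite lee_fin.
  apply: lime_le.
    apply: is_cvg_nneseries => n _ _; apply: integral_ge0 => x _.
    by rewrite lee_fin.
  apply: nearW => N; apply: le_trans (_ : (\sum_(0 <= i < N) 2^-1 ^+ i)%:E <= _)%E; last first.
    by rewrite lee_fin half_sum_le.
  rewrite -sumEFin; apply: lee_sum => n _.
  have iD : rint (D n) by exact: rintZ.
  rewrite -[leLHS]fineK; last exact: integrable_fin_num iD.
  rewrite lee_fin [leLHS]RintegralZl//; last exact: intf.
  apply: le_trans (ler_wpM2l _ (If n)) _; first exact: exprn_ge0.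
  by rewrite -exprMn (_ : 2 * 4^-1 = 2^-1)//; field.
have iH : mu.-integrable setT H.
  apply/integrableP; split=> //; apply: le_lt_trans (ltry 2).
  by rewrite (eq_integral H) => [|x _]; [exact: IH|exact: gee0_abs].
pose A := [set x | H x \is a fin_num]%classic.
have DH x N : A x -> \sum_(i < N) D i x <= fine (H x).
  move=> Ax; rewrite -lee_fin fineK// -sumEFin.
  rewrite -(big_mkord xpredT (fun i => (D i x)%:E)).
  by apply: nneseries_lim_ge => n _ _; rewrite lee_fin.
(* Cutting off where H is infinite makes the limit exist at every point, so that l is measurable. *)
pose g n x := if H x \is a fin_num then f n x else 0.
have gH x : cvgn (g ^~ x) /\ forall n, (((limn (g ^~ x) - g n x) ^+ 2)%:E <= (2 * 2^-1 ^+ n)%:E * H x)%E.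
  rewrite /g; case: (boolP (H x \is a fin_num)) => [Ax|nAx].
    have [c1 c2] := @cvg_of_sqr_summable R (f ^~ x) _ (fun N => DH x N Ax); split=> // n.
    by rewrite -(@fineK _ (H x))// -EFinM lee_fin.
  split; first exact: is_cvg_cst.
  move=> n; rewrite lim_cst// subrr expr0n; apply: mule_ge0 => //.
pose l x := limn (g ^~ x).
have mg n : measurable_fun setT (g n).
  apply: measurable_fun_ifT => //; apply: (measurable_fun_bool true) => /=.
  by have := emeasurable_fin_num measurableT mH; rewrite setTI.
have ml : measurable_fun setT l.
  by apply: (measurable_fun_cvg mg) => x _; exact: (gH x).1.
(* Where H is infinite the right-hand side is [+oo], so the original f may be put back. *)
have bnd n x : (((l x - f n x) ^+ 2)%:E <= (2 * 2^-1 ^+ n)%:E * H x)%E.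
  have := (gH x).2 n; rewrite -/(l x) /g; case: ifPn => //.
  rewrite ge0_fin_numE// ltey negbK => /eqP -> _; rewrite gt0_muley ?leey//.
have il n : rint (fun x => (l x - f n x) ^+ 2).
  apply: (le_integrable measurableT _ _ (integrableZl measurableT (2 * 2^-1 ^+ n) iH)).
    by apply/measurable_EFinP/measurable_funX/measurable_funB.
  move=> x _ /=; rewrite ger0_norm ?sqr_ge0//; apply: le_trans (bnd n x) _.
  exact: lee_abs.
exists l; split=> // n.
have q0 : 0 <= (2 * 2^-1 ^+ n : R) by rewrite mulr_ge0// exprn_ge0// invr_ge0.
rewrite -lee_fin /Rintegral fineK; last exact: integrable_fin_num (il n).
apply: (@le_trans _ _ (\int[mu]_x ((2 * 2^-1 ^+ n)%:E * H x))%E).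
  apply: ge0_le_integral => //.
  - by move=> x _; rewrite lee_fin sqr_ge0.
  - by apply/measurable_EFinP/measurable_funX/measurable_funB.
  - by apply: measurable_funeM.
rewrite ge0_integralZl//.
apply: le_trans (lee_wpmul2l _ IH) _; first by rewrite lee_fin.
by rewrite -EFinM lee_fin; lra.
Qed.

End real_square_integrable.

Section complex_coordinates.
Variable R : realType.
Local Notation Re := (@complex.Re R).
Local Notation Im := (@complex.Im R).
Implicit Types z w : R[i].

Lemma ReM z w : Re (z * w) = Re z * Re w - Im z * Im w.
Proof. by case: z; case: w. Qed.
Lemma ImM z w : Im (z * w) = Re z * Im w + Im z * Re w.
Proof. by case: z; case: w. Qed.
Lemma ReMJ z w : Re (z * conjc w) = Re z * Re w + Im z * Im w.
Proof. by rewrite ReM ReJ ImJ mulrN opprK. Qed.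
Lemma ImMJ z w : Im (z * conjc w) = Im z * Re w - Re z * Im w.
Proof. by rewrite ImM ReJ ImJ mulrN addrC. Qed.

End complex_coordinates.

(** * Complex integrals and the Hilbert space of classes *)

Section complex_integral.
Context d (T : measurableType d) (R : realType) (mu : {measure set T -> \bar R}).
Implicit Types f g : T -> R[i].
Local Notation rint := (rint mu).
Local Notation Re := (@complex.Re R).
Local Notation Im := (@complex.Im R).

Lemma eq_rint (u v : T -> R) : (forall x, u x = v x) -> rint u -> rint v.
Proof. by move=> /funext ->. Qed.

Definition cint f := rint (fun x => Re (f x)) /\ rint (fun x => Im (f x)).

Definition cmeasurable f := measurable_fun setT (fun x => Re (f x)) /\
  measurable_fun setT (fun x => Im (f x)).

Lemma cint_measurable f : cint f -> cmeasurable f.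
Proof. by move=> [h1 h2]; split; [exact: rint_measurable h1|exact: rint_measurable h2]. Qed.

Lemma cintD f g : cint f -> cint g -> cint (fun x => f x + g x).
Proof.
move=> [h1 h2] [h3 h4]; split.
  by apply: eq_rint (rintD h1 h3) => x; rewrite ReD.
by apply: eq_rint (rintD h2 h4) => x; rewrite ImD.
Qed.

Lemma cintZ a f : cint f -> cint (fun x => a * f x).
Proof.
move=> [h1 h2]; split.
  by apply: eq_rint (rintB (rintZ (Re a) h1) (rintZ (Im a) h2)) => x; rewrite ReM.
by apply: eq_rint (rintD (rintZ (Re a) h2) (rintZ (Im a) h1)) => x; rewrite ImM.
Qed.

Lemma cintegralD f g : cint f -> cint g ->
  cintegral mu (fun x => f x + g x) = cintegral mu f + cintegral mu g.
Proof.
move=> [h1 h2] [h3 h4]; apply: complexP => /=.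
  by under eq_Rintegral do rewrite ReD; rewrite RintegralD.
by under eq_Rintegral do rewrite ImD; rewrite RintegralD.
Qed.

Lemma cintegralZ a f : cint f -> cintegral mu (fun x => a * f x) = a * cintegral mu f.
Proof.
move=> [h1 h2]; apply: complexP; rewrite ?ReM ?ImM/=.
  under eq_Rintegral do rewrite ReM; rewrite RintegralB//; try exact: rintZ.
  by rewrite !RintegralZl.
under eq_Rintegral do rewrite ImM; rewrite RintegralD//; try exact: rintZ.
by rewrite !RintegralZl.
Qed.

Lemma cintegralJ f : cint f -> cintegral mu (fun x => conjc (f x)) = conjc (cintegral mu f).
Proof.
move=> [h1 h2]; apply: complexP => /=.
  by under eq_Rintegral do rewrite ReJ.
under eq_Rintegral do rewrite ImJ -mulN1r.
by rewrite RintegralZl// mulN1r.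
Qed.

Lemma Rintegral_ae (f g : T -> R) : measurable_fun setT f -> measurable_fun setT g ->
  {ae mu, forall x, f x = g x} -> \int[mu]_x f x = \int[mu]_x g x.
Proof.
move=> mf mg fg; congr fine; apply: ae_eq_integral => //; try exact/measurable_EFinP.
by apply: filterS fg => x fgx _; rewrite fgx.
Qed.

Lemma cintegral_ae f g : cmeasurable f -> cmeasurable g ->
  {ae mu, forall x, f x = g x} -> cintegral mu f = cintegral mu g.
Proof.
move=> [mf1 mf2] [mg1 mg2] fg; congr Complex; apply: Rintegral_ae => //.
  by apply: filterS fg => x ->.
by apply: filterS fg => x ->.
Qed.

Definition sqi f := f \in square_integrable mu.

Lemma sqiP f : sqi f <-> [/\ cmeasurable f, rint (fun x => Re (f x) ^+ 2) &
  rint (fun x => Im (f x) ^+ 2)].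
Proof.
split=> [/andP[/Lfun2P[? ?] /Lfun2P[? ?]]|[[? ?] ? ?]]; first by split.
by apply/andP; split; apply/Lfun2P.
Qed.

Lemma sqi_measurable f : sqi f -> cmeasurable f.
Proof. by move/sqiP => []. Qed.

Lemma sqiD f g : sqi f -> sqi g -> sqi (fun x => f x + g x).
Proof. by move=> hf hg; have := rpredD hf hg. Qed.

Lemma sqiZ a f : sqi f -> sqi (fun x => a * f x).
Proof. by move=> hf; have := rpredZ a hf. Qed.

Lemma cmeasurable_mulJ f g : cmeasurable f -> cmeasurable g ->
  cmeasurable (fun x => f x * conjc (g x)).
Proof.
move=> [f1 f2] [g1 g2]; split.
  under eq_fun do rewrite ReMJ.
  by apply: measurable_funD; exact: measurable_funM.
under eq_fun do rewrite ImMJ.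
by apply: measurable_funB; exact: measurable_funM.
Qed.

Lemma sqi_cint f g : sqi f -> sqi g -> cint (fun x => f x * conjc (g x)).
Proof.
move=> /andP[f1 f2] /andP[g1 g2].
have M (u v : T -> R) : u \in Lfun mu 2%:E -> v \in Lfun mu 2%:E -> rint (fun x => u x * v x).
  by move=> hu hv; apply/Lfun1_integrable; exact: Lfun2_mul_Lfun1.
split.
  by apply: eq_rint (rintD (M _ _ f1 g1) (M _ _ f2 g2)) => x; rewrite ReMJ.
by apply: eq_rint (rintB (M _ _ f2 g1) (M _ _ f1 g2)) => x; rewrite ImMJ.
Qed.

Lemma innerE f g : inner mu f g = cintegral mu (fun x => f x * conjc (g x)).
Proof. by []. Qed.

Lemma inner_ae f f' g g' : sqi f -> sqi f' -> sqi g -> sqi g' ->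
  {ae mu, forall x, f x = f' x} -> {ae mu, forall x, g x = g' x} ->
  inner mu f g = inner mu f' g'.
Proof.
move=> hf hf' hg hg' ff' gg'; apply: cintegral_ae.
- by apply: cmeasurable_mulJ; exact: sqi_measurable.
- by apply: cmeasurable_mulJ; exact: sqi_measurable.
- by apply: filterS2 ff' gg' => x -> ->.
Qed.

Local Notation L2 := (L2 mu).

Definition L2of f (hf : sqi f) : L2 := \pi_L2 (MkL2fun hf).

Lemma pi_ae (p : L2fun mu) : {ae mu, forall x, L2_repr (\pi_L2 p) x = p x}.
Proof.
have : repr (\pi_L2 p) - p \in @ae_null _ _ _ mu.
  by rewrite Quotient.idealrBE reprK.
move=> /asboolP; apply: filterS => x hx; apply/eqP; rewrite -subr_eq0; apply/eqP.
exact: hx.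
Qed.

Lemma L2of_ae f (hf : sqi f) : {ae mu, forall x, L2of hf x = f x}.
Proof. exact: pi_ae. Qed.

Lemma L2P (f g : L2) : {ae mu, forall x, f x = g x} -> f = g.
Proof.
move=> fg; rewrite -[f]reprK -[g]reprK; apply/eqP; rewrite -Quotient.idealrBE.
by apply/asboolP; apply: filterS fg => x hx; apply/eqP; rewrite subr_eq0; apply/eqP.
Qed.

Lemma sqi_L2 (f : L2) : sqi f.
Proof. exact: (valP (repr f)). Qed.

Lemma L2_aeD (f g : L2) : {ae mu, forall x, L2_repr (f + g) x = f x + g x}.
Proof.
have -> : f + g = \pi_L2 (repr f + repr g) by rewrite raddfD/= !reprK.
exact: pi_ae.
Qed.

Lemma L2_aeZ a (f : L2) : {ae mu, forall x, L2_repr (a *: f) x = a * f x}.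
Proof. exact: (pi_ae (a *: repr f)). Qed.

Lemma L2_aeB (f g : L2) : {ae mu, forall x, L2_repr (f - g) x = f x - g x}.
Proof.
rewrite -scaleN1r; have h := L2_aeD f (-1 *: g).
by apply: filterS2 h (L2_aeZ (-1) g) => x -> ->; rewrite mulN1r.
Qed.

Definition ip (f g : L2) : R[i] := inner mu f g.

Lemma Re_inner_self f : sqi f -> Re (inner mu f f) =
  \int[mu]_x (Re (f x) ^+ 2) + \int[mu]_x (Im (f x) ^+ 2).
Proof.
move=> /sqiP[_ i1 i2]; rewrite -RintegralD//; apply: eq_Rintegral => x _.
by rewrite ReMJ !expr2.
Qed.

Lemma ip_self_ge0 (f : L2) : 0 <= Re (ip f f).
Proof.
rewrite Re_inner_self; last exact: sqi_L2.
by apply: addr_ge0; apply: Rintegral_ge0 => x _; exact: sqr_ge0.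
Qed.

Lemma Rintegral_sqr_ae0 (u : T -> R) : rint (fun x => u x ^+ 2) ->
  \int[mu]_x (u x ^+ 2) = 0 -> {ae mu, forall x, u x = 0}.
Proof.
move=> iu u0; have mu2 := measurable_int _ iu.
have : (\int[mu]_x `|(u x ^+ 2)%:E| = 0)%E.
  under eq_integral do rewrite gee0_abs ?lee_fin ?sqr_ge0//.
  by rewrite -[LHS]fineK ?[fine _]u0//; exact: integrable_fin_num iu.
move=> /(ae_eq_integral_abs mu measurableT mu2).
by apply: filterS => x /(_ I)/= [/eqP]; rewrite sqrf_eq0 => /eqP.
Qed.

Lemma L2_hilbert : is_hilbert ip.
Proof.
split.
- move=> f g h; rewrite /ip !innerE -cintegralD; try (apply: sqi_cint; exact: sqi_L2).
  apply: cintegral_ae.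
  + by apply: cmeasurable_mulJ; apply: sqi_measurable; exact: sqi_L2.
  + by apply/cint_measurable/cintD; apply: sqi_cint; exact: sqi_L2.
  + by apply: filterS (L2_aeD f g) => x ->; rewrite mulrDl.
- move=> a f h; rewrite /ip !innerE -cintegralZ; try (apply: sqi_cint; exact: sqi_L2).
  apply: cintegral_ae.
  + by apply: cmeasurable_mulJ; apply: sqi_measurable; exact: sqi_L2.
  + by apply/cint_measurable/cintZ; apply: sqi_cint; exact: sqi_L2.
  + by apply: filterS (L2_aeZ a f) => x ->; rewrite mulrA.
- move=> f g; rewrite /ip !innerE -cintegralJ; last by apply: sqi_cint; exact: sqi_L2.
  by congr cintegral; apply/funext => x; rewrite conjcM conjcK mulrC.
- exact: ip_self_ge0.
- move=> f f0; have := Re_inner_self (sqi_L2 f); rewrite -/(ip f f) f0 /= => /esym/eqP.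
  rewrite paddr_eq0; try by apply: Rintegral_ge0 => x _; exact: sqr_ge0.
  have /sqiP[_ i1 i2] := sqi_L2 f.
  move=> /andP[/eqP/(Rintegral_sqr_ae0 i1) h1 /eqP/(Rintegral_sqr_ae0 i2) h2].
  apply: L2P; have h0 : {ae mu, forall x, L2_repr (0 : L2) x = 0}.
    rewrite -(scale0r (0 : L2)); apply: filterS (L2_aeZ 0 0) => x ->; exact: mul0r.
  apply: filterS3 h0 h1 h2 => x -> /= e1 e2; exact: complexP.
- move=> u hu; pose w n := L2_repr (u n).
  have sq (f : L2) : [/\ cmeasurable f, rint (fun x => Re (f x) ^+ 2) &
     rint (fun x => Im (f x) ^+ 2)] by apply/sqiP; exact: sqi_L2.
  have du n : sqi (fun x => w n.+1 x - w n x).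
    have := sqiD (sqi_L2 (u n.+1)) (sqiZ (-1) (sqi_L2 (u n))).
    by congr sqi; apply/funext => x; rewrite mulN1r.
  have [sq1 sq2] : (forall n, rint (fun x => (Re (w n.+1 x) - Re (w n x)) ^+ 2)) /\
      (forall n, rint (fun x => (Im (w n.+1 x) - Im (w n x)) ^+ 2)).
    split=> n; have /sqiP[_ h1 h2] := du n.
      by apply: eq_rint h1 => x; rewrite ReB.
    by apply: eq_rint h2 => x; rewrite ImD ImN.
  have nd n : \int[mu]_x ((Re (w n.+1 x) - Re (w n x)) ^+ 2) +
      \int[mu]_x ((Im (w n.+1 x) - Im (w n x)) ^+ 2) <= 4^-1 ^+ n.
    have := hu n; rewrite -(@ler_pXn2r _ 2)// ?nnegrE ?sqrtr_ge0 ?exprn_ge0 ?invr_ge0//.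
    rewrite sqr_sqrtr; last exact: ip_self_ge0.
    rewrite -exprM mulnC exprM (_ : 2^-1 ^+ 2 = 4^-1); last by field.
    rewrite /ip (inner_ae _ (du n) _ (du n) (L2_aeB _ _) (L2_aeB _ _)); try exact: sqi_L2.
    rewrite Re_inner_self//; congr (_ + _ <= _); apply: eq_Rintegral => x _.
      by rewrite ReB.
    by rewrite ImD ImN.
  have I0 (f : T -> R) : 0 <= \int[mu]_x (f x ^+ 2).
    by apply: Rintegral_ge0 => x _; exact: sqr_ge0.
  have [lr [mlr ilr hlr]] := riesz_fischer_real (fun n => (sqi_measurable (sqi_L2 (u n))).1) sq1
    (fun n => le_trans (ler_wpDr (I0 _) (lexx _)) (nd n)).
  have [li [mli ili hli]] := riesz_fischer_real (fun n => (sqi_measurable (sqi_L2 (u n))).2) sq2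
    (fun n => le_trans (ler_wpDl (I0 _) (lexx _)) (nd n)).
  have dl n : sqi (fun x => (lr x +i* li x) - w n x).
    apply/sqiP; split.
    + split => /=.
        under eq_fun do rewrite ReB; apply: measurable_funB => //.
        exact: (sqi_measurable (sqi_L2 (u n))).1.
      under eq_fun do rewrite ImD ImN; apply: measurable_funB => //.
      exact: (sqi_measurable (sqi_L2 (u n))).2.
    + by apply: eq_rint (ilr n) => x; rewrite ReB.
    + by apply: eq_rint (ili n) => x; rewrite ImD ImN.
  have hl : sqi (fun x => lr x +i* li x).
    have := sqiD (dl 0%N) (sqi_L2 (u 0%N)).
    by congr sqi; apply/funext => x; rewrite subrK.
  exists (L2of hl) => e e0.
  (* The real and the imaginary part each contribute [4 * 2^-1 ^+ n]. *)
  have [|N hN] := @half_ltn R (e ^+ 2 / 8); first by rewrite divr_gt0// exprn_gt0.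
  exists N => n Nn; rewrite -(@ler_pXn2r _ 2)// ?nnegrE ?sqrtr_ge0 ?(ltW e0)//.
  rewrite sqr_sqrtr; last exact: ip_self_ge0.
  have ae1 : {ae mu, forall x, L2_repr (L2of hl - u n) x = (lr x +i* li x) - w n x}.
    by apply: filterS2 (L2_aeB (L2of hl) (u n)) (L2of_ae hl) => x -> ->.
  rewrite /ip (inner_ae _ (dl n) _ (dl n) ae1 ae1); try exact: sqi_L2.
  rewrite Re_inner_self//.
  apply: le_trans (_ : 4 * 2^-1 ^+ n + 4 * 2^-1 ^+ n <= _); last first.
    by have := hN _ Nn; rewrite ler_pdivlMr//; lra.
  apply: lerD.
    by apply: le_trans (hlr n); rewrite le_eqVlt (_ : _ == _) //; apply/eqP/eq_Rintegral => x _; rewrite ReB.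
  by apply: le_trans (hli n); rewrite le_eqVlt (_ : _ == _) //; apply/eqP/eq_Rintegral => x _; rewrite ImD ImN.
Qed.

End complex_integral.

(** * Translation invariance of Lebesgue measure *)

Section translation_invariance.
Variable R : realType.
Local Open Scope classical_set_scope.

Let shift1 (a : R) : measurableTypeR R -> measurableTypeR R := fun x => x + a.

Let measurable_shift1 a : measurable_fun setT (shift1 a).
Proof. by apply: measurable_funD => //; exact: measurable_cst. Qed.

Lemma lebesgue_shift1 (a : R) (A : set (measurableTypeR R)) : measurable A ->
  lebesgue_measure (shift1 a @^-1` A) = lebesgue_measure A.
Proof.
move=> mA; apply/esym.
apply: (@lebesgue_measure_unique R
  (measure_function_pushforward__canonical__measure_function_Measure lebesgue_measure (measurable_shift1 a))) => //.
move=> _ [[x y] _ <-] /=; rewrite /pushforward.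
have -> : shift1 a @^-1` `]x, y] = `]x - a, y - a].
  by apply/seteqP; split=> z; rewrite /shift1 /= !in_itv/= ltrBlDr lerBrDr.
rewrite !lebesgue_measure_itv/= !lte_fin ltrD2r.
by case: ifP => // _; rewrite -!EFinB; congr EFin; rewrite opprB addrA subrK.
Qed.

Lemma measurable_shift n (a : 'cV[R]_n) : measurable_fun setT (fun x : 'cV[R]_n => x + a).
Proof.
apply: measurable_fun_cV => i; under eq_fun do rewrite mxE.
by apply: measurable_funD; [exact: measurable_cV_coord|exact: measurable_cst].
Qed.

(** Induction on the dimension by Cavalieri: the sections are shifted by the induction hypothesis,
    the outer integral by invariance on the line. *)
Lemma lebesgue_cV_shift n (a : 'cV[R]_n) (A : set 'cV[R]_n) : measurable A ->
  lebesgue_cV n ((fun x => x + a) @^-1` A) = lebesgue_cV n A.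
Proof.
elim: n a A => [|n IH] a A mA.
  by congr (lebesgue_cV 0 _); apply/seteqP; split=> x /=;
    rewrite (_ : x + a = x)//; apply/matrixP => -[].
pose B := @cV_cons R n @^-1` A.
have mB : measurable B.
  by rewrite -[B]setTI; exact: measurable_cV_cons.
pose a0 : R := a ord0 ord0; pose a' : 'cV[R]_n := \col_j a (lift ord0 j) 0.
rewrite /= /lebesgue_cV_step /pushforward /product_measure1.
transitivity (\int[lebesgue_measure]_x (lebesgue_cV n (xsection B (shift1 a0 x))))%E.
  apply: eq_integral => x _ /=; rewrite -[RHS](IH a'); last exact: measurable_xsection.
  congr (lebesgue_cV n _); apply/seteqP; split=> p; rewrite /xsection /= !inE /B /=;
    rewrite (_ : cV_cons _ + a = cV_cons (shift1 a0 x, p + a'))//;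
    apply/colP => i; rewrite /cV_cons !mxE; case: unliftP => [j ->|->] /=;
    by rewrite ?mxE.
rewrite -(@ge0_integral_pushforward _ _ _ _ _ (shift1 a0) (measurable_shift1 a0)
  lebesgue_measure setT (fun x => lebesgue_cV n (xsection B x)))//=.
- by apply: eq_measure_integral => C mC _; exact: lebesgue_shift1.
- exact: measurable_fun_xsection.
Qed.

Section on_Rn.
Variable n : nat.
Local Notation mu := (@lebesgue_cV R n).

Lemma ae_shift (a : 'cV[R]_n) (P : 'cV[R]_n -> Prop) :
  {ae mu, forall x, P x} -> {ae mu, forall x, P (x + a)}.
Proof.
move=> [N [mN N0 sN]]; exists ((fun x => x + a) @^-1` N); split.
- by rewrite -[X in measurable X]setTI; exact: measurable_shift.
- by rewrite -N0; exact: lebesgue_cV_shift.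
- by move=> x /= nP; apply: sN.
Qed.

Lemma integral_shift (a : 'cV[R]_n) (f : 'cV[R]_n -> \bar R) :
  measurable_fun setT f -> mu.-integrable setT f ->
  mu.-integrable setT (fun x => f (x + a)) /\
  (\int[mu]_x f (x + a)%R = \int[mu]_x f x)%E.
Proof.
have ge0 (g : 'cV[R]_n -> \bar R) : measurable_fun setT g -> (forall x, 0 <= g x)%E ->
    (\int[mu]_x g (x + a)%R = \int[mu]_x g x)%E.
  move=> mg g0.
  rewrite -(@ge0_integral_pushforward _ _ _ _ _ (fun x : 'cV[R]_n => x + a) (measurable_shift a)
    mu setT g)//=.
  by apply: eq_measure_integral => [|mf' C mC _]; [exact: measurable_shift|exact: (lebesgue_cV_shift a mC)].
move=> mf fint.
have mfa : measurable_fun setT (fun x : 'cV[R]_n => f (x + a)).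
  exact: (measurableT_comp mf (measurable_shift a)).
have ifa : mu.-integrable setT (fun x : 'cV[R]_n => f (x + a)).
  apply/integrableP; split=> //; move/integrableP: fint => [_]; apply: le_lt_trans.
  by rewrite (ge0 (fun x => `|f x|)%E)//; exact: measurableT_comp.
split=> //; rewrite -(@integral_pushforward _ _ _ _ _ (fun x : 'cV[R]_n => x + a)
  (measurable_shift a) mu setT f)//.
by apply: eq_measure_integral => [|mf' C mC _]; [exact: measurable_shift|exact: (lebesgue_cV_shift a mC)].
Qed.

Lemma rint_shift a (f : 'cV[R]_n -> R) : rint mu f -> rint mu (fun x => f (x + a)).
Proof. by move=> hf; case: (integral_shift a (measurable_int _ hf) hf). Qed.

Lemma Rintegral_shift a (f : 'cV[R]_n -> R) : rint mu f ->
  \int[mu]_x f (x + a) = \int[mu]_x f x.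
Proof. by move=> hf; rewrite /Rintegral; case: (integral_shift a (measurable_int _ hf) hf) => _ ->. Qed.

End on_Rn.
End translation_invariance.

Section expi.
Variable R : realType.

Lemma expiD (s t : R) : expi (s + t) = expi s * expi t.
Proof. by apply: complexP; rewrite ?ReM ?ImM/= ?cosD ?sinD; ring. Qed.

Lemma expi0 : expi (0 : R) = 1.
Proof. by rewrite /expi cos0 sin0. Qed.

Lemma normc_expi (s : R) : normc (expi s) = 1.
Proof. by rewrite /= cos2Dsin2 sqrtr1. Qed.

End expi.

(** * Time-frequency shifts on L^2 *)

Section time_frequency_shifts.
Context {R : realType} {d : nat}.
Local Notation Rd := 'cV[R]_d.
Local Notation R2d := 'cV[R]_(d + d).
Local Notation mu := (@lebesgue_cV R d).
Local Notation L2 := (L2Rd R d).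

Definition dot (b x : Rd) : R := \sum_i b i 0 * x i 0.

Lemma dotDl b c x : dot (b + c) x = dot b x + dot c x.
Proof. by rewrite /dot -big_split/=; apply: eq_bigr => i _; rewrite mxE mulrDl. Qed.
Lemma dotDr b x y : dot b (x + y) = dot b x + dot b y.
Proof. by rewrite /dot -big_split/=; apply: eq_bigr => i _; rewrite mxE mulrDr. Qed.
Lemma dotNr b x : dot b (- x) = - dot b x.
Proof. by rewrite /dot -sumrN; apply: eq_bigr => i _; rewrite mxE mulrN. Qed.

(** The exponential is evaluated at x minus the time shift because [tfshift] modulates before it
    translates. *)
Definition wave (l : R2d) (x : Rd) : R[i] := expi (2 * pi * dot (dsubmx l) (x - usubmx l)).

Lemma cmeasurable_wave l : cmeasurable (wave l).
Proof.
have mdot : measurable_fun setT (fun x : Rd => 2 * pi * dot (dsubmx l) (x - usubmx l)).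
  apply: measurable_funM; first exact: measurable_cst.
  apply: measurable_sum => i; apply: measurable_funM; first exact: measurable_cst.
  exact: (measurableT_comp (measurable_cV_coord i) (measurable_shift _)).
split.
  apply: (measurableT_comp _ mdot); apply: continuous_measurable_fun; exact: continuous_cos.
apply: (measurableT_comp _ mdot); apply: continuous_measurable_fun; exact: continuous_sin.
Qed.

Lemma sqi_shift (a : Rd) (f : Rd -> R[i]) : sqi mu f -> sqi mu (fun x => f (x + a)).
Proof.
move=> /sqiP[[m1 m2] i1 i2]; apply/sqiP; split.
- by split; [exact: (measurableT_comp m1 (measurable_shift a))|
    exact: (measurableT_comp m2 (measurable_shift a))].
- exact: (rint_shift a i1).
- exact: (rint_shift a i2).
Qed.

Lemma sqi_mul_unimodular (w f : Rd -> R[i]) : cmeasurable w -> (forall x, normc (w x) = 1) ->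
  sqi mu f -> sqi mu (fun x => w x * f x).
Proof.
move=> [w1 w2] wn /sqiP[[m1 m2] i1 i2]; apply/sqiP.
have mre : measurable_fun setT (fun x => complex.Re (w x * f x)).
  by under eq_fun do rewrite ReM; apply: measurable_funB; exact: measurable_funM.
have mim : measurable_fun setT (fun x => complex.Im (w x * f x)).
  by under eq_fun do rewrite ImM; apply: measurable_funD; exact: measurable_funM.
have e x : complex.Re (f x) ^+ 2 + complex.Im (f x) ^+ 2 =
    complex.Re (w x * f x) ^+ 2 + complex.Im (w x * f x) ^+ 2.
  by rewrite -!normcE2 normcM wn mul1r.
split=> //; apply: (rint_le _ _ (rintD i1 i2)); try exact: measurable_funX.
  by move=> x; rewrite e ger0_norm ?sqr_ge0// lerDl sqr_ge0.
by move=> x; rewrite e ger0_norm ?sqr_ge0// lerDr sqr_ge0.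
Qed.

Lemma normc_wave l x : normc (wave l x) = 1.
Proof. exact: normc_expi. Qed.

Lemma sqi_tfshift l f : sqi mu f -> sqi mu (tfshift l f).
Proof.
move=> hf; apply: sqi_mul_unimodular (sqi_shift (- usubmx l) hf).
  exact: cmeasurable_wave.
exact: normc_wave.
Qed.

Definition U (l : R2d) (f : L2) : L2 := L2of (sqi_tfshift l (sqi_L2 f)).

Lemma U_ae l (f : L2) : {ae mu, forall x, U l f x = wave l x * f (x - usubmx l)}.
Proof. exact: L2of_ae. Qed.

(** Representatives of classes are opaque; any u equal to f almost everywhere may be used because
    null sets are translation invariant. *)
Lemma U_ae_of l (f : L2) (u : Rd -> R[i]) : {ae mu, forall x, f x = u x} ->
  {ae mu, forall x, U l f x = wave l x * u (x - usubmx l)}.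
Proof.
move=> fu; apply: filterS2 (U_ae l f) (ae_shift (- usubmx l) fu) => x -> /= ->.
by [].
Qed.

Lemma U_lin l : lin (U l).
Proof.
split=> [f g|a f]; apply: L2P.
  apply: filterS3 (U_ae_of l (L2_aeD f g)) (L2_aeD (U l f) (U l g)) (filterI (U_ae l f) (U_ae l g)).
  by move=> x -> -> [-> ->]; rewrite mulrDr.
apply: filterS3 (U_ae_of l (L2_aeZ a f)) (L2_aeZ a (U l f)) (U_ae l f).
by move=> x -> -> ->; rewrite mulrCA.
Qed.

Lemma U_iso l (f g : L2) : ip (U l f) (U l g) = ip f g.
Proof.
have hs (h : L2) : sqi mu (fun x => h (x - usubmx l)) := sqi_shift _ (sqi_L2 h).
have c1 := sqi_cint (sqi_L2 f) (sqi_L2 g).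
rewrite /ip !innerE.
transitivity (cintegral mu (fun x => f (x - usubmx l) * conjc (g (x - usubmx l)))).
  apply: cintegral_ae.
  - by apply: cmeasurable_mulJ; apply: sqi_measurable; exact: sqi_L2.
  - by apply: cmeasurable_mulJ; apply: sqi_measurable; exact: hs.
  apply: filterS2 (U_ae l f) (U_ae l g) => x -> ->.
  by rewrite conjcM mulrACA mulcJ normc_wave expr1n mul1r.
congr Complex.
  exact: (Rintegral_shift (- usubmx l) c1.1).
exact: (Rintegral_shift (- usubmx l) c1.2).
Qed.

Lemma U_0 (f : L2) : U 0 f = f.
Proof.
apply: L2P; apply: filterS (U_ae 0 f) => x ->.
have -> : usubmx (0 : R2d) = 0 by apply/colP => i; rewrite !mxE.
have -> : wave 0 x = 1; last by rewrite mul1r subr0.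
rewrite /wave (_ : dsubmx 0 = 0); last by apply/colP => i; rewrite !mxE.
rewrite (_ : dot 0 _ = 0) ?mulr0 ?expi0//.
by rewrite /dot big1// => i _; rewrite mxE mul0r.
Qed.

Lemma U_mul a b : exists2 c, normc c = 1 & forall f, U a (U b f) = c *: U (a + b) f.
Proof.
(* This is the cost of moving the modulation of a past the translation of b. *)
pose c : R[i] := expi (2 * pi * dot (dsubmx a) (usubmx b)).
exists c; first exact: normc_expi.
move=> f; apply: L2P.
apply: filterS3 (U_ae_of a (U_ae b f)) (L2_aeZ c (U (a + b) f)) (U_ae (a + b) f).
move=> x -> -> ->; rewrite !mulrA.
have eu : usubmx (a + b) = usubmx a + usubmx b by apply/colP => i; rewrite !mxE.
have ed : dsubmx (a + b) = dsubmx a + dsubmx b by apply/colP => i; rewrite !mxE.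
rewrite /c /wave eu ed opprD addrA -!expiD -!mulrDr; congr (expi (_ * _) * _).
rewrite dotDl addrA -dotDr; congr (dot _ _ + _).
by rewrite [RHS]addrC subrK.
Qed.

Lemma analysisE (g f : L2) l : analysis g f l = ip f (U l g).
Proof.
apply: inner_ae; try exact: sqi_L2.
- exact: sqi_tfshift (sqi_L2 g).
- by apply: aeW.
- by apply: filterS (U_ae l g) => x ->.
Qed.

End time_frequency_shifts.

(** * Test functions and translation groups *)

Section test_functions.
Variable R : realType.

(** The sigma-algebra is generated by the coordinates, so an open set is written as a union of
    countably many boxes with rational centre and radius [1 / (k + 1)]. *)
Lemma open_measurable_cV n (O : set 'cV[R]_n) : open O -> measurable O.
Proof.
move=> oO.
pose box (t : 'cV[rat]_n * nat) := [set x : 'cV[R]_n | forall i,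
  `|ratr (t.1 i 0) - x i 0| < t.2.+1%:R^-1]%classic.
have mbox t : measurable (box t).
  have -> : box t = (\bigcap_(i in [set: 'I_n])
      ((fun x : 'cV[R]_n => x i 0) @^-1` (ball (ratr (t.1 i 0) : R) (t.2.+1%:R^-1))))%classic.
    by apply/seteqP; split=> x /= h; [move=> i _; exact: h|move=> i; exact: (h i I)].
  apply: fin_bigcap_measurable => // i _.
  by rewrite -[X in measurable X]setTI; apply: measurable_cV_coord => //; exact: measurable_ball.
pose F t := if `[< (box t `<=` O)%classic >] then box t else set0.
have -> : O = (\bigcup_t F t)%classic.
  apply/seteqP; split=> [x Ox|x [t _]]; last by rewrite /F; case: asboolP => // tO; exact: tO.
  have /nbhs_ballP[e /= e0 eO] : nbhs x O by exact: open_nbhs_nbhs.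
  have [k ke] : exists k : nat, 2 * k.+1%:R^-1 <= e.
    exists (Num.bound (2 / e)); rewrite ler_pdivrMr// -ler_pdivrMl// mulrC.
    apply: le_trans (ltW (archi_boundP _)) _; first by rewrite divr_ge0// ltW.
    by rewrite ler_nat.
  have /choice[q hq] : forall i, exists q : rat, `|ratr q - x i 0| < k.+1%:R^-1.
    move=> i; have [|q] := @rat_in_itvoo R (x i 0 - k.+1%:R^-1) (x i 0 + k.+1%:R^-1).
      by rewrite ltrBlDr -addrA ltrDl addr_gt0// invr_gt0.
    by rewrite in_itv/= => h; exists q; rewrite ltr_distl.
  pose t : 'cV[rat]_n * nat := (\col_i q i, k).
  have xt : box t x by move=> i /=; rewrite mxE.
  have tO : (box t `<=` O)%classic.
    move=> y yt; apply: eO; split=> // i j; rewrite (ord1 j) /ball/=.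
    have := yt i; have := xt i; rewrite /= mxE => h1 h2.
    have := ler_distD (ratr (q i)) (x i 0) (y i 0); rewrite (distrC (x i 0) (ratr _)).
    move=> /le_lt_trans; apply; apply: lt_le_trans ke; rewrite mulr_natl mulr2n.
    exact: ltrD.
  by exists t => //; rewrite /F; case: asboolP.
apply: countable_bigcupT_measurable => [|t]; first exact: countableP.
by rewrite /F; case: ifP.
Qed.

Lemma continuous_measurable_cV n (f : 'cV[R]_n -> R) : continuous f ->
  measurable_fun setT f.
Proof.
move=> cf; apply: (measurability _ (RGenOInfty.measurableE R)) => _ [_ [x ->] <-].
rewrite setTI; apply: open_measurable_cV; move/continuousP : cf; apply.
exact: rray_open.
Qed.

Lemma derivable_along n (f : 'cV[R]_n -> R) (v x : 'cV[R]_n) (s : R) :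
  derivable f (x + s *: v) v ->
  is_derive s (1 : R) (fun s => f (x + s *: v)) ('D_v f (x + s *: v)).
Proof.
have e : (fun h : R => h^-1 *: (((fun s => f (x + s *: v)) \o shift s) (h *: 1) - f (x + s *: v))) =
    (fun h : R => h^-1 *: ((f \o shift (x + s *: v)) (h *: v) - f (x + s *: v))).
  apply/funext => h /=; congr (_ *: (f _ - _)).
  by rewrite [h%:A]mulr1 scalerDl addrCA addrA addrC addrA.
move=> df; split; first by rewrite /derivable e.
by rewrite /derive e.
Qed.

Lemma derive_lipschitz (f df : R -> R) (B t : R) :
  (forall s, is_derive s (1 : R) f (df s)) ->
  (forall s, `|s| <= `|t| -> `|df s| <= B) ->
  `|f t - f 0| <= B * `|t|.
Proof.
move=> hf hB; have cf : continuous f.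
  move=> s; apply/differentiable_continuous/derivable1_diffP.
  by have [] := hf s.
have key a b : a <= b -> (forall s, s \in `[a, b]%R -> `|s| <= `|t|) ->
    `|f b - f a| <= B * (b - a).
  move=> ab abt; have [|c cab ->] := @MVT_segment R f df a b ab (fun s _ => hf s).
    exact: continuous_subspaceT.
  rewrite normrM [`|b - a|]ger0_norm ?subr_ge0// ler_wpM2r ?subr_ge0// hB//.
  exact: abt.
have [t0|t0] := leP 0 t.
  have := key _ _ t0; rewrite subr0 [`|t|]ger0_norm//; apply=> s.
  by rewrite in_itv/= => /andP[s0 st]; rewrite ger0_norm.
have := key _ _ (ltW t0); rewrite sub0r distrC [`|t|]ltr0_norm//; apply=> s.
by rewrite in_itv/= => /andP[st s0]; rewrite ler0_norm// lerN2.
Qed.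

Section calculus.
Variable n : nat.
Implicit Types f g : 'cV[R]_n -> R.
Local Notation e_ j := (delta_mx j 0 : 'cV[R]_n).

Lemma partialD j f g : (forall x, derivable f x (e_ j)) -> (forall x, derivable g x (e_ j)) ->
  partial j (f + g) = partial j f + partial j g.
Proof. by move=> df dg; apply/funext => x; rewrite /partial deriveD. Qed.

Lemma partialZ j a f : (forall x, derivable f x (e_ j)) ->
  partial j (a \*: f) = a \*: partial j f.
Proof. by move=> df; apply/funext => x; rewrite /partial deriveZ. Qed.

Lemma CkD k f g : Ck k f -> Ck k g -> Ck k (f + g).
Proof.
elim: k f g => [|k IH] f g [cf df] [cg dg]; split=> //.
- by move=> x; exact: continuousD (cf x) (cg x).
- by move=> x; exact: continuousD (cf x) (cg x).
- move=> j; have [df1 df2] := df j; have [dg1 dg2] := dg j; split.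
    by move=> x; exact: derivableD.
  by rewrite partialD//; exact: IH.
Qed.

Lemma CkZ k a f : Ck k f -> Ck k (a \*: f).
Proof.
elim: k f => [|k IH] f [cf df]; split=> //.
- by move=> x; apply: continuousZl_tmp; exact: cf.
- by move=> x; apply: continuousZl_tmp; exact: cf.
- move=> j; have [df1 df2] := df j; split.
    by move=> x; exact: derivableZ.
  by rewrite partialZ//; exact: IH.
Qed.

Lemma shift_quotient f a x (v : 'cV[R]_n) :
  (fun h : R => h^-1 *: (((fun x => f (x + a)) \o shift x) (h *: v) - f (x + a))) =
  (fun h : R => h^-1 *: ((f \o shift (x + a)) (h *: v) - f (x + a))).
Proof. by apply/funext => h /=; rewrite addrA. Qed.

Lemma derivable_shift f a x (v : 'cV[R]_n) : derivable f (x + a) v ->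
  derivable (fun x => f (x + a)) x v.
Proof. by rewrite /derivable shift_quotient. Qed.

Lemma partial_shift j f a : partial j (fun x => f (x + a)) = (fun x => partial j f (x + a)).
Proof. by apply/funext => x; rewrite /partial /derive shift_quotient. Qed.

Lemma continuous_shift f (a : 'cV[R]_n) : continuous f ->
  continuous (fun x : 'cV[R]_n => f (x + a)).
Proof.
move=> cf x; apply: (@continuous_comp _ _ _ (fun x : 'cV[R]_n => x + a) f); last exact: cf.
apply: (@continuousD _ _ _ id (cst a)); [exact: cvg_id|exact: cst_continuous].
Qed.

Lemma Ck_shift k (a : 'cV[R]_n) f : Ck k f -> Ck k (fun x => f (x + a)).
Proof.
elim: k f => [|k IH] f [cf df]; split=> //; try exact: continuous_shift.
move=> j; have [df1 df2] := df j; split.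
  by move=> x; exact: derivable_shift.
by rewrite partial_shift; exact: IH.
Qed.

Definition bounded_support f := exists K, forall x, f x != 0 -> forall i, `|x i 0| <= K.

Lemma compact_box K : compact [set x : 'cV[R]_n | forall i, `|x i 0| <= K].
Proof.
pose A (i : 'I_n) : set R := `[- K, K]%classic.
have cA : compact [set v : 'rV[R]_n | forall i, A i (v ord0 i)].
  by apply: rV_compact => i; exact: segment_compact.
have -> : [set x : 'cV[R]_n | forall i, `|x i 0| <= K]%classic =
    (trmx @` [set v : 'rV[R]_n | forall i, A i (v ord0 i)])%classic.
  apply/seteqP; split=> [x hx|_ [v hv <-] i].
    exists x^T; last by rewrite trmxK.
    by move=> i; rewrite /A /= mxE in_itv/= -ler_norml.
  by rewrite mxE ler_norml; have := hv i; rewrite /A /= in_itv.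
apply: continuous_compact => //; apply: continuous_subspaceT => v A'.
move=> /nbhs_ballP[e /= e0 eA]; apply/nbhs_ballP; exists e => //= w [_ vw].
apply: eA; split=> // i j; rewrite !mxE; exact: vw.
Qed.

Lemma closed_box K : closed [set x : 'cV[R]_n | forall i, `|x i 0| <= K].
Proof.
have -> : [set x : 'cV[R]_n | forall i, `|x i 0| <= K]%classic =
    (\bigcap_(i in [set: 'I_n]) ((fun x : 'cV[R]_n => `|x i 0|) @^-1` [set y | y <= K]))%classic.
  by apply/seteqP; split=> x /= h; [move=> i _; exact: h|move=> i; exact: (h i I)].
apply: closed_bigI => i _; apply: closed_comp; last exact: closed_le.
move=> x _; apply: continuous_comp; [exact: coord_continuous|exact: norm_continuous].
Qed.

Lemma compact_supportP f : compact (closure [set x | f x != 0]) <-> bounded_support f.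
Proof.
split=> [cf|[K hK]].
  have hi i : exists K, forall x, f x != 0 -> `|x i 0| <= K.
    have cc : compact ((fun x : 'cV[R]_n => x i 0) @` closure [set x | f x != 0])%classic.
      by apply: continuous_compact => //; apply: continuous_subspaceT; exact: coord_continuous.
    have [M [_ hM]] := compact_bounded cc.
    exists (M + 1) => x fx; apply: (hM (M + 1)); first by rewrite ltrDl.
    by exists x => //; exact: subset_closure.
  have [K hK] := choice hi; exists (\sum_i `|K i|) => x fx i.
  apply: le_trans (hK i x fx) _; apply: le_trans (ler_norm _) _.
  by rewrite (bigD1 i)//= lerDl sumr_ge0.
apply: subclosed_compact (@compact_box K) _; first exact: closed_closure.
have /closure_id -> := @closed_box K.
by apply: closure_subset => x /= /hK.
Qed.

Lemma partial_bounded_support j f : bounded_support f -> bounded_support (partial j f).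
Proof.
have f0 K : (forall x, f x != 0 -> forall i, `|x i 0| <= K) ->
    forall (x : 'cV[R]_n) i, K < `|x i 0| -> f x = 0.
  by move=> hK x i Kx; apply/eqP; apply: contraTT Kx => /hK/(_ i); rewrite -leNgt.
move=> [K /f0 {}f0]; exists K => x dfx i; rewrite leNgt; apply: contraNN dfx => Kx.
apply/eqP; rewrite /partial /derive; apply: lim_near_cst => //.
have d0 : 0 < `|x i 0| - K by rewrite subr_gt0.
near=> h; rewrite /= (f0 x i)// (f0 _ i) ?subrr ?scaler0//.
have hh : `|h| < `|x i 0| - K by near: h; exact: dnbhs0_lt.
rewrite !mxE; have := ler_normB (h * ((i == j) && (0 == 0 :> 'I_1))%:R + x i 0) (h * ((i == j) && (0 == 0 :> 'I_1))%:R).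
rewrite addrAC subrr add0r => h1.
have h2 : `|h * ((i == j) && (0 == 0 :> 'I_1))%:R| <= `|h|.
  by rewrite normrM ler_piMr//; case: (_ && _); rewrite ?normr1 ?normr0.
move: hh; rewrite ltrBrDl => hh; rewrite -(ltrD2r `|h|).
apply: lt_le_trans hh _; apply: le_trans h1 _; rewrite lerD2l//.
Unshelve. all: by end_near. Qed.

End calculus.
End test_functions.

(** * One-parameter unitary groups and their generators *)

Section one_parameter_group.
Variables (R : realType) (V : lmodType R[i]) (ip : V -> V -> R[i]).
Hypothesis hip : is_hilbert ip.
Local Notation nrm := (nrm ip).
Local Notation CS := (CS hip).
Variable T : R -> V -> V.
Hypothesis Tlin : forall t, lin (T t).
Hypothesis Tiso : forall t x y, ip (T t x) (T t y) = ip x y.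
Hypothesis T0 : forall x, T 0 x = x.
Hypothesis TD : forall s t x, T (s + t) x = T s (T t x).

(** u lies in the domain of the infinitesimal generator of T, and w is the value there. *)
Definition gen (u w : V) := forall e : R, 0 < e -> exists2 r, 0 < r & forall t,
  t != 0 -> `|t| < r -> nrm (t^-1%:C *: (T t u - u) - w) <= e.

Lemma nrmT t x : nrm (T t x) = nrm x.
Proof. by rewrite /nrm Tiso. Qed.

Lemma genD u w u' w' : gen u w -> gen u' w' -> gen (u + u') (w + w').
Proof.
move=> h h' e e0; have e2 : 0 < e / 2 by rewrite divr_gt0.
have [r r0 hr] := h _ e2; have [s s0 hs] := h' _ e2.
exists (Num.min r s); first by rewrite lt_min r0.
move=> t t0; rewrite lt_min => /andP[tr ts].
rewrite (Tlin t).1 opprD addrACA scalerDr opprD addrACA.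
apply: le_trans (nrmD hip _ _) _; have := hr t t0 tr; have := hs t t0 ts; lra.
Qed.

Lemma genZ a u w : gen u w -> gen (a *: u) (a *: w).
Proof.
move=> h e e0; have a1 : 0 < normc a + 1 by rewrite ltr_wpDl ?normc_ge0.
have [r r0 hr] := h _ (divr_gt0 e0 a1); exists r => // t t0 tr.
rewrite (Tlin t).2 -scalerBr scalerA mulrC -scalerA -scalerBr (nrmZ hip).
apply: le_trans (ler_wpM2l (normc_ge0 a) (hr t t0 tr)) _.
rewrite mulrCA ger_pMr// ler_pdivrMr// mul1r; lra.
Qed.

Lemma genT s u w : gen u w -> gen (T s u) (T s w).
Proof.
move=> h e e0; have [r r0 hr] := h _ e0; exists r => // t t0 tr.
have -> : T t (T s u) = T s (T t u) by rewrite -!TD addrC.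
by rewrite -(linB _ _ (Tlin s)) -(Tlin s).2 -(linB _ _ (Tlin s)) nrmT hr.
Qed.

Lemma gen_uniq u w w' : gen u w -> gen u w' -> w = w'.
Proof.
move=> h h'; apply/eqP; rewrite -subr_eq0; apply/eqP/(nrm_eq0 hip)/eqP.
rewrite eq_le nrm_ge0 andbT; apply/ler_addgt0Pr => e e0; rewrite add0r.
have e2 : 0 < e / 2 by rewrite divr_gt0.
have [r r0 hr] := h _ e2; have [s s0 hs] := h' _ e2.
pose t := Num.min r s / 2; have t0 : 0 < t by rewrite divr_gt0// lt_min r0.
have tl : t < Num.min r s by rewrite ltr_pdivrMr// ltr_pMr ?lt_min ?r0// ltr1n.
have := hr t (lt0r_neq0 t0); have := hs t (lt0r_neq0 t0).
rewrite gtr0_norm//; move: tl; rewrite lt_min => /andP[t1 t2] /(_ t2) h1 /(_ t1) h2.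
have := nrm_tri hip (t^-1%:C *: (T t u - u)) w w'.
by rewrite (nrmBC hip w (_ *: _)); lra.
Qed.

Lemma gen_is_derive u w k s : gen u w ->
  is_derive s (1 : R) (fun s => complex.Re (ip (T s u) k)) (complex.Re (ip (T s w) k)).
Proof.
move=> huw; pose q (h : R) := h^-1 *: (((fun s => complex.Re (ip (T s u) k)) \o shift s) (h *: 1) -
  complex.Re (ip (T s u) k)).
have cq : (q h @[h --> 0^'] --> complex.Re (ip (T s w) k))%classic.
  apply/cvgrPdist_le => e e0; have k1 : 0 < nrm k + 1 by rewrite ltr_wpDl ?nrm_ge0.
  have [r r0 hr] := huw _ (divr_gt0 e0 k1).
  near=> h.
  have h0 : h != 0 by near: h; exact: nbhs_dnbhs_neq.
  have hlt : `|h| < r by near: h; exact: dnbhs0_lt.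
  have -> : q h = complex.Re (ip (T s (h^-1%:C *: (T h u - u))) k).
    rewrite /q /= [h%:A]mulr1 [h + s]addrC TD (Tlin s).2 (ipZl hip) ReZ.
    by rewrite (linB _ _ (Tlin s)) (ipBl hip) ReB.
  rewrite distrC -ReB -(ipBl hip) -(linB _ _ (Tlin s)).
  apply: le_trans (Re_le_normc _) _; apply: le_trans (CS _ _) _; rewrite nrmT.
  apply: le_trans (ler_wpM2r (nrm_ge0 _ _) (hr h h0 hlt)) _.
  rewrite -mulrA ger_pMr// mulrC ler_pdivrMr// mul1r; lra.
split; first exact: (cvgP _ cq).
exact: (cvg_lim _ cq).
Unshelve. all: by end_near. Qed.

(** The mean value theorem needs real values; a phase makes the increment real and positive before
    it is applied. *)
Lemma gen_increment u w k (B t : R) : gen u w ->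
  (forall s, normc (ip (T s w) k) <= B) -> normc (ip (T t u - u) k) <= B * `|t|.
Proof.
move=> huw hB; have [c c1 hc] := normc_phase (ip (T t u - u) k).
have -> : normc (ip (T t u - u) k) = complex.Re (ip (T t (c *: u)) k) -
    complex.Re (ip (T 0 (c *: u)) k).
  by rewrite T0 -ReB -(ipBl hip) (Tlin t).2 -scalerBr (ipZl hip) hc.
apply: le_trans (ler_norm _) _.
apply: (@derive_lipschitz R (fun s => complex.Re (ip (T s (c *: u)) k))
  (fun s => complex.Re (ip (T s (c *: w)) k))) => s.
  exact: gen_is_derive (genZ c huw).
move=> _; apply: le_trans (Re_le_normc _) _.
by rewrite (Tlin s).2 (ipZl hip) normcM c1 mul1r.
Qed.

Lemma gen_lip u w t : gen u w -> nrm (T t u - u) <= nrm w * `|t|.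
Proof.
move=> huw; apply: (nrm_le_ip hip) => [|k]; first by rewrite mulr_ge0 ?nrm_ge0.
rewrite mulrAC; apply: gen_increment huw _ => s.
by apply: le_trans (CS _ _) _; rewrite nrmT.
Qed.

Lemma ipT t x y : ip (T t x) y = ip x (T (- t) y).
Proof. by rewrite -(Tiso (- t)) -TD addNr T0. Qed.

(** [ip w f] is the limit of [ip (T t u - u) f / t], and the difference can be moved onto f as
    [T (- t) f - f]. *)
Lemma lip_gen_bound f K u w : (forall t, nrm (T t f - f) <= K * `|t|) -> gen u w ->
  normc (ip w f) <= K * nrm u.
Proof.
move=> hf huw; apply/ler_addgt0Pr => e e0.
have f1 : 0 < nrm f + 1 by rewrite ltr_wpDl ?nrm_ge0.
have [r r0 hr] := huw _ (divr_gt0 e0 f1).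
pose t := r / 2; have t0 : 0 < t by rewrite divr_gt0.
have tr : `|t| < r by rewrite gtr0_norm// ltr_pdivrMr// ltr_pMr// ltr1n.
have {hr} := hr t (lt0r_neq0 t0) tr; set d := _ - w => hd.
have -> : w = t^-1%:C *: (T t u - u) - d by rewrite /d opprB addrC subrK.
rewrite (ipBl hip); apply: le_trans (le_normcD _ _) _; rewrite normcN.
apply: lerD.
  rewrite (ipZl hip) normcM normc_real (ipBl hip) ipT -(ipBr hip).
  rewrite gtr0_norm ?invr_gt0// ler_pdivrMl//; apply: le_trans (CS _ _) _.
  have := hf (- t); rewrite normrN gtr0_norm// => h.
  have -> : t * (K * nrm u) = nrm u * (K * t) by ring.
  by rewrite ler_wpM2l ?nrm_ge0.
apply: le_trans (CS _ _) _; apply: le_trans (ler_wpM2r (nrm_ge0 _ _) hd) _.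
rewrite -mulrA ger_pMr// mulrC ler_pdivrMr// mul1r; lra.
Qed.

Lemma lip_weak_derivative (M : set V) f K : M 0 ->
  (forall x y, M x -> M y -> M (x + y)) -> (forall a x, M x -> M (a *: x)) ->
  (forall u, M u -> exists w, gen u w) ->
  (forall t, nrm (T t f - f) <= K * `|t|) ->
  exists h, forall u w, M u -> gen u w -> ip w f = ip u h.
Proof.
move=> M0 MD MZ Mgen hf.
have /choice[D hD] : forall u, exists w, M u -> gen u w.
  by move=> u; have [/Mgen[w hw]|nM] := pselect (M u); [exists w|exists 0].
have [u v Mu Mv|a u Mu|u Mu|h [hh _]] := @riesz_sub _ _ _ hip M M0 MD MZ (fun u => ip (D u) f) K.
- rewrite -(ipDl hip); congr (ip _ _); apply: (gen_uniq (hD _ (MD _ _ Mu Mv))).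
  by apply: genD; exact: hD.
- rewrite -(ipZl hip); congr (ip _ _); apply: (gen_uniq (hD _ (MZ _ _ Mu))).
  by apply: genZ; exact: hD.
- exact: lip_gen_bound hf (hD _ Mu).
exists h => u w Mu huw; rewrite -hh//; congr (ip _ _).
exact: (gen_uniq huw (hD _ Mu)).
Qed.

End one_parameter_group.

(** * Boxes and test functions as elements of L^2 *)

Section box_measure.
Variable R : realType.
Local Open Scope classical_set_scope.

Definition box n (K : R) : set 'cV[R]_n := [set x | forall i, `|x i 0| <= K].

Lemma measurable_box n K : measurable (@box n K).
Proof.
have -> : @box n K = \bigcap_(i in [set: 'I_n])
    ((fun x : 'cV[R]_n => x i 0) @^-1` `[- K, K]).
  apply/seteqP; split=> x /= h; first by move=> i _; rewrite /= in_itv/= -ler_norml; exact: h.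
  by move=> i; have := h i I; rewrite /= in_itv/= -ler_norml.
apply: fin_bigcap_measurable => // i _.
by rewrite -[X in measurable X]setTI; exact: measurable_cV_coord.
Qed.

Lemma box_finite n K : (lebesgue_cV n (@box n K) < +oo)%E.
Proof.
elim: n => [|n IH]; first by rewrite /= /dirac/= ltry.
rewrite /= /lebesgue_cV_step /pushforward.
have -> : @cV_cons R n @^-1` (@box n.+1 K) = `[- K, K] `*` @box n K.
  apply/seteqP; split=> -[a x] /= h.
    split; first by have := h ord0; rewrite /cV_cons !mxE unlift_none/= in_itv/= -ler_norml.
    by move=> i; have := h (lift ord0 i); rewrite /cV_cons !mxE liftK.
  move=> i; rewrite /cV_cons !mxE; case: h => h1 h2.
  case: unliftP => [j _|_] /=; first exact: h2.
  by rewrite /= in_itv/= -ler_norml in h1.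
rewrite product_measure1E//; last exact: measurable_box.
have fin : lebesgue_measure (`[- K, K] : set R) \is a fin_num.
  by rewrite lebesgue_measure_itv; case: ifP.
exact: lte_mul_pinfty.
Qed.

End box_measure.

Section L2_of_bounded.
Context {R : realType} {d : nat}.
Local Notation Rd := 'cV[R]_d.
Local Notation mu := (@lebesgue_cV R d).
Local Notation L2 := (L2Rd R d).

Lemma rint_box (f : Rd -> R) (B K : R) : measurable_fun setT f ->
  (forall x, `|f x| <= B) -> (forall x, f x != 0 -> box K x) ->
  rint mu f /\ \int[mu]_x `|f x| <= B * fine (mu (box K)).
Proof.
move=> mf fB fK; have mK := @measurable_box R d K; have fin := @box_finite R d K.
have i0 : rint mu (fun x => \1_(box K) x).
  apply/integrableP; split; first exact/measurable_EFinP/measurable_indic.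
  under eq_integral do rewrite gee0_abs ?lee_fin//.
  by rewrite integral_indic// setIT.
have i1 : rint mu (fun x => B * \1_(box K) x) by exact: rintZ.
have hb x : `|f x| <= B * \1_(box K) x.
  have [->|/fK hx] := eqVneq (f x) 0.
    rewrite normr0 mulr_ge0//; exact: le_trans (fB x).
  by rewrite indicE mem_set// mulr1.
have i2 : rint mu f by exact: rint_le hb i1.
split=> //; apply: (le_trans (le_Rintegral measurableT (rint_abs i2) i1 (fun x _ => hb x))).
by rewrite RintegralZl// /Rintegral integral_indic// setIT.
Qed.

Lemma sqi_box (f : Rd -> R[i]) (B K : R) : cmeasurable f ->
  (forall x, normc (f x) <= B) -> (forall x, f x != 0 -> box K x) -> sqi mu f.
Proof.
move=> [m1 m2] fB fK; apply/sqiP; split=> //.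
  apply: (proj1 (@rint_box _ (B ^+ 2) K _ _ _)).
  - exact: measurable_funX.
  - move=> x; rewrite normrX lerXn2r ?nnegrE//.
      exact: le_trans (normc_ge0 _) (fB x).
    exact: le_trans (Re_le_normc _) (fB x).
  - by move=> x fx; apply: fK; apply: contraNneq fx => ->; rewrite expr0n.
apply: (proj1 (@rint_box _ (B ^+ 2) K _ _ _)).
- exact: measurable_funX.
- move=> x; rewrite normrX lerXn2r ?nnegrE//.
    exact: le_trans (normc_ge0 _) (fB x).
  exact: le_trans (Im_le_normc _) (fB x).
- by move=> x fx; apply: fK; apply: contraNneq fx => ->; rewrite expr0n.
Qed.

Lemma nrm_box (f : L2) (u : Rd -> R) (B K : R) : measurable_fun setT u ->
  {ae mu, forall x, f x = (u x)%:C} -> 0 <= B ->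
  (forall x, `|u x| <= B) -> (forall x, u x != 0 -> box K x) ->
  nrm (@ip _ _ _ mu) f <= B * Num.sqrt (fine (mu (box K))).
Proof.
move=> mu0 fu B0 uB uK.
have su : sqi mu (fun x => (u x)%:C).
  apply: (@sqi_box _ B K); first by split => //=; exact: measurable_cst.
    by move=> x; rewrite normc_real.
  by move=> x ux; apply: uK; apply: contraNneq ux => ->.
have m0 : 0 <= fine (mu (box K)) by rewrite fine_ge0.
rewrite -(@ler_pXn2r _ 2)// ?nnegrE ?nrm_ge0 ?mulr_ge0 ?sqrtr_ge0//.
rewrite (sqr_nrm (L2_hilbert mu)) exprMn sqr_sqrtr// /ip.
rewrite (inner_ae _ su _ su fu fu); try exact: sqi_L2.
rewrite Re_inner_self//= [X in _ + X](_ : _ = 0) ?addr0; last first.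
  by under eq_Rintegral do rewrite expr0n; rewrite Rintegral_cst//= mul0r.
have b1 x : `|u x ^+ 2| <= B ^+ 2 by rewrite normrX lerXn2r.
have b2 x : u x ^+ 2 != 0 -> box K x.
  by move=> ux; apply: uK; apply: contraNneq ux => ->; rewrite expr0n.
have [_] := @rint_box (fun x => u x ^+ 2) (B ^+ 2) K (measurable_funX _ mu0) b1 b2.
apply: le_trans; rewrite le_eqVlt; apply/orP; left; apply/eqP/eq_Rintegral => x _.
by rewrite ger0_norm ?sqr_ge0.
Qed.

Local Notation tf := (@test_function R d).

Lemma tfD u v : tf u -> tf v -> tf (u + v).
Proof.
move=> [u1 /compact_supportP[K hK]] [v1 /compact_supportP[L hL]]; split.
  by move=> k; exact: CkD.
apply/compact_supportP; exists (Num.max K L) => x uv i; rewrite le_max.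
have [u0|/hK->//] := eqVneq (u x) 0.
by rewrite orbC hL//; apply: contraNneq uv => v0; rewrite /= fctE u0 v0 addr0.
Qed.

Lemma tfZ a u : tf u -> tf (a \*: u).
Proof.
move=> [u1 /compact_supportP[K hK]]; split; first by move=> k; exact: CkZ.
apply/compact_supportP; exists K => x ux i; apply: hK.
by apply: contraNneq ux => u0; rewrite /= u0 scaler0.
Qed.

Lemma tf_shift (a : Rd) u : tf u -> tf (fun x => u (x + a)).
Proof.
move=> [u1 /compact_supportP[K hK]]; split; first by move=> k; exact: Ck_shift.
apply/compact_supportP; exists (K + \sum_i `|a i 0|) => x ux i.
have := hK _ ux i; rewrite mxE => h.
have := ler_normB (x i 0 + a i 0) (a i 0); rewrite addrK => /le_trans; apply.
by apply: lerD => //; rewrite (bigD1 i)//= lerDl sumr_ge0.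
Qed.

Lemma tf_partial j u : tf u -> tf (partial j u).
Proof.
move=> [u1 /compact_supportP hu]; split.
  by move=> k; have [_ /(_ j)[_]] := u1 k.+1.
by apply/compact_supportP; exact: partial_bounded_support.
Qed.

Lemma tf_continuous u : tf u -> continuous u.
Proof. by move=> [/(_ 0%N)[]]. Qed.

Lemma tf_measurable u : tf u -> measurable_fun setT u.
Proof. by move=> /tf_continuous; exact: continuous_measurable_cV. Qed.

Lemma tf_derivable u j x : tf u -> derivable u x (delta_mx j 0).
Proof. by move=> [/(_ 1%N)[_ /(_ j)[]]]. Qed.

Lemma tf_bounded u : tf u -> exists B, forall x, `|u x| <= B.
Proof.
move=> hu; have [_ /compact_supportP[K hK]] := hu.
have cc : compact (u @` [set x : Rd | forall i, `|x i 0| <= K])%classic.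
  apply: continuous_compact; last exact: compact_box.
  by apply: continuous_subspaceT; exact: tf_continuous.
have [M [_ hM]] := compact_bounded cc; exists (`|M| + 1) => x.
have [->|ux] := eqVneq (u x) 0; first by rewrite normr0 addr_ge0.
apply: (hM (`|M| + 1)); first by rewrite (le_lt_trans (ler_norm _))// ltrDl.
by exists x => //; exact: hK.
Qed.

Lemma tf_support u : tf u -> exists K, forall x, u x != 0 -> box K x.
Proof. by move=> [_ /compact_supportP]. Qed.

Lemma tf_sqi u : tf u -> sqi mu (fun x => (u x)%:C).
Proof.
move=> hu; have [B hB] := tf_bounded hu; have [K hK] := tf_support hu.
apply: (@sqi_box _ B K).
- by split; [exact: tf_measurable|exact: measurable_cst].
- by move=> x; rewrite normc_real.
- by move=> x ux; apply: hK; apply: contraNneq ux => ->.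
Qed.

Definition cls u (hu : tf u) : L2 := L2of (tf_sqi hu).

Lemma cls_ae u (hu : tf u) : {ae mu, forall x, cls hu x = (u x)%:C}.
Proof. exact: L2of_ae. Qed.

(** Translations are time-frequency shifts of frequency 0. Thus the lattice shifts and the
    translations that define H^1 belong to one family [U]. *)
Definition tv (j : 'I_d) (t : R) : 'cV[R]_(d + d) := col_mx (t *: delta_mx j 0) 0.

Lemma U_tv_ae j t (f : L2) (u : Rd -> R[i]) : {ae mu, forall x, f x = u x} ->
  {ae mu, forall x, U (tv j t) f x = u (x - t *: delta_mx j 0)}.
Proof.
move=> fu; apply: filterS (U_ae_of (tv j t) fu) => x ->.
rewrite /wave /tv col_mxKu col_mxKd (_ : dot 0 _ = 0) ?mulr0 ?expi0 ?mul1r//.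
by rewrite /dot big1// => i _; rewrite mxE mul0r.
Qed.

Lemma U_tv0 j f : U (tv j 0) f = f.
Proof. by rewrite /tv scale0r col_mx0 U_0. Qed.

Lemma U_tvD j s t f : U (tv j (s + t)) f = U (tv j s) (U (tv j t) f).
Proof.
apply: L2P.
have ae0 : {ae mu, forall x, f x = f x} by apply: aeW.
apply: filterS2 (U_tv_ae j (s + t) ae0) (U_tv_ae j s (U_tv_ae j t ae0)) => x -> ->.
by rewrite scalerDl opprD addrA.
Qed.

Lemma U_tv_cls j t u (hu : tf u) :
  U (tv j t) (cls hu) = cls (tf_shift (- (t *: delta_mx j 0)) hu).
Proof. by apply: L2P; apply: filterS2 (U_tv_ae j t (cls_ae hu))
  (cls_ae (tf_shift (- (t *: delta_mx j 0)) hu)) => x -> ->. Qed.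

End L2_of_bounded.

Lemma taylor_lipschitz (R : realType) (F dF : R -> R) (B r : R) :
  (forall s, is_derive s (1 : R) F (dF s)) ->
  (forall s, `|dF s - dF 0| <= B * `|s|) -> 0 <= B ->
  `|F r - F 0 - r * dF 0| <= B * `|r| * `|r|.
Proof.
move=> hF hB B0; set p := dF 0.
have H s : is_derive s (1 : R) (F - p \*: id) (dF s - p).
  have h1 : is_derive s (1 : R) (p \*: (@id R)) p.
    by apply: is_derive_eq; rewrite [LHS]mulr1.
  exact: is_deriveB (hF s) h1.
have := @derive_lipschitz R (F - p \*: id) (fun s => dF s - p) (B * `|r|) r H.
rewrite !fctE /= scaler0 subr0 => h.
rewrite addrAC mulrC; apply: h => s sr.
by apply: le_trans (hB s) _; rewrite ler_wpM2l.
Qed.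

Section translation_generator.
Context {R : realType} {d : nat}.
Local Notation mu := (@lebesgue_cV R d).
Local Notation tf := (@test_function R d).

Lemma taylor2 u (j : 'I_d) x (B r : R) : tf u -> (forall y, `|partial j (partial j u) y| <= B) ->
  `|u (x + r *: delta_mx j 0) - u x - r * partial j u x| <= B * `|r| * `|r|.
Proof.
move=> hu hB; set e := delta_mx j 0.
have h1 y s : is_derive s (1 : R) (fun s => u (y + s *: e)) (partial j u (y + s *: e)).
  by apply: derivable_along; exact: tf_derivable.
have h2 y s : is_derive s (1 : R) (fun s => partial j u (y + s *: e)) (partial j (partial j u) (y + s *: e)).
  by apply: derivable_along; apply: tf_derivable; exact: tf_partial.
have B0 : 0 <= B by exact: le_trans (hB x).
have e0 : x + 0 *: e = x by rewrite scale0r addr0.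
have lip s : `|partial j u (x + s *: e) - partial j u (x + 0 *: e)| <= B * `|s|.
  exact: (@derive_lipschitz R _ _ B s (h2 x) (fun s' _ => hB _)).
have := @taylor_lipschitz R _ _ B r (h1 x) lip B0.
by rewrite e0.
Qed.

(** By Taylor's formula the difference quotient converges uniformly at rate [B * |t|], and a common
    box for the supports turns this into L^2 convergence. The sign is negative because x is moved to
    [x - t e_j]. *)
Lemma tf_gen u (hu : tf u) j :
  gen (@ip _ _ _ mu) (fun t => U (tv j t)) (cls hu) (- cls (tf_partial j hu)).
Proof.
have [B0 hB0] := tf_bounded (tf_partial j (tf_partial j hu)).
pose B := `|B0|; have hB y : `|partial j (partial j u) y| <= B.
  exact: le_trans (hB0 y) (ler_norm _).
have [K hK] := tf_support hu; have [K' hK'] := tf_support (tf_partial j hu).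
(* With [|t| < 1] a translate of the support stays within the box of size [K + 1]. *)
pose L := Num.max (K + 1) K'.
pose m := Num.sqrt (fine (mu (box L))).
have m0 : 0 <= m by exact: sqrtr_ge0.
have B0' : 0 <= B by exact: normr_ge0.
have Bm : 0 < B * m + 1 by rewrite ltr_wpDl// mulr_ge0.
move=> e e0; exists (Num.min 1 (e / (B * m + 1))).
  by rewrite lt_min ltr01 divr_gt0.
move=> t t0; rewrite lt_min => /andP[t1 te].
pose w x := t^-1 * (u (x - t *: delta_mx j 0) - u x) + partial j u x.
have wB x : `|w x| <= B * `|t|.
  have := @taylor2 u j x B (- t) hu hB; rewrite scaleNr mulNr opprK normrN => h.
  have -> : w x = t^-1 * (u (x - t *: delta_mx j 0) - u x + t * partial j u x).
    by rewrite /w (mulrDr _ _ (t * _)) mulKf.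
  by rewrite normrM normfV ler_pdivrMl ?normr_gt0// [leRHS]mulrC.
have mw : measurable_fun setT w.
  apply: measurable_funD; last exact: tf_measurable (tf_partial j hu).
  apply: measurable_funM; first exact: measurable_cst.
  apply: measurable_funB; last exact: tf_measurable.
  exact: tf_measurable (tf_shift _ hu).
have aew : {ae mu, forall x, L2_repr (t^-1%:C *: (U (tv j t) (cls hu) - cls hu) -
    - cls (tf_partial j hu)) x = (w x)%:C}.
  rewrite opprK.
  apply: filterS3 (L2_aeD (t^-1%:C *: (U (tv j t) (cls hu) - cls hu)) (cls (tf_partial j hu)))
    (L2_aeZ (t^-1%:C) (U (tv j t) (cls hu) - cls hu)) (filterI (L2_aeB (U (tv j t) (cls hu)) (cls hu))
    (filterI (U_tv_ae j t (cls_ae hu)) (filterI (cls_ae hu) (cls_ae (tf_partial j hu))))).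
  by move=> x -> -> [-> [-> [-> ->]]]; rewrite /w rmorphD rmorphM rmorphB.
have wK x : w x != 0 -> box L x.
  move=> wx i; rewrite /L le_max.
  have [p0|/hK'->] := eqVneq (partial j u x) 0; last by rewrite orbT.
  apply/orP; left; have [u0|/hK/(_ i)] := eqVneq (u x) 0; last by move/le_trans; apply; rewrite lerDl.
  have : u (x - t *: delta_mx j 0) != 0.
    by apply: contraNneq wx => u1; rewrite /w p0 u0 u1 subrr mulr0 addr0.
  move=> /hK/(_ i); rewrite !mxE => h.
  have := ler_normD (x i 0 - t * ((i == j) && (0 == 0 :> 'I_1))%:R) (t * ((i == j) && (0 == 0 :> 'I_1))%:R).
  rewrite subrK => /le_trans; apply; apply: lerD => //.
  rewrite normrM; apply: le_trans (ltW t1); rewrite ler_piMr//.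
  by case: (_ && _); rewrite ?normr1 ?normr0.
have Bt : 0 <= B * `|t| by rewrite mulr_ge0.
apply: le_trans (nrm_box mw aew Bt wB wK) _; rewrite -/m.
move: te; rewrite ltr_pdivlMr// => te.
have : 0 <= `|t| by [].
have -> : B * `|t| * m = `|t| * (B * m) by ring.
move: te; rewrite mulrDr mulr1; lra.
Qed.

End translation_generator.

(** * Smooth functions flat at the origin *)

Section bump.
Variable R : realType.
Implicit Types (k l : nat) (t y a b c : R).

(* [bump k] extends [exp (-1/t) / t^k] by 0 to the left half-line. *)
Definition bump k t : R := if 0 < t then expR (- t^-1) * t^-1 ^+ k else 0.

Lemma bump_ge0 k t : 0 <= bump k t.
Proof.
rewrite /bump; case: ifP => // t0.
by rewrite mulr_ge0 ?expR_ge0// exprn_ge0// invr_ge0 ltW.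
Qed.

(** With [m = k.+2], the inequality [expR s >= (s / m) ^+ m] at [s = t^-1] gives the constant
    [m ^+ m]. The spare factor [t ^+ 2] yields the derivative at 0. *)
Lemma bump_le k t : bump k t <= (k.+2%:R) ^+ k.+2 * t ^+ 2.
Proof.
rewrite /bump; case: ifPn => [t0|_]; last by rewrite mulr_ge0 ?sqr_ge0 ?exprn_ge0.
have s0 : 0 < t^-1 by rewrite invr_gt0.
have -> : expR (- t^-1) * t^-1 ^+ k = (t^-1 ^+ k.+2 / expR t^-1) * t ^+ 2.
  have st : t^-1 ^+ 2 * t ^+ 2 = 1 by rewrite -exprMn mulVf ?expr1n// gt_eqF.
  by rewrite expRN -addn2 exprD mulrAC -[_ * _ * t ^+ 2]mulrA st mulr1 mulrC.
rewrite ler_wpM2r ?sqr_ge0// ler_pdivrMr ?expR_gt0//.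
have -> : t^-1 ^+ k.+2 = k.+2%:R ^+ k.+2 * (t^-1 / k.+2%:R) ^+ k.+2.
  by rewrite -exprMn mulrC divfK.
rewrite ler_wpM2l ?exprn_ge0//.
have -> : expR t^-1 = expR (t^-1 / k.+2%:R) ^+ k.+2.
  by rewrite -expRM_natl mulrC divfK.
rewrite lerXn2r ?nnegrE ?expR_ge0 ?divr_ge0 ?(ltW s0)//.
by apply: le_trans (expR_ge1Dx _); rewrite lerDr.
Qed.

Lemma is_derive0_quadratic (f : R -> R) (C : R) : f 0 = 0 -> 0 <= C ->
  (forall h, `|f h| <= C * h ^+ 2) -> is_derive (0 : R) (1 : R) f 0.
Proof.
move=> f0 C0 fC.
have cv : ((fun h : R => h^-1 *: ((f \o shift 0) (h *: 1) - f 0)) @ 0^' --> (0 : R))%classic.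
  apply/cvgrPdist_lt => e e0; near=> h.
  rewrite sub0r normrN f0 subr0 /= addr0 [h *: 1]mulr1.
  have hne : h != 0 by near: h; exact: nbhs_dnbhs_neq.
  have he : `|h| < e / (C + 1).
    by near: h; apply: dnbhs0_lt; rewrite divr_gt0// ltr_wpDl.
  rewrite normrM normfV ltr_pdivrMl ?normr_gt0//.
  apply: le_lt_trans (fC h) _; rewrite -real_normK ?num_real// expr2.
  rewrite mulrCA ltr_pM2l ?normr_gt0//.
  move: he; rewrite ltr_pdivlMr ?ltr_wpDl// mulrDr mulr1 mulrC => he.
  by apply: le_lt_trans he; rewrite lerDl.
split; first by apply/cvg_ex; exists 0.
exact: cvg_lim cv.
Unshelve. all: by end_near. Qed.

(** Differentiation maps the family into its own span, which is why the exponent k is carried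
    along. *)
Lemma is_derive_bump k t : is_derive t (1 : R) (bump k) (bump k.+2 t - k%:R * bump k.+1 t).
Proof.
have [t0|t0|->] := ltgtP t 0.
- apply: (@near_eq_is_derive _ _ _ (cst 0)); last first.
    by rewrite /bump ltNge (ltW t0)/= mulr0 subr0; exact: is_derive_cst.
  near=> s; rewrite /bump; case: ifP => // s0; exfalso; move: s0; apply/negP.
  by rewrite -leNgt ltW//; near: s; exact: lt_nbhsl.
- apply: (@near_eq_is_derive _ R R (fun s : R => expR (- s^-1) * s^-1 ^+ k)).
    near=> s; rewrite /bump; case: ifPn => // /negP s0; exfalso; apply: s0.
    by near: s; exact: lt_nbhsr.
  have t1 : t != 0 by rewrite gt_eqF.
  have dV : is_derive t (1 : R) (fun s : R => s^-1) (- t ^- 2).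
    apply: is_derive_eq (is_deriveV t1 (is_derive_id t 1)) _.
    by rewrite [LHS]mulr1.
  have dX := is_deriveX k dV.
  have dE : is_derive t (1 : R) (fun s : R => expR (- s^-1)) (expR (- t^-1) * (t ^- 2)).
    apply: (@is_derive1_comp R expR (fun s => - s^-1)).
    by apply: is_derive_eq (is_deriveN dV) _; rewrite opprK.
  have := is_deriveM dE dX.
  have -> : (fun s : R => expR (- s^-1)) * ((fun s : R => s^-1) ^+ k) =
     (fun s => expR (- s^-1) * s^-1 ^+ k).
    by apply/funext => s; rewrite fctE; congr (_ * _); elim: (k) => [|m IH]; rewrite ?expr0// !exprS -IH.
  move/is_derive_eq; apply; rewrite /bump t0 /GRing.scale/= -exprVn.
  have -> : (fun s : R => s^-1) ^+ k = (fun s : R => s^-1 ^+ k).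
    by apply/funext => s; elim: (k) => [|m IH]; rewrite ?expr0// !exprS -IH.
  case: k {dX} => [|m] /=; first by rewrite !expr2 expr0 !mul0r mulr0 add0r subr0 mul1r.
  by rewrite !exprS; ring.
have -> : bump k.+2 0 - k%:R * bump k.+1 0 = 0 by rewrite /bump ltxx mulr0 subr0.
apply: (@is_derive0_quadratic _ (k.+2%:R ^+ k.+2)); first by rewrite /bump ltxx.
  by rewrite exprn_ge0.
by move=> h; rewrite ger0_norm ?bump_ge0//; exact: bump_le.
Unshelve. all: by end_near. Qed.

End bump.

(** * Density of the test functions *)

Section tensor.
Variable R : realType.
Implicit Types (F G : R -> R).

(** This class contains the factors of [box_bump] and is closed under differentiation, so the mixed
    partial derivatives of a tensor product exist by induction, without formulas. *)
Inductive bump_span : (R -> R) -> Prop :=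
| bump_span_prod k l (c a b : R) :
    bump_span (fun y => bump k (c * (y - a)) * bump l (c * (b - y)))
| bump_spanD F G : bump_span F -> bump_span G -> bump_span (F + G)
| bump_spanZ (c : R) F : bump_span F -> bump_span (c \*: F).

Lemma is_derive_bump_affine k (c a y : R) :
  is_derive y (1 : R) (fun y => bump k (c * (y - a)))
    ((bump k.+2 (c * (y - a)) - k%:R * bump k.+1 (c * (y - a))) * c).
Proof.
apply: (@is_derive1_comp R (bump k) (fun y => c * (y - a))); first exact: is_derive_bump.
have h : is_derive y (1 : R) (c \*: (@id R - cst a)) c.
  by apply: is_derive_eq; rewrite subr0 [LHS]mulr1.
exact: h.
Qed.

Lemma bump_span_derive F : bump_span F ->
  exists2 dF, bump_span dF & forall y, is_derive y (1 : R) F (dF y).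
Proof.
elim=> [k l c a b|{}F G _ [dF sF hF] _ [dG sG hG]|c {}F _ [dF sF hF]].
- pose P k l y := bump k (c * (y - a)) * bump l (c * (b - y)).
  exists (c \*: (P k.+2 l + (- k%:R) \*: P k.+1 l) +
    (- c) \*: (P k l.+2 + (- l%:R) \*: P k l.+1)).
    have sP k' l' : bump_span (P k' l') by exact: bump_span_prod.
    by apply: bump_spanD; apply: bump_spanZ; apply: bump_spanD => //; exact: bump_spanZ.
  move=> y; have h1 := is_derive_bump_affine k c a y.
  have h2 : is_derive y (1 : R) (fun y => bump l (c * (b - y)))
      ((bump l.+2 (c * (b - y)) - l%:R * bump l.+1 (c * (b - y))) * - c).
    have e z : c * (b - z) = - c * (z - b) by ring.
    have := is_derive_bump_affine l (- c) b y; rewrite -e.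
    by under eq_fun do rewrite -e.
  apply: is_derive_eq (is_deriveM h1 h2) _.
  have sc (p q : R) : p *: q = p * q by [].
  by rewrite /P !fctE /= !sc; ring.
- by exists (dF + dG); [exact: bump_spanD|move=> y; exact: is_deriveD].
- by exists (c \*: dF); [exact: bump_spanZ|move=> y; exact: is_deriveZ].
Qed.

Variable n : nat.
Implicit Types H : 'I_n -> R -> R.

Definition tensor H (x : 'cV[R]_n) : R := \prod_i H i (x i 0).

Lemma tensor_continuous H : (forall i, continuous (H i)) -> continuous (tensor H).
Proof.
move=> cH; apply: continuous_big; first exact: mul_continuous.
move=> i _ x; apply: (@continuous_comp _ _ _ (fun x : 'cV[R]_n => x i 0) (H i)).
  exact: coord_continuous.
exact: cH.
Qed.

Definition replace H j F : 'I_n -> R -> R := fun i => if i == j then F else H i.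

Lemma tensor_partial H j F : (forall y, is_derive y (1 : R) (H j) (F y)) ->
  (forall x, derivable (tensor H) x (delta_mx j 0)) /\
  partial j (tensor H) = tensor (replace H j F).
Proof.
move=> hF; have q x : (fun h : R => h^-1 *: ((tensor H \o shift x) (h *: delta_mx j 0) - tensor H x)) =
    (fun h : R => (\prod_(i | i != j) H i (x i 0)) *
      (h^-1 *: ((H j \o shift (x j 0)) (h *: 1) - H j (x j 0)))).
  apply/funext => h; rewrite /= /tensor (bigD1 j)//= [X in _ - X](bigD1 j)//=.
  rewrite !mxE !eqxx [h *: 1]mulr1.
  under eq_bigr => i ij do rewrite !mxE (negbTE ij) mulr0 add0r.
  have sc (p q : R) : p *: q = p * q by [].
  by rewrite mulr1 -mulrBl !sc; ring.
have e (x : 'cV[R]_n) : tensor (replace H j F) x = (\prod_(i | i != j) H i (x i 0)) * F (x j 0).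
  rewrite /tensor (bigD1 j)//= /replace eqxx mulrC; congr (_ * _).
  by apply: eq_bigr => i /negbTE ->.
have cv (x : 'cV[R]_n) : ((fun h : R => (\prod_(i | i != j) H i (x i 0)) *
      (h^-1 *: ((H j \o shift (x j 0)) (h *: 1) - H j (x j 0)))) @ 0^' -->
    tensor (replace H j F) x)%classic.
  rewrite e; apply: cvgMl_tmp; have [d1 <-] := hF (x j 0); exact: d1.
split=> [x|]; first by rewrite /derivable q; apply/cvg_ex; eexists; exact: cv.
by apply/funext => x; rewrite /partial /derive q; exact: cvg_lim (cv x).
Qed.

Lemma tensor_Ck k H : (forall i, bump_span (H i)) -> Ck k (tensor H).
Proof.
have ct H' : (forall i, bump_span (H' i)) -> continuous (tensor H').
  move=> sH; apply: tensor_continuous => i y.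
  have [dF _ /(_ y)[hF _]] := bump_span_derive (sH i).
  exact/differentiable_continuous/derivable1_diffP.
elim: k H => [|k IH] H sH; split=> //; try exact: ct.
move=> j; have [dF sF hF] := bump_span_derive (sH j).
have [h1 h2] := tensor_partial hF; split=> //.
by rewrite h2; apply: IH => i; rewrite /replace; case: eqP.
Qed.

(** For s > 0 the factor [bump 0 (c * s)], which is [exp (-1 / (c s))], tends to 1 as c grows. The
    limit is the indicator of the open box, while the support never leaves its closure. *)
Definition box_bump (c : R) (a b : 'cV[R]_n) : 'cV[R]_n -> R :=
  tensor (fun i y => bump 0 (c * (y - a i 0)) * bump 0 (c * (b i 0 - y))).

Definition open_box (a b : 'cV[R]_n) : set 'cV[R]_n :=
  [set x | forall i, a i 0 < x i 0 < b i 0]%classic.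

Lemma bump0_le1 (t : R) : bump 0 t <= 1.
Proof.
rewrite /bump; case: ifP => // t0.
by rewrite expr0 mulr1 -expR0 ler_expR oppr_le0 invr_ge0 ltW.
Qed.

Lemma bump_gt0 k (t : R) : bump k t != 0 -> 0 < t.
Proof. by rewrite /bump; case: ifP; rewrite ?eqxx. Qed.

Lemma box_bump_supp c a b x : 0 < c -> box_bump c a b x != 0 -> open_box a b x.
Proof.
move=> c0; rewrite /box_bump /tensor prodf_seq_neq0 => /allP h i.
have := h i (mem_index_enum _) => /=; rewrite mulf_eq0 negb_or => /andP[/bump_gt0 h1 /bump_gt0].
by rewrite !pmulr_rgt0// !subr_gt0 in h1 * => ->; rewrite h1.
Qed.

Lemma box_bump_bound c a b x : 0 <= box_bump c a b x <= 1.
Proof.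
apply: (big_ind (fun p : R => 0 <= p <= 1)); first by rewrite ler01 lexx.
  by move=> p q /andP[p0 p1] /andP[q0 q1]; rewrite mulr_ge0// mulr_ile1.
by move=> i _; rewrite mulr_ge0 ?bump_ge0//= mulr_ile1 ?bump_ge0 ?bump0_le1.
Qed.

Lemma box_bump_test c a b : 0 < c -> test_function (box_bump c a b).
Proof.
move=> c0; split; first by move=> k; apply: tensor_Ck => i; exact: bump_span_prod.
apply/compact_supportP; exists (\sum_i (`|a i 0| + `|b i 0|)) => x /box_bump_supp/(_ _)/= h i.
have /andP[h1 h2] := h c0 i.
rewrite (bigD1 i)//=; apply: ler_wpDr; first by apply: sumr_ge0 => k _; rewrite addr_ge0.
rewrite ler_norml; apply/andP; split.
  rewrite lerNl; apply: (@le_trans _ _ `|a i 0|); last by rewrite lerDl.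
  by rewrite -normrN (le_trans _ (ler_norm _))// lerN2 ltW.
by apply: ltW; apply: lt_le_trans h2 _; apply: le_trans (ler_norm _) _; rewrite lerDr.
Qed.

Lemma box_bump_cvg a b x :
  ((fun m : nat => box_bump m.+1%:R a b x) @ \oo --> (\1_(open_box a b) x : R))%classic.
Proof.
have c1 (s : R) : 0 < s -> ((fun m : nat => bump 0 (m.+1%:R * s)) @ \oo --> (1 : R))%classic.
  move=> s0; have -> : (fun m : nat => bump 0 (m.+1%:R * s)) = (fun m => expR (- (m.+1%:R^-1 * s^-1))).
    by apply/funext => m; rewrite /bump mulr_gt0// expr0 mulr1 invfM.
  rewrite -[X in (_ --> X)%classic]expR0; apply: continuous_cvg; first exact: continuous_expR.
  rewrite -oppr0; apply: cvgN; rewrite -(mul0r s^-1); apply: cvgMr_tmp; exact: cvg_harmonic.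
have [xab|xab] := pselect (open_box a b x).
  rewrite indicE mem_set//= /box_bump /tensor.
  rewrite [X in (_ --> X)%classic](_ : _ = \prod_(i < n) (1 : R)); last by rewrite big1.
  apply: (@cvg_big R 'I_n *%R 1 xpredT _ _ _ _ (fun i (m : nat) =>
    bump 0 (m.+1%:R * (x i 0 - a i 0)) * bump 0 (m.+1%:R * (b i 0 - x i 0))) (fun=> 1)).
    exact: mul_continuous.
  move=> i _; have /andP[h1 h2] := xab i; rewrite -[X in (_ --> X)%classic]mulr1.
  by apply: cvgM; apply: c1; rewrite subr_gt0.
rewrite indicE memNset//=.
have -> : (fun m : nat => box_bump m.+1%:R a b x) = cst 0.
  apply/funext => m /=; apply/eqP; apply: contrapT => /negP h; apply: xab.
  by apply: box_bump_supp h.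
exact: cvg_cst.
Qed.

End tensor.

Section density.
Variables (R : realType) (n : nat).
Local Notation Rn := 'cV[R]_n.
Local Notation mu := (@lebesgue_cV R n).
Local Open Scope classical_set_scope.

Definition boxes : set (set Rn) := [set A | exists a b, A = open_box a b].

Lemma boxes_setI : setI_closed boxes.
Proof.
move=> _ _ [a [b ->]] [a' [b' ->]].
exists (\col_i Num.max (a i 0) (a' i 0)), (\col_i Num.min (b i 0) (b' i 0)).
apply/seteqP; split=> x /=.
  move=> [h h'] i; rewrite !mxE gt_max lt_min.
  by have /andP[-> ->] := h i; have /andP[-> ->] := h' i.
by move=> h; split=> i; have := h i; rewrite !mxE gt_max lt_min => /andP[/andP[h1 h2] /andP[h3 h4]]; apply/andP.
Qed.

Lemma measurable_open_box (a b : Rn) : measurable (open_box a b).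
Proof.
have -> : open_box a b = \bigcap_(i in [set: 'I_n])
    ((fun x : Rn => x i 0) @^-1` `]a i 0, b i 0[).
  apply/seteqP; split=> x /= h; first by move=> i _; rewrite /= in_itv/=; exact: h.
  by move=> i; have := h i I; rewrite /= in_itv.
apply: fin_bigcap_measurable => // i _.
by rewrite -[X in measurable X]setTI; exact: measurable_cV_coord.
Qed.

Lemma measurable_cVE : @measurable _ Rn = <<s boxes >>.
Proof.
apply/seteqP; split; last first.
  apply: smallest_sub; first exact: sigma_algebra_measurable.
  by move=> _ [a [b ->]]; exact: measurable_open_box.
rewrite {1}/measurable/=; apply: smallest_sub; first exact: smallest_sigma_algebra.
rewrite -bigcup_seq; apply: bigcup_sub => j _ A [B mB <-].
suff mj : measurable_fun [set: g_sigma_algebraType boxes] (fun x : Rn => x j 0) by exact: mj.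
apply: (measurability _ (RGenOInfty.measurableE R)) => _ [_ [c ->] <-]; rewrite setTI.
pose a (m : nat) : Rn := \col_i (if i == j then c else - m%:R).
have -> : (fun x : Rn => x j 0) @^-1` `]c, +oo[ = \bigcup_m open_box (a m) (const_mx m%:R).
  apply/seteqP; split=> [x /=|x [m _ /(_ j) h]]; rewrite /= in_itv/= andbT.
    move=> cx; pose K := \sum_i `|x i 0|; exists (Num.bound K) => // i.
    have xK : `|x i 0| <= K by rewrite /K (bigD1 i)//= lerDl sumr_ge0.
    have := le_lt_trans xK (archi_boundP (le_trans (normr_ge0 _) xK)).
    rewrite ltr_norml !mxE => /andP[h1 ->]; rewrite andbT.
    by case: eqP => [->|].
  by move: h; rewrite !mxE eqxx => /andP[].
by apply: bigcupT_measurable => m; apply: sub_sigma_algebra; exists (a m), (const_mx m%:R).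
Qed.

Variable v : Rn -> R.
Hypothesis mv : measurable_fun setT v.
Hypothesis v2 : rint mu (fun x => v x ^+ 2).

(** v is only square integrable, but on a box [|v| <= 1 + v^2] is integrable. *)
Lemma rint_mul_bounded (w : Rn -> R) (K : R) : measurable_fun setT w ->
  (forall x, `|w x| <= 1) -> (forall x, w x != 0 -> box K x) ->
  rint mu (fun x => w x * v x).
Proof.
move=> mw w1 wK.
have i0 := (@rint_box R n (\1_(box K)) 1 K (measurable_indic (@measurable_box R n K)) _ _).1.
apply: (@rint_le _ _ _ mu _ (fun x => \1_(box K) x + v x ^+ 2)).
- exact: measurable_funM.
- move=> x; have [->|wx] := eqVneq (w x) 0.
    by rewrite mul0r normr0 addr_ge0 ?sqr_ge0// indicE.
  rewrite indicE mem_set ?normrM; last exact: wK.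
  apply: (@le_trans _ _ `|v x|); first by rewrite ler_piMl.
  rewrite -[v x ^+ 2]real_normK ?num_real//.
  have := sqr_ge0 (`|v x| - 2^-1); move: `|v x| => t; rewrite mulr1n /=; nra.
- apply: rintD => //; apply: i0 => x; first by rewrite indicE; case: (_ \in _); rewrite ?normr1 ?normr0.
  by rewrite indicE; case: (pselect (box K x)) => [//|h]; rewrite memNset// eqxx.
Qed.

Hypothesis v_perp : forall u, test_function u -> \int[mu]_x (u x * v x) = 0.

Lemma box_support (a b : Rn) : exists K, forall x, open_box a b x -> box K x.
Proof.
exists (\sum_i (`|a i 0| + `|b i 0|)) => x h i.
have /andP[h1 h2] := h i.
rewrite (bigD1 i)//=; apply: ler_wpDr; first by apply: sumr_ge0 => k _; rewrite addr_ge0.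
rewrite ler_norml; apply/andP; split.
  rewrite lerNl; apply: (@le_trans _ _ `|a i 0|); last by rewrite lerDl.
  by rewrite -normrN (le_trans _ (ler_norm _))// lerN2 ltW.
by apply: ltW; apply: lt_le_trans h2 _; apply: le_trans (ler_norm _) _; rewrite lerDr.
Qed.

Lemma rint_indic_open_box (a b : Rn) : rint mu (fun x => \1_(open_box a b) x * v x).
Proof.
have [K hK] := box_support a b; apply: (@rint_mul_bounded _ K).
- by apply: measurable_indic; exact: measurable_open_box.
- by move=> x; rewrite indicE; case: (_ \in _); rewrite ?normr1 ?normr0.
- move=> x; rewrite indicE; case: (pselect (open_box a b x)) => [/hK//|h].
  by rewrite memNset// eqxx.
Qed.

(** The bumps increase no further than the indicator of their own box, so [|\1 * v|] is a majorant
    for dominated convergence. *)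
Lemma integral_open_box0 (a b : Rn) : (\int[mu]_x (\1_(open_box a b) x * v x)%:E = 0)%E.
Proof.
have [K hK] := box_support a b.
have ib := rint_indic_open_box a b.
have c0 m : 0 < m.+1%:R :> R by [].
have tfm m := @box_bump_test R n m.+1%:R a b (c0 m).
have im m : rint mu (fun x => box_bump m.+1%:R a b x * v x).
  apply: (@rint_mul_bounded _ K).
  - exact: continuous_measurable_cV ((tfm m).1 0%N).1.
  - by move=> x; have /andP[h1 h2] := box_bump_bound m.+1%:R a b x; rewrite ger0_norm.
  - by move=> x /(box_bump_supp (c0 m))/hK.
have [|||||_ _ h] := @dominated_convergence _ _ _ mu setT measurableT
   (fun m x => (box_bump m.+1%:R a b x * v x)%:E) (fun x => (\1_(open_box a b) x * v x)%:E)
   (fun x => (`|\1_(open_box a b) x * v x|)%:E).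
- by move=> m; exact: measurable_int (im m).
- exact: measurable_int ib.
- apply: aeW => x _; apply: cvg_EFin; first exact: nearW.
  by apply: cvgMr_tmp; exact: box_bump_cvg.
- exact: rint_abs ib.
- apply: aeW => x m _; rewrite lee_fin !normrM ler_wpM2r//.
  have /andP[h1 h2] := box_bump_bound m.+1%:R a b x; rewrite ger0_norm// indicE.
  case: (pselect (open_box a b x)) => h; first by rewrite mem_set// normr1.
  have [->//|/(box_bump_supp (c0 m))//] := eqVneq (box_bump m.+1%:R a b x) 0.
have e m : (\int[mu]_x (box_bump m.+1%:R a b x * v x)%:E = 0)%E.
  by rewrite -[LHS]fineK; [rewrite [fine _](v_perp (tfm m))|exact: integrable_fin_num (im m)].
have h' : (fun _ : nat => 0%E : \bar R) @ \oo --> (\int[mu]_x (\1_(open_box a b) x * v x)%:E)%E.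
  by apply: cvg_trans h; apply: near_eq_cvg; apply: nearW => m /=; rewrite e.
by rewrite -(cvg_lim (@ereal_hausdorff R) h') lim_cst//; exact: ereal_hausdorff.
Qed.

(** Open boxes are a pi-system generating the measurable sets, so the integral of [\1_(K m) * v]
    vanishes over every measurable set. The cutoff to [K m] provides integrability, and the [K m]
    exhaust the space. *)
Lemma ae_zero_of_orthogonal : {ae mu, forall x, v x = 0}.
Proof.
pose K m : set Rn := open_box (const_mx (- m%:R)) (const_mx m%:R).
have key m : {ae mu, forall x, \1_(K m) x * v x = 0}.
  have iw := rint_indic_open_box (const_mx (- m%:R)) (const_mx m%:R).
  have iwA A : measurable A -> mu.-integrable A (fun x => (\1_(K m) x * v x)%:E).
    by move=> mA; apply: integrableS iw.
  have P0 : (\int[mu]_x (\1_(K m) x * v x)%:E = 0)%E by exact: integral_open_box0.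
  have PA A : measurable A -> (\int[mu]_(x in A) (\1_(K m) x * v x)%:E = 0)%E.
    rewrite measurable_cVE; move: A; apply: (@dynkin_induction _ Rn boxes (fun A => \int[mu]_(x in A) (\1_(K m) x * v x)%:E = 0)%E measurable_cVE boxes_setI) => //.
    - move=> _ [a [b ->]]; rewrite integral_mkcond.
      have [a' [b' e]] : boxes (open_box a b `&` K m).
        by apply: boxes_setI; [exists a, b|exists (const_mx (- m%:R)), (const_mx m%:R)].
      rewrite -(integral_open_box0 a' b') -e; apply: eq_integral => x _.
      by rewrite patchE indicI /=; case: ifPn => xA; rewrite ?indicE ?xA ?(negbTE xA) ?mul1r// !mul0r.
    - move=> S mS S0; rewrite -(setUv S) in P0.
      rewrite integral_setU ?S0 ?add0e// in P0.
      + exact: measurableC.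
      + by rewrite setUv; exact: measurable_int iw.
      + by apply/disj_setPCl.
    - move=> F mF tF F0; rewrite integral_bigcup//.
        by rewrite eseries0.
      by apply: iwA; exact: bigcupT_measurable.
  apply: filterS (integral_ae_eq measurableT iw (measurable_cst (0%E : \bar R)) _).
    by move=> x /(_ I)[].
  by move=> A _ mA; rewrite PA// integral0.
apply: filterS (ae_foralln key) => x h.
have [m xm] : exists m, K m x.
  pose S := \sum_i `|x i 0|; exists (Num.bound S) => // i.
  have xK : `|x i 0| <= S by rewrite /S (bigD1 i)//= lerDl sumr_ge0.
  have := le_lt_trans xK (archi_boundP (le_trans (normr_ge0 _) xK)).
  by rewrite ltr_norml !mxE.
by have := h m; rewrite indicE mem_set// mul1r.
Qed.

End density.

Section test_dense.
Context {R : realType} {d : nat}.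
Local Notation Rd := 'cV[R]_d.
Local Notation mu := (@lebesgue_cV R d).
Local Notation L2 := (L2Rd R d).
Local Notation Re := (@complex.Re R).
Local Notation Im := (@complex.Im R).
Local Notation tf := (@test_function R d).
Local Notation ip := (@ip _ _ _ mu).
Local Notation nrm := (nrm ip).

Lemma ip_cls u (hu : tf u) (k : L2) :
  ip (cls hu) k = cintegral mu (fun x => (u x)%:C * conjc (k x)).
Proof.
rewrite /ip (inner_ae (sqi_L2 _) (tf_sqi hu) (sqi_L2 k) (sqi_L2 k) (cls_ae hu))//.
exact: aeW.
Qed.

Lemma cls_perp (k : L2) : (forall u (hu : tf u), ip (cls hu) k = 0) -> k = 0.
Proof.
move=> hk; have /sqiP[[mr mi] r2 i2] := sqi_L2 k.
have hr u : tf u -> \int[mu]_x (u x * Re (k x)) = 0.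
  move=> hu; have := congr1 Re (hk u hu); rewrite ip_cls /= => <-.
  by apply: eq_Rintegral => x _; rewrite ReMJ /= mul0r addr0.
have hi u : tf u -> \int[mu]_x (u x * Im (k x)) = 0.
  move=> hu; have := congr1 (fun z => - Im z) (hk u hu); rewrite ip_cls /= oppr0.
  have -> : \int[mu]_x Im ((u x)%:C * conjc (k x)) = - \int[mu]_x (u x * Im (k x)).
    rewrite -[RHS]mulN1r -RintegralZl//; last first.
      have [_ h] := sqi_cint (tf_sqi hu) (sqi_L2 k).
      by apply: eq_rint (rintZ (-1) h) => x; rewrite ImMJ /= mul0r sub0r mulN1r opprK.
    by apply: eq_Rintegral => x _; rewrite ImMJ /= mul0r sub0r mulN1r.
  by rewrite opprK.
have h0 : {ae mu, forall x, L2_repr (0 : L2) x = 0}.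
  by rewrite -(scale0r (0 : L2)); apply: filterS (L2_aeZ 0 0) => x ->; exact: mul0r.
apply: L2P; apply: filterS3 h0 (ae_zero_of_orthogonal mr r2 hr) (ae_zero_of_orthogonal mi i2 hi).
by move=> x -> e1 e2; exact: complexP.
Qed.

Lemma clsD u v (hu : tf u) (hv : tf v) : cls hu + cls hv = cls (tfD hu hv).
Proof.
apply: L2P; apply: filterS3 (L2_aeD (cls hu) (cls hv)) (cls_ae (tfD hu hv))
  (filterI (cls_ae hu) (cls_ae hv)) => x -> -> [-> ->].
by rewrite -rmorphD.
Qed.

Lemma clsZ a u (hu : tf u) : a%:C *: cls hu = cls (tfZ a hu).
Proof.
apply: L2P; apply: filterS3 (L2_aeZ (a%:C) (cls hu)) (cls_ae (tfZ a hu)) (cls_ae hu) => x -> -> ->.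
by rewrite -rmorphM.
Qed.

Definition test_class : set L2 := [set f | exists u v (hu : tf u) (hv : tf v),
  f = cls hu + 'i%C *: cls hv]%classic.

Lemma tf0 : tf (0 : Rd -> R).
Proof.
by have := tfZ 0 (box_bump_test (0 : Rd) 0 ltr01); congr tf; apply/funext => x /=; rewrite scale0r.
Qed.

Lemma cls0 : cls tf0 = 0.
Proof.
rewrite -(scale0r (cls tf0)) -[0 in RHS]/((0 : R)%:C) clsZ; apply: L2P.
by apply: filterS2 (cls_ae tf0) (cls_ae (tfZ 0 tf0)) => x -> ->; rewrite /= scaler0.
Qed.

Lemma test_class_cls u (hu : tf u) : test_class (cls hu).
Proof. by exists u, 0, hu, tf0; rewrite cls0 scaler0 addr0. Qed.

Lemma test_class0 : test_class 0.
Proof. by rewrite -cls0; exact: test_class_cls. Qed.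

Lemma test_classD f g : test_class f -> test_class g -> test_class (f + g).
Proof.
move=> [u [v [hu [hv ->]]]] [u' [v' [hu' [hv' ->]]]].
exists (u + u'), (v + v'), (tfD hu hu'), (tfD hv hv').
by rewrite -!clsD scalerDr addrACA.
Qed.

Lemma test_classZ a f : test_class f -> test_class (a *: f).
Proof.
move=> [u [v [hu [hv ->]]]]; case: a => a b.
exists (a \*: u + (- b) \*: v), (a \*: v + b \*: u),
  (tfD (tfZ a hu) (tfZ (- b) hv)), (tfD (tfZ a hv) (tfZ b hu)).
rewrite -!clsD -!clsZ !scalerDr !scalerA.
rewrite [X in _ = _ + X]addrC addrACA -!scalerDl.
by congr (_ *: _ + _ *: _); simpc.
Qed.

Lemma test_class_dense k e : 0 < e -> exists2 m, test_class m & nrm (k - m) <= e.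
Proof.
apply: (dense_of_orthogonal (L2_hilbert mu) test_class0 test_classD test_classZ).
by move=> {e}k hk; apply: cls_perp => u hu; apply: hk; exact: test_class_cls.
Qed.

End test_dense.

(** * Sobolev regularity as a Lipschitz condition *)

Section weak_derivative.
Context {R : realType} {d : nat}.
Local Notation Rd := 'cV[R]_d.
Local Notation mu := (@lebesgue_cV R d).
Local Notation L2 := (L2Rd R d).
Local Notation tf := (@test_function R d).
Local Notation ip := (@ip _ _ _ mu).
Local Notation nrm := (nrm ip).
Local Notation hip := (L2_hilbert mu).

Variable j : 'I_d.

Lemma ip_clsr u (hu : tf u) (f : L2) :
  ip f (cls hu) = cintegral mu (fun x => f x * (u x)%:C).
Proof.
rewrite /ip (inner_ae (sqi_L2 f) (sqi_L2 f) (sqi_L2 _) (tf_sqi hu) _ (cls_ae hu)); last exact: aeW.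
by rewrite innerE; congr cintegral; apply/funext => x; rewrite conjcR.
Qed.

Lemma weak_partialP (f h : L2) : weak_partial j f h <->
  forall u (hu : tf u), ip f (cls (tf_partial j hu)) = - ip h (cls hu).
Proof.
split=> [w u hu|w u hu]; first by rewrite !ip_clsr; exact: w.
by have := w u hu; rewrite !ip_clsr.
Qed.

(** [test_pair m w] records w as the value at m of the translation generator. A relation is used
    because a class in [test_class] comes without a choice of u and v. *)
Inductive test_pair : L2 -> L2 -> Prop :=
  TestPair u v (hu : tf u) (hv : tf v) : test_pair (cls hu + 'i%C *: cls hv)
    (- cls (tf_partial j hu) + 'i%C *: - cls (tf_partial j hv)).

Lemma test_pair_exists m : test_class m -> exists w, test_pair m w.
Proof. by move=> [u [v [hu [hv ->]]]]; eexists; exact: TestPair. Qed.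

Local Notation T := (fun t => U (tv j t)).

Lemma test_pair_gen m w : test_pair m w -> gen ip T m w.
Proof.
case=> u v hu hv; have Tl t := U_lin (tv j t : 'cV[R]_(d + d)).
apply: (genD hip Tl); first exact: tf_gen.
by apply: (genZ hip Tl); exact: tf_gen.
Qed.

Lemma test_pairT t m w : test_pair m w -> test_pair (T t m) (T t w).
Proof.
case=> u v hu hv.
have TE (u' : Rd -> R) (hu' : tf u') : T t (cls hu') = cls (tf_shift (- (t *: delta_mx j 0)) hu') /\
    T t (- cls (tf_partial j hu')) = - cls (tf_partial j (tf_shift (- (t *: delta_mx j 0)) hu')).
  split; first exact: U_tv_cls.
  rewrite -scaleN1r (U_lin _).2 scaleN1r; congr (- _); rewrite U_tv_cls.
  apply: L2P; apply: filterS2 (cls_ae (tf_shift (- (t *: delta_mx j 0)) (tf_partial j hu')))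
    (cls_ae (tf_partial j (tf_shift (- (t *: delta_mx j 0)) hu'))) => x -> ->.
  by rewrite partial_shift.
rewrite !(U_lin _).1 !(U_lin _).2 (TE u hu).1 (TE v hv).1 (TE u hu).2 (TE v hv).2.
exact: TestPair.
Qed.

Lemma weak_partial_pair (f h : L2) m w : weak_partial j f h -> test_pair m w ->
  ip f w = ip h m.
Proof.
move=> /weak_partialP fh [u v hu hv].
by rewrite !(ipDr hip) !(ipZr hip) !(ipNr hip) !fh !opprK.
Qed.

(** Against a test element m the difference moves to [ip f (T (- t) m - m)]. The rate of change of
    [ip f (T s m)] is [ip f (T s w)], which equals [ip h (T s m)] and so is at most [nrm h * nrm m].
    Density of the test elements then bounds the norm. *)
Lemma weak_partial_lip (f h : L2) t : weak_partial j f h ->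
  nrm (U (tv j t) f - f) <= nrm h * `|t|.
Proof.
move=> fh; set x := _ - f; set M := nrm h * `|t|.
have M0 : 0 <= M by rewrite mulr_ge0 ?nrm_ge0.
apply: (nrm_le_ip hip) => // y; rewrite -subr_le0.
apply: (@dense_le _ _ _ test_class (fun y => normc (ip x y) - M * nrm y) (nrm x + M) 0).
- exact: test_class_dense.
- by rewrite addr_ge0 ?nrm_ge0.
- move=> a b; have -> : ip x a = ip x b + ip x (a - b) by rewrite -(ipDr hip) addrC subrK.
  have h1 := le_normcD (ip x b) (ip x (a - b)).
  have h2 := CS hip x (a - b).
  have h3 : M * nrm b <= M * (nrm a + nrm (a - b)).
    by rewrite ler_wpM2l// -{1}[b](subKr a) (le_trans (nrmB hip _ _)).
  lra.
move=> m /test_pair_exists[w mw]; rewrite subr_le0.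
have Tl s := U_lin (tv j s : 'cV[R]_(d + d)).
have Ti s := @U_iso R d (tv j s).
rewrite /x (ipBl hip) (ipT (T := T) Ti (U_tv0 j) (U_tvD j)) -(ipBr hip) -normcJ -(ipC hip).
rewrite /M mulrAC -(normrN t).
apply: (@gen_increment _ _ _ hip T Tl Ti (U_tv0 j) (U_tvD j) m w f (nrm h * nrm m) (- t) (test_pair_gen mw)) => s.
rewrite -normcJ -(ipC hip) (weak_partial_pair fh (test_pairT s mw)).
by apply: le_trans (CS hip _ _) _; rewrite /nrm Ti.
Qed.

Lemma lip_weak_partial (f : L2) K : (forall t, nrm (U (tv j t) f - f) <= K * `|t|) ->
  exists h, weak_partial j f h.
Proof.
move=> fK; have Tl s := U_lin (tv j s : 'cV[R]_(d + d)).
have Ti s := @U_iso R d (tv j s).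
have [|h hh] := @lip_weak_derivative _ _ _ hip T Tl Ti (U_tv0 j) (U_tvD j) test_class f K
  test_class0 test_classD test_classZ _ fK.
  by move=> m /test_pair_exists[w /test_pair_gen]; exists w.
exists h; apply/weak_partialP => u hu.
have := hh _ _ (test_class_cls hu) (tf_gen hu j).
by rewrite (ipNl hip) => e; rewrite (ipC hip) [in RHS](ipC hip) -e rmorphN opprK.
Qed.

End weak_derivative.

Lemma H1P (R : realType) (d : nat) (f : L2Rd R d) : H1 f <->
  exists K, forall j t, nrm (@ip _ _ _ (@lebesgue_cV R d)) (U (tv j t) f - f) <= K * `|t|.
Proof.
split=> [/choice[h fh]|[K fK] j]; last exact: lip_weak_partial (fK j).
exists (\sum_j nrm (@ip _ _ _ (@lebesgue_cV R d)) (h j)) => j t.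
apply: le_trans (weak_partial_lip t (fh j)) _; rewrite ler_wpM2r// (bigD1 j)//= lerDl.
by apply: sumr_ge0 => i _; exact: nrm_ge0.
Qed.

(** * Test functions are Bessel vectors *)

Section schur.
Variables (R : realType) (V : lmodType R[i]) (ip : V -> V -> R[i]).
Hypothesis hip : is_hilbert ip.
Variables (W : zmodType) (U : W -> V -> V).
Hypothesis Ulin : forall a, lin (U a).
Hypothesis Uiso : forall a x y, ip (U a x) (U a y) = ip x y.
Hypothesis U0 : forall x, U 0 x = x.
Hypothesis UM : forall a b, exists2 c, normc c = 1 &
  forall x, U a (U b x) = c *: U (a + b) x.
Variable L : set W.
Hypothesis LB : forall a b, L a -> L b -> L (a - b).

(** The Gram matrix has entries of modulus [v (l - m)], so its row and column sums are at most K,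
    and [2 |c l| |c m| <= |c l|^2 + |c m|^2] bounds its quadratic form by K. *)
Lemma bes_of_summable (p : V) (K : R) : 0 <= K ->
  (forall s, seq_in L s -> \sum_(l <- s) normc (ip (U l p) p) <= K) ->
  bes ip U L p (Num.sqrt K).
Proof.
move=> K0 hK; pose v l := normc (ip (U l p) p).
have v0 l : 0 <= v l by exact: normc_ge0.
have gram l m : normc (ip (U l p) (U m p)) = v (l - m).
  have [c c1 hc] := UM (- m) l; have [c' c1' hc'] := UM (- m) m.
  rewrite -(Uiso (- m)) hc hc' addNr U0 (ipZl hip) (ipZr hip) !normcM normcJ c1 c1' !mul1r.
  by rewrite addrC.
have vsym l m : v (l - m) = v (m - l) by rewrite -!gram (ipC hip) normcJ.
apply/(bes_synth hip); rewrite ?sqrtr_ge0// => s c ss c1.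
rewrite -(@ler_pXn2r _ 2)// ?nnegrE ?nrm_ge0 ?sqrtr_ge0// (sqr_nrm hip) sqr_sqrtr//.
apply: le_trans (ler_norm _) _; apply: le_trans (Re_le_normc _) _.
rewrite (ip_suml hip); apply: le_trans (sum_normc_le _ _) _.
have row l : l \in s -> \sum_(m <- s) v (l - m) <= K.
  move=> ls; rewrite -(big_map (fun m => l - m) xpredT v); apply: hK; split.
    by rewrite map_inj_uniq; [exact: ss.1|move=> x y /addrI/oppr_inj].
  by move=> _ /mapP[m ms ->]; apply: LB; exact: ss.2.
have term l : normc (ip (c l *: U l p) (\sum_(i <- s) c i *: U i p)) <=
    \sum_(m <- s) (2^-1 * normc (c l) ^+ 2 * v (l - m) + 2^-1 * normc (c m) ^+ 2 * v (l - m)).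
  rewrite (ip_sumr hip); apply: le_trans (sum_normc_le _ _) _; apply: ler_sum => m _.
  rewrite (ipZl hip) (ipZr hip) !normcM normcJ gram -mulrDl mulrA ler_wpM2r//.
  have := sqr_ge0 (normc (c l) - normc (c m)); nra.
apply: le_trans (ler_sum _ (fun l _ => term l)) _.
under eq_bigr do rewrite big_split /=; rewrite big_split /= [X in _ + X]exchange_big /=.
have half (f : W -> W -> R) : (forall l, l \in s -> \sum_(m <- s) f l m <= K) ->
    \sum_(l <- s) \sum_(m <- s) 2^-1 * normc (c l) ^+ 2 * f l m <= 2^-1 * K.
  move=> fK; apply: (@le_trans _ _ (\sum_(l <- s) 2^-1 * normc (c l) ^+ 2 * K)).
    rewrite !big_seq; apply: ler_sum => l ls.
    by rewrite -mulr_sumr ler_wpM2l ?fK// mulr_ge0 ?invr_ge0 ?sqr_ge0.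
  by rewrite -mulr_suml -mulr_sumr ler_wpM2r// ler_piMr ?invr_ge0.
have h1 := half _ row.
have h2 := half (fun l m => v (m - l)).
apply: (@le_trans _ _ (2^-1 * K + 2^-1 * K)); last by lra.
apply: lerD => //; apply: h2 => l ls; under eq_bigr do rewrite vsym; exact: row.
Qed.

End schur.

(** * Decay of correlations under modulation *)

Section anticommuting_decay.
Variables (R : realType) (V : lmodType R[i]) (ip : V -> V -> R[i]).
Hypothesis hip : is_hilbert ip.
Local Notation nrm := (nrm ip).
Variables S U : V -> V.
Hypothesis Slin : lin S.
Hypothesis Siso : forall x y, ip (S x) (S y) = ip x y.
Hypothesis Ulin : lin U.
Hypothesis Uiso : forall x y, ip (U x) (U y) = ip x y.
Hypothesis anticomm : forall x, S (U x) = - U (S x).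

Let D x := x - S x.

Let iterDS k x : iter k D (S x) = S (iter k D x).
Proof. by elim: k => //= k ->; rewrite /D (linB _ _ Slin). Qed.

(** Anticommutation and isometry give [ip (U u) v = - ip (U (S u)) (S v)], hence [2 ip (U u) v = ip
    (U (D u)) v + ip (U (S u)) (D v)]. Each of the two terms contains one difference and so gains a
    factor r. *)
Lemma anticommuting_decay N (r C C' : R) u v : 0 <= r -> 0 <= C -> 0 <= C' ->
  (forall k, (k <= N)%N -> nrm (iter k D u) <= C * r ^+ k) ->
  (forall k, (k <= N)%N -> nrm (iter k D v) <= C' * r ^+ k) ->
  normc (ip (U u) v) <= C * C' * r ^+ N.
Proof.
move=> r0; elim: N C C' u v => [|N IH] C C' u v C0 C0' hu hv.
  rewrite expr0 mulr1; apply: le_trans (CS hip _ _) _.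
  have := hu 0%N isT; have := hv 0%N isT; rewrite /= !expr0 !mulr1 => h1 h2.
  by apply: ler_pM => //; rewrite ?nrm_ge0// /nrm Uiso.
have e : ip (U u) v = 2^-1%:C * (ip (U (D u)) v + ip (U (S u)) (D v)).
  have e1 : ip (U u) v = - ip (U (S u)) (S v) by rewrite -(ipNl hip) -anticomm Siso.
  rewrite /D (linB _ _ Ulin) (ipBl hip) (ipBr hip) addrA subrK -e1 mulrDr -mulrDl -rmorphD.
  by rewrite (_ : 2^-1 + 2^-1 = 1) ?mul1r//; lra.
rewrite e normcM normc_real ger0_norm ?invr_ge0// mulrC ler_pdivrMr//.
apply: le_trans (le_normcD _ _) _.
have -> : C * C' * r ^+ N.+1 * 2 = (C * r) * C' * r ^+ N + C * (C' * r) * r ^+ N.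
  by rewrite exprS; ring.
apply: lerD; apply: IH => //; rewrite ?mulr_ge0// => k kN.
- by have := hu k.+1 kN; rewrite iterSr -mulrA -exprS.
- exact: hv (leqW kN).
- by rewrite iterDS /nrm Siso; exact: hu (leqW kN).
- by have := hv k.+1 kN; rewrite iterSr -mulrA -exprS.
Qed.

End anticommuting_decay.

Section generator_differences.
Variables (R : realType) (V : lmodType R[i]) (ip : V -> V -> R[i]).
Hypothesis hip : is_hilbert ip.
Local Notation nrm := (nrm ip).
Variable T : R -> V -> V.
Hypothesis Tlin : forall t, lin (T t).
Hypothesis Tiso : forall t x y, ip (T t x) (T t y) = ip x y.
Hypothesis T0 : forall x, T 0 x = x.
Hypothesis TD : forall s t x, T (s + t) x = T s (T t x).

Let D s x := x - T s x.

Lemma gen_difference k s u w : gen ip T u w -> gen ip T (iter k (D s) u) (iter k (D s) w).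
Proof.
have e x : D s x = x + (-1) *: T s x by rewrite scaleN1r.
move=> h; elim: k => //= k IH; rewrite !e.
apply: (genD hip Tlin) => //; apply: (genZ hip Tlin).
exact: (genT Tlin Tiso TD).
Qed.

(** Iterated differences commute with the generator, so each further difference costs a factor [|s|]
    and replaces u by its generator value, which stays in M. *)
Lemma difference_bound (M : set V) : (forall u, M u -> exists2 w, M w & gen ip T u w) ->
  forall k u, M u -> exists2 C, 0 <= C & forall s, nrm (iter k (D s) u) <= C * `|s| ^+ k.
Proof.
move=> Mgen; elim=> [|k IH] u Mu.
  by exists (nrm u); rewrite ?nrm_ge0// => s; rewrite expr0 mulr1.
have [w Mw uw] := Mgen _ Mu; have [C C0 hC] := IH _ Mw; exists C => // s.
rewrite exprSr mulrA iterS /D (nrmBC hip).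
apply: le_trans (gen_lip hip Tlin Tiso T0 TD _ (gen_difference k s uw)) _.
by rewrite ler_wpM2r.
Qed.

Lemma difference_bounds (M : set V) : (forall u, M u -> exists2 w, M w & gen ip T u w) ->
  forall N u, M u -> exists2 C, 0 <= C & forall s k, (k <= N)%N ->
    nrm (iter k (D s) u) <= C * `|s| ^+ k.
Proof.
move=> Mgen N u Mu; elim: N => [|N [C C0 hC]].
  by exists (nrm u) => [|s k]; rewrite ?nrm_ge0// leqn0 => /eqP->; rewrite expr0 mulr1.
have [C' C0' hC'] := difference_bound Mgen N.+1 Mu; exists (C + C'); first exact: addr_ge0.
move=> s k; rewrite leq_eqVlt => /orP[/eqP->|/hC h].
  by apply: le_trans (hC' s) _; rewrite ler_wpM2r ?exprn_ge0// lerDr.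
by apply: le_trans (h s) _; rewrite ler_wpM2r ?exprn_ge0// lerDl.
Qed.

End generator_differences.

(** * Summable weights on integer vectors *)

Section lattice_sums.
Variable R : realType.

Lemma sum_inv_1_sqr m : \sum_(j < m) (1 + j%:R ^+ 2 : R)^-1 <= 3.
Proof.
suff : \sum_(j < m) (1 + j%:R ^+ 2 : R)^-1 <= 3 - 3 / m.+1%:R.
  by move=> /le_trans; apply; rewrite gerBl divr_ge0.
elim: m => [|m IH]; first by rewrite big_ord0 divr1 subrr.
rewrite big_ord_recr /=; apply: le_trans (lerD IH (lexx _)) _.
have m0 : 0 <= m%:R :> R by [].
rewrite -!(natr1 m) -(natr1 m.+1) -(natr1 m); set x : R := m%:R in m0 *.
have x1 : 0 < x + 1 by lra. have x2 : 0 < x + 1 + 1 by lra.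
have x3 : 0 < 1 + x ^+ 2 by nra.
(* This amounts to [(2 x - 1) (x - 1) >= 0], which fails between 1/2 and 1: it matters that x is a
   natural number. *)
have x4 : (x + 1) * (x + 1 + 1) <= 3 * (1 + x ^+ 2).
  rewrite /x {x m0 x1 x2 x3 IH}; case: m => [|[|m]]; rewrite ?mulr0n ?mulr1n; try lra.
  have h : 2 <= m.+2%:R :> R by rewrite ler_nat.
  nra.
have -> : 3 - 3 / (x + 1) + (1 + x ^+ 2)^-1 = 3 - 3 / (x + 1 + 1) -
    (3 * (1 + x ^+ 2) - (x + 1) * (x + 1 + 1)) / ((1 + x ^+ 2) * ((x + 1) * (x + 1 + 1))).
  by field; rewrite !gt_eqF.
by rewrite gerBl divr_ge0 ?subr_ge0// ltW ?mulr_gt0.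
Qed.

(** Coordinates are encoded by absolute value and sign, and over all functions into this finite set
    the sum of products is a product of sums. The sign doubles the one-variable bound 3, whence
    6. *)
Lemma sum_prod_inv_1_sqr n (s : seq 'cV[int]_n) : uniq s ->
  \sum_(z <- s) \prod_i (1 + (z i 0)%:~R ^+ 2 : R)^-1 <= 6 ^+ n.
Proof.
move=> us; pose m := (\max_(z <- s) \max_i absz (z i 0%R))%N.
have sm z i : z \in s -> (absz (z i 0%R) <= m)%N.
  move=> zs; rewrite /m (big_rem z)//= leq_max; apply/orP; left.
  exact: (@leq_bigmax _ (fun i => absz (z i 0%R))).
pose J := ('I_m.+1 * bool)%type.
pose F (p : J) : R := (1 + (p.1 : nat)%:R ^+ 2)^-1.
have F0 p : 0 <= F p by rewrite invr_ge0 addr_ge0// sqr_ge0.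
pose enc (z : 'cV[int]_n) : {ffun 'I_n -> J} := [ffun i => (inord (absz (z i 0%R)), z i 0 < 0)].
have encE z : z \in s -> \prod_i (1 + (z i 0)%:~R ^+ 2 : R)^-1 = \prod_i F (enc z i).
  move=> zs; apply: eq_bigr => i _; rewrite ffunE /F /= inordK ?ltnS ?sm//.
  by rewrite -[(absz _)%:R]/((Posz (absz _))%:~R) abszE intr_norm real_normK ?num_real.
have enc_inj : {in s &, injective enc}.
  move=> y z ys zs /ffunP e; apply/colP => i; have := e i.
  rewrite !ffunE => -[/(congr1 val)]; rewrite /= !inordK ?ltnS ?sm// => h1 h2.
  by move: h1 h2; case: (y i 0) => p; case: (z i 0) => q //= [->].
rewrite big_seq (eq_bigr _ encE) -big_seq -(big_map enc xpredT (fun f => \prod_i F (f i))).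
rewrite big_uniq; last by rewrite map_inj_in_uniq.
apply: (@le_trans _ _ (\sum_(f : {ffun 'I_n -> J}) \prod_i F (f i))).
  rewrite [leRHS](bigID (mem (map enc s)))/= lerDl; apply: sumr_ge0 => f _.
  by apply: prodr_ge0 => i _.
rewrite -(bigA_distr_bigA (fun _ : 'I_n => F)) prodr_const card_ord.
rewrite lerXn2r ?nnegrE ?sumr_ge0//.
rewrite -(pair_big xpredT xpredT (fun j b => F (j, b)))/=.
under eq_bigr do rewrite big_bool /= -mulr2n -mulr_natl.
by rewrite -mulr_sumr; have := sum_inv_1_sqr m.+1; rewrite /F /=; lra.
Qed.

End lattice_sums.

Section bessel_test_functions.
Context {R : realType} {d : nat}.
Local Notation mu := (@lebesgue_cV R d).
Local Notation L2 := (L2Rd R d).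
Local Notation tf := (@test_function R d).
Local Notation ip := (@ip _ _ _ mu).
Local Notation nrm := (nrm ip).
Local Notation hip := (L2_hilbert mu).

Lemma expiNpi (t : R) : expi (t - pi) = - expi t.
Proof. by rewrite /expi cosB sinB cospi sinpi; apply: complexP => /=; ring. Qed.

(* The half-period translation flips the sign of the modulation. *)
Lemma U_anticommute (l : 'cV[R]_(d + d)) j (f : L2) : dsubmx l j 0 != 0 ->
  U (tv j (2 * dsubmx l j 0)^-1) (U l f) = - U l (U (tv j (2 * dsubmx l j 0)^-1) f).
Proof.
move=> b0; set s := _^-1; rewrite -scaleN1r; apply: L2P.
have ae0 : {ae mu, forall x, f x = f x} by apply: aeW.
apply: filterS3 (U_tv_ae j s (U_ae l f)) (L2_aeZ (-1) (U l (U (tv j s) f)))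
  (U_ae_of l (U_tv_ae j s ae0)) => x -> -> ->.
rewrite [x - s *: _ - _]addrAC mulrA mulN1r; congr (_ * _).
rewrite /wave [x - s *: _ - _]addrAC [dot _ (x - _ - _)]dotDr [dot _ (- (s *: _))]dotNr.
have -> : dot (dsubmx l) (s *: delta_mx j 0) = 2^-1.
  rewrite /dot (bigD1 j)//= big1 ?addr0; last first.
    by move=> i ij; rewrite !mxE (negbTE ij) !mulr0.
  by rewrite !mxE !eqxx mulr1 /s mxE invfM mulrCA divff ?mulr1//; move: b0; rewrite mxE.
rewrite -expiNpi; congr expi; rewrite mulrBr; congr (_ - _).
by rewrite mulrAC mulfV ?mul1r.
Qed.

(** The half-period [s = 1 / (2 b)] anticommutes with the modulation, and N differences produce
    [|s| ^+ N], which absorbs [|b| ^+ N]. *)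
Lemma decay_frequency N u (hu : tf u) (j : 'I_d) : exists2 C, 0 <= C &
  forall l, dsubmx l j 0 != 0 ->
    `|dsubmx l j 0| ^+ N * normc (ip (U l (cls hu)) (cls hu)) <= C.
Proof.
have Tl s := U_lin (tv j s : 'cV[R]_(d + d)).
have Ti s := @U_iso R d (tv j s).
pose M := [set f : L2 | exists v (hv : tf v), f = cls hv \/ f = - cls hv]%classic.
(* M contains negatives because the generator takes a test function to minus its partial
   derivative. *)
have Mgen f : M f -> exists2 w, M w & gen ip (fun t => U (tv j t)) f w.
  move=> [v [hv [->|->]]].
    by exists (- cls (tf_partial j hv)); [exists (partial j v), (tf_partial j hv); right|exact: tf_gen].
  exists (cls (tf_partial j hv)); first by exists (partial j v), (tf_partial j hv); left.
  by have := genZ hip Tl (-1) (tf_gen hv j); rewrite !scaleN1r opprK.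
have Mu : M (cls hu) by exists u, hu; left.
have [C C0 hC] := difference_bounds hip Tl Ti (U_tv0 j) (U_tvD j) Mgen N Mu.
exists (C ^+ 2); first exact: sqr_ge0.
move=> l b0; set b := dsubmx l j 0 in b0 *; pose s := (2 * b)^-1.
have anti f := @U_anticommute l j f b0.
have := anticommuting_decay hip (Tl s) (Ti s) (U_lin l) (@U_iso R d l) anti (normr_ge0 s) C0 C0
  (hC s) (hC s).
rewrite -expr2 => h; apply: le_trans (ler_wpM2l _ h) _; first exact: exprn_ge0.
rewrite mulrCA -exprMn -normrM /s invfM mulrCA mulfV// mulr1 ler_piMr ?sqr_ge0//.
by rewrite exprn_ile1// ger0_norm ?invr_ge0// invf_le1// ler1n.
Qed.

(** Supports in a box of size K are separated once a coordinate is shifted by more than [2 * K]. *)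
Lemma correlation_support u (hu : tf u) : exists K, forall l j, K < `|usubmx l j 0| ->
  ip (U l (cls hu)) (cls hu) = 0.
Proof.
have [K hK] := tf_support hu; exists (2 * K) => l j Kl.
rewrite /ip innerE; set g := (fun x => _).
have -> : cintegral mu g = cintegral mu (fun=> 0 : R[i]).
  apply: cintegral_ae.
  - by apply: cmeasurable_mulJ; apply: sqi_measurable; exact: sqi_L2.
  - by split; exact: measurable_cst.
  - apply: filterS2 (U_ae_of l (cls_ae hu)) (cls_ae hu) => x; rewrite /g => -> ->.
    have [->|/hK/(_ j) h1] := eqVneq (u x) 0; first by rewrite conjcR mulr0.
    have [->|/hK/(_ j) h2] := eqVneq (u (x - usubmx l)) 0; first by rewrite mulr0 mul0r.
    exfalso; move: Kl; apply/negP; rewrite -leNgt.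
    have -> : usubmx l j 0 = x j 0 - (x - usubmx l) j 0 by rewrite !mxE; ring.
    by apply: le_trans (ler_normB _ _) _; lra.
by rewrite /cintegral /= !Rintegral_cst//= !mul0r.
Qed.

Lemma decay N u (hu : tf u) : (0 < N)%N -> exists2 C, 0 <= C &
  forall (l : 'cV[R]_(d + d)) i, `|l i 0| ^+ N * normc (ip (U l (cls hu)) (cls hu)) <= C.
Proof.
move=> N0; pose v (l : 'cV[R]_(d + d)) := normc (ip (U l (cls hu)) (cls hu)).
have v0 l : 0 <= v l by exact: normc_ge0.
have /choice[C hC] : forall j, exists C : R, 0 <= C /\ forall l, dsubmx l j 0 != 0 ->
    `|dsubmx l j 0| ^+ N * v l <= C.
  by move=> j; have [C C0 hC] := decay_frequency N hu j; exists C.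
have [K hK] := correlation_support hu.
have C0 j : 0 <= C j := (hC j).1.
have C'0 : 0 <= \sum_j C j by apply: sumr_ge0 => j _; exact: C0.
have K'0 : 0 <= `|K| ^+ N * nrm (cls hu) ^+ 2 by rewrite mulr_ge0 ?sqr_ge0 ?exprn_ge0.
exists (`|K| ^+ N * nrm (cls hu) ^+ 2 + \sum_j C j); first exact: addr_ge0.
move=> l i; rewrite -[l]vsubmxK; case: (split_ordP i) => j ->.
  rewrite col_mxEu vsubmxK ler_wpDr//.
  have [lK|lK] := leP `|usubmx l j 0| K; last first.
    by rewrite /v (hK l j lK) normc0 mulr0.
  apply: ler_pM; [exact: exprn_ge0|exact: v0| |].
    by rewrite lerXn2r ?nnegrE// (le_trans lK)// ler_norm.
  by apply: le_trans (CS hip _ _) _; rewrite expr2 /nrm U_iso.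
rewrite col_mxEd vsubmxK ler_wpDl//.
have h : C j <= \sum_j C j.
  by rewrite (bigD1 j)//= lerDl sumr_ge0.
(* At frequency 0 no half-period exists, but [0 ^+ N] vanishes because N is positive. *)
have [->|b0] := eqVneq (dsubmx l j 0) 0.
  by rewrite normr0 expr0n gtn_eqF// mul0r.
by apply: le_trans h; exact: (hC j).2.
Qed.

(** Decay of order [2 * n] in the largest coordinate, for n coordinates, is enough to dominate the
    product of the weights [1 / (1 + z_i^2)], whose sum is bounded. *)
Lemma bessel_summable (A : 'M[R]_(d + d)) u (hu : tf u) : A \in unitmx ->
  exists2 K, 0 <= K & forall s : seq 'cV[int]_(d + d), uniq s ->
    \sum_(z <- s) normc (ip (U (A *m map_mx intr z) (cls hu)) (cls hu)) <= K.
Proof.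
move=> uA; pose v (l : 'cV[R]_(d + d)) := normc (ip (U l (cls hu)) (cls hu)).
have v0 l : 0 <= v l by exact: normc_ge0.
pose n := (d + d)%N.
(* In dimension 0 there is no largest coordinate, but only one integer vector. *)
have [n0|n0] := posnP n.
  exists (v (A *m map_mx intr 0)) => // s us.
  have z0 (z : 'cV[int]_(d + d)) : z = 0
    by apply/matrixP => i; have : (i < n)%N := ltn_ord i; rewrite n0.
  case: s us => [|z [|z' s]] us; rewrite ?big_nil// ?big_seq1 ?(z0 z)//.
  by move: us; rewrite /= (z0 z) (z0 z') inE eqxx.
have [C C0 hC] := @decay (2 * n)%N u hu ltac:(by rewrite muln_gt0).
(* This bounds the inverse of A in the maximum norm and carries the decay from [A *m z] over to
   z. *)
pose a := 1 + \sum_i \sum_j `|invmx A i j|.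
have a1 : 1 <= a by rewrite lerDl; apply: sumr_ge0 => i _; exact: sumr_ge0.
pose B := nrm (cls hu) ^+ 2 + a ^+ (2 * n) * C.
have vB l : v l <= nrm (cls hu) ^+ 2.
  by apply: le_trans (CS hip _ _) _; rewrite expr2 /nrm U_iso.
have a0 : 0 <= a ^+ (2 * n) * C by rewrite mulr_ge0// exprn_ge0// (le_trans ler01).
have B0 : 0 <= B by rewrite addr_ge0 ?sqr_ge0.
have hz (z : 'cV[int]_(d + d)) i : `|(z i 0)%:~R : R| ^+ (2 * n) * v (A *m map_mx intr z) <= a ^+ (2 * n) * C.
  set l := A *m map_mx intr z.
  pose k : 'I_(d + d) := [arg max_(j > Ordinal n0) `|l j 0|]%O.
  have kmax j : `|l j 0| <= `|l k 0|.
    by rewrite /k; case: Order.TotalTheory.arg_maxP => // m _ h; exact: h.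
  have -> : (z i 0)%:~R = (invmx A *m l) i 0 :> R by rewrite /l mulKmx// mxE.
  apply: (@le_trans _ _ ((a * `|l k 0|) ^+ (2 * n) * v l)); last first.
    by rewrite exprMn -mulrA ler_wpM2l// exprn_ge0// (le_trans ler01).
  rewrite ler_wpM2r// lerXn2r ?nnegrE ?mulr_ge0// ?(le_trans ler01)//.
  rewrite mxE; apply: le_trans (ler_norm_sum _ _ _) _.
  apply: (@le_trans _ _ (\sum_j `|invmx A i j| * `|l k 0|)).
    by apply: ler_sum => j _; rewrite normrM ler_wpM2l.
  rewrite -mulr_suml ler_wpM2r// /a [X in 1 + X](bigD1 i)//= ler_wpDl// lerDl.
  by apply: sumr_ge0 => i' _; exact: sumr_ge0.
have hw (z : 'cV[int]_(d + d)) : v (A *m map_mx intr z) <= 2 ^+ n * B * \prod_i (1 + (z i 0)%:~R ^+ 2)^-1.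
  pose k : 'I_(d + d) := [arg max_(j > Ordinal n0) `|(z j 0)%:~R : R|]%O.
  have kmax j : `|(z j 0)%:~R : R| <= `|(z k 0)%:~R|.
    by rewrite /k; case: Order.TotalTheory.arg_maxP => // m _ h; exact: h.
  rewrite prodfV ler_pdivlMr; last by apply: prodr_gt0 => i _; rewrite ltr_pwDl// sqr_ge0.
  set x : R := (z k 0)%:~R in kmax.
  have p1 : \prod_i (1 + (z i 0)%:~R ^+ 2 : R) <= (1 + x ^+ 2) ^+ n.
    rewrite -[n in leRHS]card_ord -prodr_const; apply: ler_prod => i _.
    rewrite addr_ge0 ?sqr_ge0//= lerD2l -real_normK ?num_real// -[x ^+ 2]real_normK ?num_real//.
    by rewrite lerXn2r ?nnegrE.
  (* [1 + x^2] is at most 2 or at most [2 x^2], according to the size of x. *)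
  have p2 : (1 + x ^+ 2) ^+ n <= 2 ^+ n * (1 + `|x| ^+ (2 * n)).
    have [x1|x1] := leP (`|x|) 1.
      apply: (@le_trans _ _ (2 ^+ n)); last by rewrite ler_peMr ?exprn_ge0// lerDl exprn_ge0.
      rewrite lerXn2r ?nnegrE ?addr_ge0 ?sqr_ge0//.
      have xx : x ^+ 2 <= 1 by rewrite -real_normK ?num_real// exprn_ile1.
      lra.
    have x2 : 1 + x ^+ 2 <= 2 * `|x| ^+ 2.
      have : 1 <= `|x| ^+ 2 by rewrite exprn_ege1// ltW.
      by rewrite real_normK ?num_real//; lra.
    apply: (@le_trans _ _ ((2 * `|x| ^+ 2) ^+ n)).
      by rewrite lerXn2r ?nnegrE ?addr_ge0 ?sqr_ge0// mulr_ge0 ?sqr_ge0.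
    by rewrite exprMn ler_wpM2l ?exprn_ge0// -exprM lerDr.
  apply: le_trans (ler_wpM2l (v0 _) (le_trans p1 p2)) _.
  rewrite mulrCA ler_wpM2l ?exprn_ge0// mulrDr mulr1 /B; apply: lerD; first exact: vB.
  by rewrite mulrC; exact: hz.
exists (2 ^+ n * B * 6 ^+ n); first by rewrite !mulr_ge0 ?exprn_ge0.
move=> s us; apply: le_trans (ler_sum _ (fun z _ => hw z)) _.
by rewrite -mulr_sumr ler_wpM2l ?mulr_ge0 ?exprn_ge0//; exact: sum_prod_inv_1_sqr.
Qed.

Lemma bes_test (L : set 'cV[R]_(d + d)) u (hu : tf u) : is_lattice L ->
  exists M, bes ip U L (cls hu) M.
Proof.
move=> [A uA ->]; have [K K0 hK] := bessel_summable hu uA.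
exists (Num.sqrt K); apply: (bes_of_summable hip) => //.
- exact: U_iso.
- exact: U_0.
- exact: U_mul.
- move=> _ _ [y _ <-] [z _ <-]; exists (y - z) => //.
  by rewrite -mulmxBr map_mxB.
move=> s [us hs].
(* A section over s of the map from integer vectors to lattice points; as a section it is injective
   on s. *)
have /choice[zf hzf] : forall l, exists z : 'cV[int]_(d + d), l \in s -> A *m map_mx intr z = l.
  move=> l; have [/hs[z _ <-]|ls] := boolP (l \in s); first by exists z.
  by exists 0.
have uz : uniq (map zf s).
  rewrite map_inj_in_uniq// => x y xs ys e.
  by rewrite -(hzf x xs) -(hzf y ys) e.
apply: le_trans (hK _ uz); rewrite big_map le_eqVlt; apply/orP; left; apply/eqP.
by apply: eq_big_seq => l ls; rewrite hzf.
Qed.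

End bessel_test_functions.

(** * The spectrum of the frame operator *)

Section l2_norms.

Lemma l2normP (R : realType) (I : choiceType) (D : set I) (u : I -> R[i]) (c : R) :
  0 <= c -> (l2norm D u <= c%:E)%E <-> l2bound D u c.
Proof.
move=> c0; set X := (\esum_(i in D) (normc (u i) ^+ 2)%:E)%E.
have X0 : (0 <= X)%E by apply: esum_ge0 => i _; rewrite lee_fin sqr_ge0.
have -> : l2norm D u = sqrte X by rewrite -poweR12_sqrt.
split=> [Xc s ss|uc].
  rewrite -lee_fin; apply: le_trans (seq_le_esum _ ss) _; rewrite -/X.
  move: X X0 Xc => [r|//|//]; rewrite /sqrte !lee_fin => r0 rc.
  by rewrite -(sqr_sqrtr r0) lerXn2r ?nnegrE ?sqrtr_ge0.
have : (X <= (c ^+ 2)%:E)%E by apply: esum_seq_le => s ss; exact: uc.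
move: X X0 => [r|//|//]; rewrite /sqrte !lee_fin => r0 rc.
by rewrite -(ger0_norm c0) -sqrtr_sqr ler_sqrt// sqr_ge0.
Qed.

Variables (R : realType) (d : nat).
Local Notation mu := (@lebesgue_cV R d).
Local Notation L2 := (L2Rd R d).
Local Notation Re := (@complex.Re R).
Local Notation Im := (@complex.Im R).
Local Notation ip := (@ip _ _ _ mu).
Local Notation nrm := (nrm ip).
Local Notation hip := (L2_hilbert mu).

Lemma L2normE (f : L2) : L2norm f = (nrm f)%:E.
Proof.
have /sqiP[_ i1 i2] := sqi_L2 f.
pose h x : R := Re (f x) ^+ 2 + Im (f x) ^+ 2.
have ih : rint mu h by exact: rintD.
have e : (\int[mu]_x (`|(EFin \o (@normc R \o f)) x| `^ 2) = (nrm f ^+ 2)%:E)%E.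
  rewrite (sqr_nrm hip) /ip (Re_inner_self (sqi_L2 f)) -RintegralD// -/h.
  have fin := integrable_fin_num measurableT ih.
  rewrite /Rintegral fineK//; apply: eq_integral => x _ /=.
  by rewrite powR_mulrn// ger0_norm ?normc_ge0// normcE2.
rewrite /L2norm unlock e poweR12_sqrt ?lee_fin ?sqr_ge0//.
by rewrite /= sqrtr_sqr ger0_norm ?nrm_ge0.
Qed.

End l2_norms.

Section gabor_spectrum.
Variables (R : realType) (d : nat) (Lambda : set 'cV[R]_(d + d)).
Hypothesis Lambda_lattice : is_lattice Lambda.
Local Notation mu := (@lebesgue_cV R d).
Local Notation L2 := (L2Rd R d).
Local Notation ip := (@ip _ _ _ mu).
Local Notation nrm := (nrm ip).
Local Notation hip := (L2_hilbert mu).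

Lemma lattice0 : Lambda 0.
Proof. by have [A _ ->] := Lambda_lattice; exists 0; rewrite // map_mx0 mulmx0. Qed.

Lemma latticeD a b : Lambda a -> Lambda b -> Lambda (a + b).
Proof.
have [A _ ->] := Lambda_lattice; move=> [y _ <-] [z _ <-]; exists (y + z) => //.
by rewrite map_mxD mulmxDr.
Qed.

Lemma latticeN a : Lambda a -> Lambda (- a).
Proof.
have [A _ ->] := Lambda_lattice; move=> [y _ <-]; exists (- y) => //.
by rewrite map_mxN mulmxN.
Qed.

Lemma analysis_fun (g f : L2) : analysis g f = (fun l => ip f (U l g)).
Proof. by apply/funext => l; exact: analysisE. Qed.

Lemma besselP (g : L2) : bessel Lambda g <-> exists M, bes ip U Lambda g M.
Proof.
split=> [[M gM]|[M [M0 gM]]].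
  exists `|M|; split=> // f; rewrite -analysis_fun.
  apply/l2normP; rewrite ?mulr_ge0 ?nrm_ge0//.
  apply: le_trans (gM f) _; rewrite L2normE -EFinM lee_fin.
  by rewrite ler_wpM2r ?nrm_ge0 ?ler_norm.
exists M => f; rewrite L2normE -EFinM.
by apply/l2normP; [rewrite mulr_ge0 ?nrm_ge0|rewrite analysis_fun; exact: gM].
Qed.

Lemma frame_opE (g : L2) : frame_op Lambda g = opS ip U Lambda g g.
Proof.
apply/funext => f; rewrite /frame_op /synthesis /opS /synth analysis_fun.
by congr (xget _ _); apply/funext => h; apply/propext; split=> hh k;
  have := hh k; rewrite analysis_fun.
Qed.

(** [t = 0] is left out so that the difference quotients in [gauges] have positive denominators. *)
Definition coordinate_shifts : set ('cV[R]_(d + d) * R) :=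
  [set e | exists2 t, t != 0 & exists j, e = (tv j t, `|t|)]%classic.

Lemma coordinate_shifts_gt0 e : coordinate_shifts e -> 0 < e.2.
Proof. by move=> [t t0 [j ->]]; rewrite normr_gt0. Qed.

Lemma H1LambdaE : H1Lambda Lambda = smooth ip U Lambda coordinate_shifts.
Proof.
apply/seteqP; split=> f [f1 f2]; split.
- by have /H1P[K fK] := f1; exists K => _ [t t0 [j ->]]; exact: fK.
- exact/besselP.
- apply/H1P; have [K fK] := f1; exists K => j t.
  have [->|t0] := eqVneq t 0; last by apply: (fK (tv j t, `|t|)); exists t => //; exists j.
  by rewrite U_tv0 subrr nrm0 ?normr0 ?mulr0//; exact: hip.
- exact/besselP.
Qed.

Lemma test_class_smooth : (test_class `<=` smooth ip U Lambda coordinate_shifts)%classic.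
Proof.
move=> m hm; split.
  have /choice[w mw] : forall j, exists w, test_pair j m w by move=> j; exact: test_pair_exists.
  exists (\sum_j nrm (w j)) => _ [t t0 [j ->]] /=.
  apply: le_trans (gen_lip hip (fun s => U_lin (tv j s)) (fun s => @U_iso R d (tv j s)) (U_tv0 j)
    (U_tvD j) t (test_pair_gen (mw j))) _.
  rewrite ler_wpM2r// (bigD1 j)//= lerDl; apply: sumr_ge0 => i _; exact: nrm_ge0.
have [u [v [hu [hv ->]]]] := hm.
have [M hM] := bes_test hu Lambda_lattice; have [N hN] := bes_test hv Lambda_lattice.
exists (M + normc 'i%C * N); apply: (besD hip (@U_lin R d) hM).
exact: (besZ hip (@U_lin R d)).
Qed.

Lemma smooth_is_dense k e : 0 < e ->
  exists2 m, smooth ip U Lambda coordinate_shifts m & nrm (k - m) <= e.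
Proof.
by move=> e0; have [m hm km] := test_class_dense k e0; exists m => //; exact: test_class_smooth.
Qed.

End gabor_spectrum.

Theorem theorem4p2 (R : realType) (d : nat) (d_gt0 : (0 < d)%N)
    (Lambda : set 'cV[R]_(d + d)) (Lambda_lattice : is_lattice Lambda)
    (g : L2Rd R d) (g_H1 : H1Lambda Lambda g) :
  spectrum_on (H1Lambda Lambda) (frame_op Lambda g) =
  spectrum (frame_op Lambda g).
Proof.
rewrite H1LambdaE in g_H1 *; rewrite frame_opE; apply/seteqP.
have key := smooth_spectrum (L2_hilbert (@lebesgue_cV R d)) (@U_lin R d) (@U_iso R d) (@U_0 R d) (@U_mul R d)
  (lattice0 Lambda_lattice) (latticeD Lambda_lattice) (latticeN Lambda_lattice)
  (@coordinate_shifts_gt0 R d) (@smooth_is_dense R d Lambda Lambda_lattice) g_H1.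
by split=> z /= nz h; apply: nz; apply/key.
Qed.
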